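(* Let $\Lambda$ be an artin algebra and let $\mathcal{C}$ be a functorially finite (full, additive) subcategory of $\mathrm{mod}\,\Lambda$, closed under direct summands and isomorphisms, which is closed under the image of morphisms. Then any family of monomorphisms (resp. epimorphisms) between indecomposable objects in $\mathcal{C}$ is noetherian (resp. conoetherian) if and only if $\mathcal{C}$ is of finite representation type. Specially, any family of monomorphisms (resp. epimorphisms) between indecomposable $\Lambda$-modules in $\mathrm{mod}\,\Lambda$ is noetherian (resp. conoetherian) if and only if $\mathrm{mod}\,\Lambda$ is of finite representation type.
   Context: $\mathrm{mod}\,\Lambda$ is the category of finitely generated left $\Lambda$-modules. Monomorphisms and epimorphisms are understood as those of $\Lambda$-modules. Closed under the image of morphisms means that $\mathrm{Im}\,f\in\mathcal{C}$ for every morphism $f$ in $\mathcal{C}$. A left $\mathcal{C}$-approximation of $X\in\mathrm{mod}\,\Lambda$ is a morphism $\alpha:X\to C$ with $C\in\mathcal{C}$ such that every morphism $X\to C'$ with $C'\in\mathcal{C}$ factors through $\alpha$; right $\mathcal{C}$-approximations are dual. $\mathcal{C}$ is functorially finite if every $X\in\mathrm{mod}\,\Lambda$ has both a left and a right $\mathcal{C}$-approximation. $\mathcal{C}$ is of finite representation type if it has finitely many isomorphism classes of indecomposable objects. A family $\{f_j\}_{j\in J}$ of morphisms in $\mathcal{C}$ is noetherian if for any infinite chain $C_0\xrightarrow{f_{j_1}}C_1\xrightarrow{f_{j_2}}C_2\to\cdots$ of morphisms in the family with $f_{j_i}\cdots f_{j_2}f_{j_1}\ne0$ for all $i$, there is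 $d\ge1$ such that $f_{j_k}$ is an isomorphism for all $k\ge d$. It is conoetherian if for any infinite chain $\cdots\to C_2\xrightarrow{f_{j_2}}C_1\xrightarrow{f_{j_1}}C_0$ of morphisms in the family with $f_{j_1}f_{j_2}\cdots f_{j_i}\neq0$ for all $i$, there is $d\ge1$ such that $f_{j_k}$ is an isomorphism for all $k\ge d$. *)

(* Defs.v *)
From HB Require Import structures.
From mathcomp Require Import all_boot all_order all_algebra.
From mathcomp Require Import boolp.

Set Implicit Arguments.
Unset Strict Implicit.
Unset Printing Implicit Defensive.

Import GRing.Theory.
Local Open Scope ring_scope.

Definition is_ideal (k : comPzRingType) (I : k -> Prop) : Prop :=
  [/\ I 0, forall x y, I x -> I y -> I (x + y) & forall a x, I x -> I (a * x)].

Definition artinian (k : comPzRingType) : Prop :=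
  forall I : nat -> k -> Prop,
    (forall n, is_ideal (I n)) ->
    (forall n x, I n.+1 x -> I n x) ->
    exists n, forall m, (n <= m)%N -> forall x, I m x <-> I n x.

(* [algType k] would exclude the zero algebra, so a [k]-algebra is presented
   by its structure morphism, a ring morphism [phi] with central image; the
   last clause says that [L] is finitely generated as a [k]-module. *)
Definition artin_algebra (L : pzRingType) : Prop :=
  exists (k : comPzRingType) (phi : {rmorphism k -> L}),
    [/\ artinian k,
        forall a x, GRing.comm (phi a) x
      & exists (n : nat) (e : 'I_n -> L),
          forall x, exists c : 'I_n -> k, x = \sum_(i < n) phi (c i) * e i].

Definition fin_gen (L : pzRingType) (M : lmodType L) : Prop :=
  exists (n : nat) (e : 'I_n -> M),
    forall x, exists c : 'I_n -> L, x = \sum_(i < n) c i *: e i.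

Definition zero_module (L : pzRingType) (M : lmodType L) : Prop :=
  forall x : M, x = 0.

(* The set-theoretic inverse of a bijective linear map is linear. *)
Definition isomorphic (L : pzRingType) (M N : lmodType L) : Prop :=
  exists f : {linear M -> N}, bijective f.

Definition surjective (A B : Type) (f : A -> B) : Prop :=
  forall y, exists x, f x = y.

Definition indecomposable (L : pzRingType) (M : lmodType L) : Prop :=
  ~ zero_module M /\
  forall A B : lmodType L,
    isomorphic M (A * B)%type -> zero_module A \/ zero_module B.

Section Image.
Context (L : pzRingType) (M N : lmodType L) (f : {linear M -> N}).

Definition in_image : N -> bool := fun y => `[< exists x, f x = y >].

Lemma in_image_submod : submod_closed in_image.
Proof.
split; first by apply/asboolP; exists 0; rewrite linear0.
move=> a u v /asboolP[x <-] /asboolP[y <-].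
by apply/asboolP; exists (a *: x + y); rewrite linearP.
Qed.

HB.instance Definition _ :=
  GRing.isSubmodClosed.Build L N in_image in_image_submod.

Record lin_image := LinImage { image_val : N; _ : image_val \in in_image }.

HB.instance Definition _ := [isSub for image_val].
HB.instance Definition _ := [Choice of lin_image by <:].
HB.instance Definition _ := [SubChoice_isSubLmodule of lin_image by <:].

End Image.

Section Subcategory.
Context (L : pzRingType) (C : lmodType L -> Prop).

Definition closed_under_isomorphisms : Prop :=
  forall M N : lmodType L, isomorphic M N -> C M -> C N.

Definition additive_subcategory : Prop :=
  (forall M : lmodType L, zero_module M -> C M) /\
  (forall M N : lmodType L, C M -> C N -> C (M * N)%type).

Definition closed_under_summands : Prop :=
  forall M A B : lmodType L, C M -> isomorphic M (A * B)%type -> C A.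

Definition closed_under_images : Prop :=
  forall (M N : lmodType L) (f : {linear M -> N}), C M -> C N -> C (lin_image f).

Definition left_approximation (X A : lmodType L) (a : {linear X -> A}) : Prop :=
  C A /\
  forall (A' : lmodType L) (f : {linear X -> A'}), C A' ->
    exists g : {linear A -> A'}, f =1 g \o a.

Definition right_approximation (X A : lmodType L) (a : {linear A -> X}) : Prop :=
  C A /\
  forall (A' : lmodType L) (f : {linear A' -> X}), C A' ->
    exists g : {linear A' -> A}, f =1 a \o g.

Definition functorially_finite : Prop :=
  forall X : lmodType L, fin_gen X ->
    (exists (A : lmodType L) (a : {linear X -> A}), left_approximation a) /\
    (exists (A : lmodType L) (a : {linear A -> X}), right_approximation a).

Definition finite_representation_type : Prop :=
  exists (n : nat) (N : 'I_n -> lmodType L),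
    forall M : lmodType L, C M -> indecomposable M ->
      exists i, isomorphic M (N i).

End Subcategory.

Record mod_morphism (L : pzRingType) := ModMorphism {
  source : lmodType L;
  target : lmodType L;
  arrow :> {linear source -> target}
}.

Fixpoint chain_comp (L : pzRingType) (X : nat -> lmodType L)
    (g : forall i, {linear X i -> X i.+1}) (i : nat) : X 0%N -> X i :=
  match i with
  | 0 => id
  | i'.+1 => g i' \o chain_comp g i'
  end.
Arguments chain_comp {L X} g i _.

Fixpoint cochain_comp (L : pzRingType) (X : nat -> lmodType L)
    (g : forall i, {linear X i.+1 -> X i}) (i : nat) : X i -> X 0%N :=
  match i with
  | 0 => id
  | i'.+1 => @cochain_comp L X g i' \o g i'
  end.
Arguments cochain_comp {L X} g i _.

(* Chains are indexed from 0: [g i] is the (i+1)-st map of the chain. *)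
Definition noetherian (L : pzRingType) (J : Type) (f : J -> mod_morphism L) :
    Prop :=
  forall (X : nat -> lmodType L) (g : forall i, {linear X i -> X i.+1}),
    (forall i, exists j, f j = ModMorphism (g i)) ->
    (forall i, exists x, chain_comp g i.+1 x <> 0) ->
    exists d, forall k, (d <= k)%N -> bijective (g k).

Definition conoetherian (L : pzRingType) (J : Type) (f : J -> mod_morphism L) :
    Prop :=
  forall (X : nat -> lmodType L) (g : forall i, {linear X i.+1 -> X i}),
    (forall i, exists j, f j = ModMorphism (g i)) ->
    (forall i, exists x, cochain_comp g i.+1 x <> 0) ->
    exists d, forall k, (d <= k)%N -> bijective (g k).

Definition between_indecomposables (L : pzRingType) (C : lmodType L -> Prop)
    (f : mod_morphism L) : Prop :=
  [/\ C (source f), indecomposable (source f),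
      C (target f) & indecomposable (target f)].

Definition monos_noetherian (L : pzRingType) (C : lmodType L -> Prop) : Prop :=
  forall (J : Type) (f : J -> mod_morphism L),
    (forall j, between_indecomposables C (f j) /\ injective (f j)) ->
    noetherian f.

Definition epis_conoetherian (L : pzRingType) (C : lmodType L -> Prop) : Prop :=
  forall (J : Type) (f : J -> mod_morphism L),
    (forall j, between_indecomposables C (f j) /\ surjective (f j)) ->
    conoetherian f.

(* Main.v *)
Require Import Defs.
From mathcomp Require Import all_boot all_order all_algebra.
From HB Require Import structures.
From mathcomp Require Import generic_quotient ring_quotient.
From mathcomp Require Import boolp classical_sets functions.
From mathcomp Require Import zify.

(** Infinite type forces an infinite chain of proper monomorphisms through the
Gabriel-Roiter measure [mu], which assigns to an indecomposable the
lexicographically best set of lengths of a chain of indecomposable submodules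
in [C].  Gabriel's main property says that a monomorphism from an
indecomposable [X] to a direct sum of indecomposables [Y_i] either splits or
satisfies [mu X < mu Y_i] for some [i].  If [K] is a submodule of [X] of
maximal measure, then [X] is a quotient of the target of the left almost split
morphism of [K] in [C], so such [X] have bounded length.  Moreover a class of
indecomposables of bounded length closed under submodules in [C] is finite, by
the Harada-Sai lemma.  Hence, starting from the indecomposables of smallest
measure, the indecomposables form a finitely branching tree under inclusion
that never stops when [C] has infinite type, and Koenig's lemma yields an
infinite chain of proper inclusions.

The argument only uses images, length and left almost split morphisms, so the
statement on epimorphisms is its instance in the opposite category.  Almost
split morphisms of modules come from embedding the simple functor of [N] into
[X |-> Hom_k(Hom(N, X), J)], where [J] is the minimal injective cogenerator of
[k]; approximations transport them to [C]. *)

Set Implicit Arguments.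
Unset Strict Implicit.
Unset Printing Implicit Defensive.

Import Order.TTheory GRing.Theory Num.Theory.
Local Open Scope ring_scope.

(** * Categories with images *)

(** Harada-Sai controls only classes of bounded length closed under submodules, and the siblings in
    the tree need not form such a class. Gabriel's property makes the classes [mu <= c] closed, so
    the tree is first pruned to the [small] objects, those with finitely many indecomposables of no
    larger measure: objects of bounded length take finitely many measures, so a family of small ones
    is covered by a member of largest measure. If proper inclusions cannot go on forever, the pruned
    tree is finite. Were some indecomposable not small, the non-small ones at the roots or just
    above small ones would have bounded length, hence a member of least measure; up to that measure
    all lengths are bounded, so that member would be small after all.

    [C] need not contain kernels or cokernels, so the arguments are cast in terms of images;
    complements, for instance, are images of idempotents. Lengths are taken over [k] rather than
    [L]: passing to functionals into [J] does not increase them, and an injective map into a module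
    of no greater length is bijective. *)

Definition biproduct_eqs (ob : Type) (hom : ob -> ob -> zmodType)
    (idm : forall X, hom X X)
    (comp : forall X Y Z, hom Y Z -> hom X Y -> hom X Z)
    (A B X : ob) (i1 : hom A X) (p1 : hom X A) (i2 : hom B X) (p2 : hom X B) :
    Prop :=
  [/\ comp _ _ _ p1 i1 = idm A, comp _ _ _ p2 i2 = idm B,
      comp _ _ _ p1 i2 = 0, comp _ _ _ p2 i1 = 0
    & comp _ _ _ i1 p1 + comp _ _ _ i2 p2 = idm X].

(* [inj] and [surj] are the monomorphisms and epimorphisms of modules, which
   need not be the categorical ones of the subcategory.  The axioms are
   invariant under passing to the opposite category, exchanging [inj] and
   [surj]. *)
Record imcat := ImCat {
  ob : Type;
  hom : ob -> ob -> zmodType;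
  idm : forall X, hom X X;
  comp : forall X Y Z, hom Y Z -> hom X Y -> hom X Z;
  inj : forall X Y, hom X Y -> Prop;
  surj : forall X Y, hom X Y -> Prop;
  len : ob -> nat;
  compA : forall W X Y Z (h : hom Y Z) (g : hom X Y) (f : hom W X),
    comp h (comp g f) = comp (comp h g) f;
  comp1m : forall X Y (f : hom X Y), comp (idm Y) f = f;
  compm1 : forall X Y (f : hom X Y), comp f (idm X) = f;
  compDl : forall X Y Z (g h : hom Y Z) (f : hom X Y),
    comp (g + h) f = comp g f + comp h f;
  compDr : forall X Y Z (h : hom Y Z) (f g : hom X Y),
    comp h (f + g) = comp h f + comp h g;
  inj_id : forall X, inj (idm X);
  inj_comp : forall X Y Z (g : hom Y Z) (f : hom X Y),
    inj g -> inj f -> inj (comp g f);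
  inj_cancel : forall X Y Z (g : hom Y Z) (f : hom X Y),
    inj (comp g f) -> inj f;
  surj_id : forall X, surj (idm X);
  surj_comp : forall X Y Z (g : hom Y Z) (f : hom X Y),
    surj g -> surj f -> surj (comp g f);
  surj_cancel : forall X Y Z (g : hom Y Z) (f : hom X Y),
    surj (comp g f) -> surj g;
  image_ex : forall X Y (f : hom X Y),
    exists I (m : hom I Y) (e : hom X I), [/\ f = comp m e, inj m & surj e];
  inj_len : forall X Y (f : hom X Y), inj f -> (len X <= len Y)%N;
  inj_iso : forall X Y (f : hom X Y), inj f -> (len Y <= len X)%N ->
    exists g : hom Y X, comp g f = idm X /\ comp f g = idm Y;
  surj_len : forall X Y (f : hom X Y), surj f -> (len Y <= len X)%N;
  surj_iso : forall X Y (f : hom X Y), surj f -> (len X <= len Y)%N ->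
    exists g : hom Y X, comp g f = idm X /\ comp f g = idm Y;
  len0 : forall X, len X = 0%N <-> idm X = 0;
  zero_ex : exists X, idm X = 0;
  biproduct_ex : forall A B, exists X i1 p1 i2 p2,
    @biproduct_eqs ob hom idm comp A B X i1 p1 i2 p2;
  complement_ex : forall A X (s : hom A X) (r : hom X A), comp r s = idm A ->
    exists B s' r', @biproduct_eqs ob hom idm comp A B X s r s' r'
}.

Section ImCat.
Context (C : imcat).
Local Notation ob := (ob C).
Local Notation hom := (@hom C).
Local Notation "g ** f" := (comp g f) (at level 40, left associativity).
Local Notation idm := (@idm C).
Local Notation ell := (@len C).

Implicit Types (A B E I K Q W X Y Z : ob).

Definition biproduct A B X (i1 : hom A X) (p1 : hom X A) (i2 : hom B X)
    (p2 : hom X B) : Prop :=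
  biproduct_eqs idm (@comp C) i1 p1 i2 p2.
Arguments biproduct : clear implicits.

Definition iso X Y (f : hom X Y) : Prop :=
  exists g : hom Y X, g ** f = idm X /\ f ** g = idm Y.
Definition isom X Y : Prop := exists f : hom X Y, iso f.
Definition splitm X Y (f : hom X Y) : Prop := exists r, r ** f = idm X.
Definition zob X : Prop := idm X = 0.
Definition ind X : Prop :=
  ~ zob X /\ forall A B i1 p1 i2 p2, biproduct A B X i1 p1 i2 p2 -> zob A \/ zob B.

Lemma comp0m X Y Z (f : hom X Y) : (0 : hom Y Z) ** f = 0.
Proof. by apply: (addrI (0 ** f)); rewrite -compDl !addr0. Qed.

Lemma compm0 X Y Z (f : hom Y Z) : f ** (0 : hom X Y) = 0.
Proof. by apply: (addrI (f ** 0)); rewrite -compDr !addr0. Qed.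

Lemma compBr X Y Z (h : hom Y Z) (f g : hom X Y) :
  h ** (f - g) = h ** f - h ** g.
Proof. by apply/eqP; rewrite eq_sym subr_eq -compDr subrK. Qed.

Lemma zob_dom X Y (f : hom X Y) : zob X -> f = 0.
Proof. by move=> X0; rewrite -[f]compm1 X0 compm0. Qed.

Lemma zob_cod X Y (f : hom X Y) : zob Y -> f = 0.
Proof. by move=> X0; rewrite -[f]comp1m X0 comp0m. Qed.

Lemma iso_inj X Y (f : hom X Y) : iso f -> inj f.
Proof. by move=> [g [gf _]]; apply: (@inj_cancel _ _ _ _ g); rewrite gf;
  apply: inj_id. Qed.

Lemma iso_surj X Y (f : hom X Y) : iso f -> surj f.
Proof. by move=> [g [_ fg]]; apply: (@surj_cancel _ _ _ _ _ g); rewrite fg;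
  apply: surj_id. Qed.

Lemma split_inj X Y (f : hom X Y) : splitm f -> inj f.
Proof. by move=> [g gf]; apply: (@inj_cancel _ _ _ _ g); rewrite gf; apply: inj_id. Qed.

Lemma iso_id X : iso (idm X).
Proof. by exists (idm X); rewrite !comp1m. Qed.

Lemma iso_comp X Y Z (g : hom Y Z) (f : hom X Y) : iso g -> iso f -> iso (g ** f).
Proof.
move=> [g' [g1 g2]] [f' [f1 f2]]; exists (f' ** g').
by rewrite compA -[f' ** g' ** g]compA g1 compm1 f1 compA -[g ** f ** f']compA f2 compm1.
Qed.

Lemma iso_split X Y (f : hom X Y) : iso f -> splitm f.
Proof. by move=> [g [gf _]]; exists g. Qed.

Lemma iso_cancel X Y Z (g : hom Y Z) (f : hom X Y) :
  iso f -> iso (g ** f) -> iso g.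
Proof.
move=> [f' [f1 f2]] [h [h1 h2]]; exists (f ** h).
split; last by rewrite compA.
have E : h ** g = f' by rewrite -[g]compm1 -f2 !compA -[h ** g ** f]compA h1 comp1m.
by rewrite -compA E.
Qed.

Lemma isom_refl X : isom X X.
Proof. by exists (idm X); apply: iso_id. Qed.

Lemma isom_sym X Y : isom X Y -> isom Y X.
Proof. by move=> [f [g [gf fg]]]; exists g, f. Qed.

Lemma isom_trans X Y Z : isom X Y -> isom Y Z -> isom X Z.
Proof. by move=> [f fi] [g gi]; exists (g ** f); apply: iso_comp. Qed.

Lemma isom_len X Y : isom X Y -> ell X = ell Y.
Proof.
move=> XY; have /isom_sym[g /iso_inj/inj_len gi] := XY.
by case: XY => f /iso_inj/inj_len fi; apply/eqP; rewrite eqn_leq fi gi.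
Qed.

Lemma split_cancel X Y Z (g : hom Y Z) (f : hom X Y) : splitm (g ** f) -> splitm f.
Proof. by move=> [r rg]; exists (r ** g); rewrite -compA. Qed.

(** [Y] splits into [X] and a complement; since [X] is nonzero, the complement vanishes. *)
Lemma split_ind_iso X Y (f : hom X Y) : ~ zob X -> ind Y -> splitm f -> iso f.
Proof.
move=> X0 [_ Yi] [r rf]; have [B [s' [r' bip]]] := complement_ex rf.
have [//|B0] := Yi _ _ _ _ _ _ bip; exists r; split=> //.
by case: bip => _ _ _ _; rewrite (zob_dom s' B0) comp0m addr0.
Qed.


Lemma isom_zob X Y : isom X Y -> zob X -> zob Y.
Proof. by move=> [f [g [gf fg]]] X0; rewrite /zob -fg (zob_dom f X0) comp0m. Qed.

Lemma biproduct_isom A B X Y i1 p1 i2 p2 : isom X Y ->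
  biproduct A B X i1 p1 i2 p2 -> exists j1 q1 j2 q2, biproduct A B Y j1 q1 j2 q2.
Proof.
move=> [f [g [gf fg]]] [e1 e2 e3 e4 e5].
exists (f ** i1), (p1 ** g), (f ** i2), (p2 ** g).
have E U V (p : hom X U) (i : hom V X) : p ** g ** (f ** i) = p ** i.
  by rewrite compA -[p ** g ** f]compA gf compm1.
split; rewrite ?E // !compA -[f ** i1 ** p1]compA -[f ** i2 ** p2]compA.
by rewrite -compDl -compDr e5 compm1.
Qed.

Lemma isom_ind X Y : isom X Y -> ind X -> ind Y.
Proof.
move=> XY [X0 Xi]; split; first by move=> /(isom_zob (isom_sym XY)).
move=> A B i1 p1 i2 p2 bip.
by have [? [? [? [? /Xi]]]] := biproduct_isom (isom_sym XY) bip.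
Qed.

(* Up to isomorphism, [dec P X] says that [X] is a finite direct sum of
   objects satisfying [P]. *)
Inductive dec (P : ob -> Prop) : ob -> Prop :=
| dec_zob X : zob X -> dec P X
| dec_base X : P X -> dec P X
| dec_sum A B X i1 p1 i2 p2 : biproduct A B X i1 p1 i2 p2 ->
    dec P A -> dec P B -> dec P X.

Lemma dec_mono (P Q : ob -> Prop) X : (forall Z, P Z -> Q Z) -> dec P X -> dec Q X.
Proof.
move=> PQ; elim=> [{}X X0|{}X /PQ PX|A B {}X i1 p1 i2 p2 bip _ dA _ dB].
- exact: dec_zob.
- exact: dec_base.
- exact: dec_sum bip dA dB.
Qed.

Lemma biproduct_split1 A B X i1 p1 i2 p2 :
  biproduct A B X i1 p1 i2 p2 -> splitm i1.
Proof. by case=> e1 *; exists p1. Qed.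
Lemma biproduct_split2 A B X i1 p1 i2 p2 :
  biproduct A B X i1 p1 i2 p2 -> splitm i2.
Proof. by case=> _ e2 *; exists p2. Qed.

Lemma biproduct_sym A B X i1 p1 i2 p2 :
  biproduct A B X i1 p1 i2 p2 -> biproduct B A X i2 p2 i1 p1.
Proof. by case=> *; split; rewrite // addrC. Qed.

Lemma biproduct_len1 A B X i1 p1 i2 p2 :
  biproduct A B X i1 p1 i2 p2 -> ~ zob B -> (ell A < ell X)%N.
Proof.
move=> bip B0; rewrite ltnNge; apply/negP => le.
have /split_inj ii1 := biproduct_split1 bip.
have [g [gi ig]] := inj_iso ii1 le; case: bip => e1 e2 e3 _ _; apply: B0.
have gp : g = p1 by rewrite -[p1]compm1 -ig compA e1 comp1m.
by rewrite /zob -e2 -[i2]comp1m -ig gp -compA e3 !compm0.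
Qed.

(** Summands are split off by induction on length. Their embeddings into [X] are recorded because
    later uses bound their lengths and measures through them. *)
Lemma ind_dec X : dec (fun Z => ind Z /\ exists z : hom Z X, inj z) X.
Proof.
have [n] := ubnP (ell X); elim: n X => // n IHn X ltX.
have [X0|X0] := pselect (zob X); first exact: dec_zob.
have [Xi|Xi] := pselect (ind X).
  by apply: dec_base; split=> //; exists (idm X); apply: inj_id.
have [A [B [i1 [p1 [i2 [p2 [bip A0 B0]]]]]]] : exists A B i1 p1 i2 p2,
    [/\ biproduct A B X i1 p1 i2 p2, ~ zob A & ~ zob B].
  apply: contrapT => H; apply: Xi; split=> // A B i1 p1 i2 p2 bip.
  apply: contrapT => /not_orP[A0 B0]; apply: H.
  by exists A, B, i1, p1, i2, p2.
have bip' := biproduct_sym bip.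
have lA := biproduct_len1 bip B0; have lB := biproduct_len1 bip' A0.
apply: (dec_sum bip).
- have := IHn A (leq_trans lA ltX); apply: dec_mono => Z [Zi [z zi]]; split=> //.
  by exists (i1 ** z); apply: inj_comp => //; apply: split_inj;
    apply: biproduct_split1 bip.
- have := IHn B (leq_trans lB ltX); apply: dec_mono => Z [Zi [z zi]]; split=> //.
  by exists (i2 ** z); apply: inj_comp => //; apply: split_inj;
    apply: biproduct_split2 bip.
Qed.

Lemma dec_nonzero P X : dec P X -> ~ zob X -> exists Z, P Z.
Proof.
elim=> [{}X X0 //|{}X PX _|A B {}X i1 p1 i2 p2 bip _ IA _ IB X0]; first by exists X.
have [A0|/IA //] := pselect (zob A); have [B0|/IB //] := pselect (zob B).
case: X0; case: bip => _ _ _ _.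
by rewrite (zob_dom i1 A0) (zob_dom i2 B0) !comp0m addr0 => /esym.
Qed.

Lemma nonzero_ind_sub X : ~ zob X -> exists Z, ind Z /\ exists z : hom Z X, inj z.
Proof. exact/dec_nonzero/ind_dec. Qed.

(** * Rank of morphisms and the Harada-Sai lemma *)

Definition rank_le X Y (f : hom X Y) (r : nat) : Prop :=
  exists I (m : hom I Y) (e : hom X I), f = m ** e /\ (ell I <= r)%N.

Lemma rank_le0 X Y (f : hom X Y) : rank_le f 0 -> f = 0.
Proof.
move=> [I [m [e [-> ]]]]; rewrite leqn0 => /eqP/len0 I0.
by rewrite (zob_dom m I0) comp0m.
Qed.

(** If the image of [q ** g ** m] had length [r.+1], no length would be lost between [I] and [K], so
    this composite would be invertible. Then [m] splits in the indecomposable [W], hence is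
    invertible, so [q ** g] is invertible too, and [g] splits in the indecomposable [X]: it would be
    an isomorphism. *)
Lemma rank_drop V W X Y (f : hom V W) (g : hom W X) (h : hom X Y) r :
  ind W -> ind X -> ~ iso g -> rank_le f r.+1 -> rank_le h r.+1 ->
  rank_le (h ** g ** f) r.
Proof.
move=> Wi Xi gN [I [m [e [-> lI]]]] [K [n [q [-> lK]]]].
have [I' [m' [e' [E' m'i e's]]]] := image_ex (q ** g).
have [J [u [v [E ui vs]]]] := image_ex (e' ** m).
have lJ : n ** q ** g ** (m ** e) = n ** m' ** u ** (v ** e).
  rewrite -[n ** q ** g]compA E' -!compA; congr (n ** _).
  by rewrite !compA -[m' ** e' ** m]compA E !compA.
have [leJ|ltJ] := leqP (ell J) r; first by exists J, (n ** m' ** u), (v ** e).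
have lI' : (ell I' <= r.+1)%N by rewrite (leq_trans (inj_len m'i)).
have [u' [u1 u2]] := inj_iso ui (leq_trans lI' ltJ).
have [v' [v1 v2]] := surj_iso vs (leq_trans lI ltJ).
have lK' : (ell K <= ell I')%N by exact: leq_trans lK (leq_trans ltJ (inj_len ui)).
have m'iso := inj_iso m'i lK'.
have J0 : ~ zob J by move=> /len0 J0; rewrite J0 in ltJ.
have I0 : ~ zob I by move=> I0; apply: J0; apply: isom_zob I0; exists v, v'.
have emiso : iso (e' ** m) by rewrite E; apply: iso_comp; [exists u' | exists v'].
have miso : iso m by apply: split_ind_iso => //;
  apply/(@split_cancel _ _ _ e')/iso_split.
have e'iso : iso e' by apply: (iso_cancel miso).
have W0 : ~ zob W by case: Wi.
case: gN; apply: split_ind_iso => //; apply: (@split_cancel _ _ _ q).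
by rewrite E'; apply/iso_split/iso_comp.
Qed.

Inductive noniso_chain (b : nat) : nat -> forall X Y, hom X Y -> Prop :=
| noniso_chain0 X : ind X -> (ell X <= b)%N -> noniso_chain b 0 (idm X)
| noniso_chainS n X Y Z (g : hom Y Z) (f : hom X Y) :
    noniso_chain b n f -> ind Z -> (ell Z <= b)%N -> ~ iso g ->
    noniso_chain b n.+1 (g ** f).

Lemma noniso_chain_cod b n X Y (f : hom X Y) :
  noniso_chain b n f -> ind Y /\ (ell Y <= b)%N.
Proof. by case. Qed.

Lemma noniso_chain_cat b m n X Z (f : hom X Z) : noniso_chain b (m + n) f ->
  exists Y (h : hom Y Z) (g : hom X Y),
    [/\ f = h ** g, noniso_chain b n g & noniso_chain b m h].
Proof.
elim: m X Z f => [|m IHm] X Z f; rewrite ?add0n ?addSn.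
  move=> cf; have [Zi lZ] := noniso_chain_cod cf; exists Z, (idm Z), f.
  by split; rewrite ?comp1m //; apply: noniso_chain0.
move En: (m + n).+1 => l cf; case: cf En => // {}l X' Y' Z' g {}f cf Zi lZ gN [] E.
rewrite -E in cf; have [Y [h [g' [-> cg ch]]]] := IHm _ _ _ cf.
by exists Y, (g ** h), g'; rewrite compA; split=> //; apply: noniso_chainS.
Qed.

(** Two chains with composites of rank at most s, joined by one more non-isomorphism, have a
    composite of rank below s by [rank_drop]. The required number of maps thus goes from n to 2n + 1
    at each drop, which gives 2^b - 1. *)
Lemma harada_sai b : exists n, forall X Y (f : hom X Y), noniso_chain b n f -> f = 0.
Proof.
suff /(_ b (leqnn b)) [n Hn] : forall r, (r <= b)%N -> exists n,
  forall X Y (f : hom X Y),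
    noniso_chain b n f -> rank_le f (b - r).
  by exists n => X Y f /Hn; rewrite subnn => /rank_le0.
elim=> [_|r IHr lrb].
  exists 0%N => X Y f /noniso_chain_cod[_ lY]; rewrite subn0.
  by exists Y, (idm Y), f; rewrite comp1m.
have [n Hn] := IHr (ltnW lrb); exists (n + n.+1)%N => X Y f.
move=> /noniso_chain_cat[Z [h [g [-> cg ch]]]].
move En: n.+1 cg => m cg.
case: cg En h ch => // {}m X' Y' Z' g' f' cf' Z'i lZ' gN [Em] h ch.
rewrite -Em in cf'; have [Y'i _] := noniso_chain_cod cf'.
rewrite compA; apply: rank_drop => //; (rewrite subnSK //; exact: Hn).
Qed.

(** Harada-Sai replaces Fitting's lemma: the powers of a non-isomorphism [a] are composites of
    non-isomorphisms between copies of [X], so [a] is nilpotent and the geometric series is a left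
    inverse of [b = 1 - a]. *)
Lemma ind_local X (a b : hom X X) : ind X -> a + b = idm X -> iso a \/ iso b.
Proof.
move=> Xi ab1; have [ai|aN] := pselect (iso a); [by left | ].
have [n Hn] := harada_sai (ell X).
pose pw i := iter i (comp a) (idm X).
have cpw i : noniso_chain (ell X) i (pw i).
  by elim: i => [|i IHi] /=; [apply: noniso_chain0 | apply: noniso_chainS].
have Ea : b = idm X - a by rewrite -ab1 addrC addKr.
have Ca i : a ** pw i = pw i ** a.
  by elim: i => [|i IHi] /=; rewrite ?compm1 ?comp1m // -compA -IHi.
suff [c Hc] : exists c, c ** b = idm X - pw n.
  right; apply: split_ind_iso => //; first by case: Xi.
  by exists c; rewrite Hc (Hn _ _ _ (cpw n)) subr0.
elim: n {Hn} => [|i [c Hc]] /=; first by exists 0; rewrite comp0m subrr.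
exists (c + pw i); rewrite compDl Hc Ea compBr compm1 -Ca.
by rewrite addrA subrK.
Qed.

Lemma splitm_biproduct K A B X i1 p1 i2 p2 (f : hom K X) : ind K ->
  biproduct A B X i1 p1 i2 p2 -> splitm f -> splitm (p1 ** f) \/ splitm (p2 ** f).
Proof.
move=> Ki [_ _ _ _ e5] [r rf].
have E : r ** i1 ** (p1 ** f) + r ** i2 ** (p2 ** f) = idm K.
  by rewrite -!compA -compDr !compA -compDl e5 comp1m.
by have [/iso_split/split_cancel|/iso_split/split_cancel] := ind_local Ki E;
  [left|right].
Qed.

(** The exchange half of Krull-Schmidt: locality of [End K] pushes a split monomorphism into one of
    two summands, until a single indecomposable is left. *)
Lemma dec_retract P K X (f : hom K X) : (forall Z, P Z -> ind Z) ->
  ind K -> dec P X -> splitm f -> exists Z, P Z /\ isom K Z.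
Proof.
move=> Pi Ki; have K0 : ~ zob K by case: Ki.
move=> dX; elim: dX f => [{}X X0|{}X PX|A B {}X i1 p1 i2 p2 bip _ IA _ IB] f fs.
- by case: fs => r rf; case: K0; rewrite /zob -rf (zob_cod f X0) compm0.
- by exists X; split=> //; exists f; apply: split_ind_iso => //; apply: Pi.
- by have [/IA|/IB] := splitm_biproduct Ki bip fs.
Qed.

End ImCat.

(** * The Gabriel-Roiter measure *)

Section GabrielRoiter.
Context (C : imcat).
Local Notation ob := (ob C).
Local Notation hom := (@hom C).
Local Notation "g ** f" := (comp g f) (at level 40, left associativity).
Local Notation idm := (@idm C).
Local Notation ell := (@len C).

Implicit Types (A B E I K Q W X Y Z : ob).

Definition weight (n : nat) : rat := (2 ^+ n)^-1.

Lemma weight_gt0 n : 0 < weight n.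
Proof. by rewrite invr_gt0 exprn_gt0. Qed.

Lemma weightD m n : weight m = (2 ^+ n) * weight (n + m).
Proof. by rewrite /weight exprD invfM mulrA divff ?mul1r // expf_neq0. Qed.

Lemma weight_lt m n : (m < n)%N -> weight n < weight m.
Proof.
move=> mn; rewrite (weightD m (n - m)) subnK 1?ltnW // ltr_pMl ?weight_gt0 //.
by rewrite exprn_egt1 // subn_eq0 -ltnNge.
Qed.

(* Ordering finite sets [I] of lengths by [\sum_(i in I) 2 ^- i] is the
   Gabriel-Roiter order: [I < J] iff the least element of their symmetric
   difference is in [J]. *)
Inductive gr_chain : ob -> rat -> Prop :=
| gr_chain1 X : gr_chain X (weight (ell X))
| gr_chainS X' X (f : hom X' X) q : ind X' -> inj f -> ~ iso f ->
    gr_chain X' q -> gr_chain X (q + weight (ell X)).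

Lemma proper_len X Y (f : hom X Y) : inj f -> ~ iso f -> (ell X < ell Y)%N.
Proof. by move=> fi fN; rewrite ltnNge; apply/negP => /(inj_iso fi). Qed.

(** Lengths increase strictly along a chain, so its sum is at most 2 minus the last weight; this
    slack absorbs the next weight, which is at most half the last one. Hence the measures of objects
    of length at most [n] are finitely many multiples of [weight n], and extremal measures exist. *)
Lemma gr_chain_nat X q n : gr_chain X q -> (ell X <= n)%N ->
  exists2 v, (v + 2 ^ (n - ell X) <= 2 ^ n.+1)%N & q = v%:R * weight n.
Proof.
move=> cX; elim: cX n => [{}X|X' {}X f {}q _ fi fN _ IH] n ln.
  exists (2 ^ (n - ell X))%N.
    by rewrite addnn -mul2n -expnS leq_exp2l // ltnS leq_subr.
  by rewrite natrX (weightD (ell X) (n - ell X)) subnK.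
have lt := proper_len fi fN; have n0 : (0 < n)%N by lia.
have [v vlt ->] := IH (n.-1) ltac:(lia); rewrite prednK // in vlt.
exists (v * 2 + 2 ^ (n - ell X))%N.
  have : (2 ^ (n - ell X) <= 2 ^ (n.-1 - ell X'))%N by rewrite leq_exp2l //; lia.
  by rewrite expnS; lia.
rewrite natrD mulrDl natrX; congr (_ + _);
  last by rewrite (weightD (ell X) (n - ell X)) subnK.
by rewrite (weightD n.-1 1) add1n prednK ?natrM ?mulrA //; lia.
Qed.

Definition mu X : rat :=
  xget 0 [set q | gr_chain X q /\ forall q', gr_chain X q' -> q' <= q].

Lemma muP X : gr_chain X (mu X) /\ forall q, gr_chain X q -> q <= mu X.
Proof.
suff H : exists q, gr_chain X q /\ forall q', gr_chain X q' -> q' <= q.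
  exact: (xgetPex 0 H).
pose P v := `[< gr_chain X (v%:R * weight (ell X)) >].
have P1 : exists v, P v by exists 1%N; apply/asboolP; rewrite mul1r; apply: gr_chain1.
have Pb v : P v -> (v <= 2 ^ (ell X).+1)%N.
  move=> /asboolP /gr_chain_nat/(_ (leqnn _)) [w /(leq_trans (leq_addr _ _)) wlt].
  have w0 : weight (ell X) != 0 by rewrite gt_eqF // weight_gt0.
  by move=> /(mulIf w0)/eqP; rewrite eqr_nat => /eqP->.
case: (ex_maxnP P1 Pb) => v /asboolP cv vmax; exists (v%:R * weight (ell X)).
split=> // q' cq'; have [w _ E] := gr_chain_nat cq' (leqnn _).
rewrite E ler_pM2r ?weight_gt0 // ler_nat vmax //; apply/asboolP; by rewrite -E.
Qed.

Lemma mu_ge X : weight (ell X) <= mu X.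
Proof. by apply: (muP X).2; apply: gr_chain1. Qed.

Lemma mu_proper X Y (f : hom X Y) : ind X -> inj f -> ~ iso f ->
  mu X + weight (ell Y) <= mu Y.
Proof. by move=> Xi fi fN; apply: (muP Y).2; apply: gr_chainS Xi fi fN (muP X).1. Qed.

Lemma mu_proper_lt X Y (f : hom X Y) : ind X -> inj f -> ~ iso f -> mu X < mu Y.
Proof.
by move=> Xi fi fN; apply: lt_le_trans (mu_proper Xi fi fN); rewrite ltrDl weight_gt0.
Qed.

Lemma gr_chain_isom X Y q : isom X Y -> gr_chain X q -> gr_chain Y q.
Proof.
move=> XY cX; case: cX XY => [{}X|X' {}X f {}q X'i fi fN cX'] XY.
  by rewrite (isom_len XY); apply: gr_chain1.
rewrite (isom_len XY); case: XY => g giso.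
apply: (@gr_chainS X' Y (g ** f)) => //; first by apply: inj_comp => //; apply: iso_inj.
move=> gf; apply: fN; case: giso => h [hg gh].
have -> : f = h ** (g ** f) by rewrite compA hg comp1m.
by apply: iso_comp => //; exists g.
Qed.

Lemma mu_isom X Y : isom X Y -> mu X = mu Y.
Proof.
move=> XY; apply/eqP; rewrite eq_le; apply/andP; split; apply: (muP _).2.
  exact: gr_chain_isom XY (muP X).1.
exact: gr_chain_isom (isom_sym XY) (muP Y).1.
Qed.

Lemma mu_sub X Y (f : hom X Y) : ind X -> inj f -> mu X <= mu Y.
Proof.
move=> Xi fi; have [fiso|fN] := pselect (iso f); last exact/ltW/(mu_proper_lt Xi fi fN).
by rewrite (@mu_isom X Y) //; exists f.
Qed.

(** A Gabriel-Roiter submodule: by [mu_proper] the equality says that [X] has the largest measure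
    among the proper indecomposable subobjects of [Y]. *)
Definition gr_sub X Y : Prop :=
  ind X /\ (exists f : hom X Y, inj f /\ ~ iso f) /\ mu Y = mu X + weight (ell Y).

Lemma mu_cases X : mu X = weight (ell X) \/ exists X', gr_sub X' X.
Proof.
have : gr_chain X (mu X) := (muP X).1.
move Eq: (mu X) => q cX; case: cX Eq => [{}X|X' {}X f {}q X'i fi fN cX'] Eq;
  [by left | right].
exists X'; split; [by []|split; first by exists f].
by apply/eqP; rewrite eq_le (mu_proper X'i fi fN) andbT Eq lerD2r (muP X').2.
Qed.

(** Objects shorter than [X] have measures that are multiples of [weight n] for [n = ell X - 1], so
    two distinct ones differ by at least [weight n], which exceeds [weight (ell X)]. *)
Lemma mu_gap X X' Z : (ell X' < ell X)%N -> (ell Z < ell X)%N ->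
  mu X' < mu Z -> mu X' + weight (ell X) < mu Z.
Proof.
move=> lX' lZ; set n := (ell X).-1.
have En : ell X = n.+1 by rewrite prednK //; lia.
have [v _ ->] := gr_chain_nat (muP X').1 (n := n) ltac:(lia).
have [w _ ->] := gr_chain_nat (muP Z).1 (n := n) ltac:(lia).
rewrite ltr_pM2r ?weight_gt0 // ltr_nat => vw.
have : (v.+1%:R * weight n <= w%:R * weight n) by rewrite ler_pM2r ?weight_gt0 ?ler_nat.
apply: lt_le_trans; rewrite -natr1 mulrDl mul1r ltrD2l En.
exact: weight_lt.
Qed.

(* Gabriel's main property of the Gabriel-Roiter measure. *)
Lemma mu_main X : ind X -> forall Y (f : hom X Y) (P : ob -> Prop), inj f ->
  (forall Z, P Z -> ind Z) -> dec P Y ->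
  (exists Z, P Z /\ mu X < mu Z) \/ splitm f.
Proof.
have [n] := ubnP (ell X); elim: n X => // n IHn X ltX Xi Y f P fi Pi dY.
have X0 : ~ zob X by case: Xi.
pose out := exists Z, P Z /\ mu X < mu Z.
(* [Y] is replaced by a sum of objects satisfying [R]: summands of images of the components of [f].
   Being shorter than [X], they make the induction on length and [mu_gap] available. *)
pose R Z := ind Z /\ (ell Z < ell X)%N /\ exists Z', P Z' /\ mu Z <= mu Z'.
have : (out \/ splitm f) \/
    exists I (g : hom X I) (m : hom I Y), f = m ** g /\ dec R I.
  (* Injectivity is forgotten before the induction over the summands, since the components of [f]
     need not be injective. An injective component settles the claim at once; any other has an image
     shorter than [X]. *)
  have {fi} : inj f \/ True by left.
  elim: dY f => [{}Y Y0|{}Y PY|A B {}Y i1 p1 i2 p2 bip _ IA _ IB] f _.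
  - by right; exists Y, f, (idm Y); rewrite comp1m; split=> //; apply: dec_zob.
  - have [fi|fN] := pselect (inj f).
      left; have [fiso|fN] := pselect (iso f); [right; exact: iso_split|left].
      by exists Y; split=> //; apply: mu_proper_lt fN.
    right; have [I [m [e [E mi es]]]] := image_ex f.
    have lI : (ell I < ell X)%N.
      rewrite ltnNge; apply/negP => /(surj_iso es) eiso; apply: fN.
      by rewrite E; apply: inj_comp => //; apply: iso_inj.
    exists I, e, m; split=> //; apply: dec_mono (ind_dec I) => Z [Zi [z zi]].
    split=> //; split; first exact: leq_ltn_trans (inj_len zi) lI.
    by exists Y; split=> //; apply: mu_sub Zi (inj_comp mi zi).
  - have [[[o|fs]|[I [g [m [E dI]]]]] _] := (IA (p1 ** f) (or_intror I), Logic.I).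
    + by left; left.
    + by left; right; apply: split_cancel fs.
    have [[o|fs]|[I' [g' [m' [E' dI']]]]] := IB (p2 ** f) (or_intror Logic.I).
    + by left; left.
    + by left; right; apply: split_cancel fs.
    right; have [J [j1 [q1 [j2 [q2 bip']]]]] := biproduct_ex I I'.
    exists J, (j1 ** g + j2 ** g'), (i1 ** m ** q1 + i2 ** m' ** q2).
    split; last exact: dec_sum bip' dI dI'.
    case: bip' => e1 e2 e3 e4 _; case: bip => _ _ _ _ e5.
    rewrite compDl !compDr !compA -![_ ** q1 ** j1]compA -![_ ** q1 ** j2]compA.
    rewrite -![_ ** q2 ** j1]compA -![_ ** q2 ** j2]compA e1 e2 e3 e4 !compm1 !compm0 !comp0m.
    by rewrite addr0 add0r -!compA -E -E' !compA -compDl e5 comp1m.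
case=> // -[I [g [m [E dI]]]]; have gi : inj g by apply: (@inj_cancel _ _ _ _ m);
  rewrite -E.
have I0 : ~ zob I by move=> /len0 I0; apply: X0; apply/len0; have := inj_len gi;
  rewrite I0 leqn0 => /eqP.
have RI Z : R Z -> ind Z by case.
have [muX|[X' [X'i [[x [xi xN]] muX]]]] := mu_cases X.
  (* Here [mu X] is the single weight of [X], and any summand of [I], being shorter, already weighs
     more. *)
  have [Z [_ [lZ [Y' [PY' ZY']]]]] := dec_nonzero dI I0.
  left; exists Y'; split=> //; apply: lt_le_trans ZY'; rewrite muX.
  exact: lt_le_trans (weight_lt lZ) (mu_ge Z).
have lX' := proper_len xi xN.
(* Induction applies to the Gabriel-Roiter submodule [X'] inside [I]. It cannot split there, as it
   would split in [X]; so some summand has larger measure than [X'], and by the gap also larger than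
   [X]. *)
have [[Z [[_ [lZ [Y' [PY' ZY']]]] ltZ]]|] :=
    IHn _ (leq_trans lX' ltX) X'i _ _ _ (inj_comp gi xi) RI dI.
  left; exists Y'; split=> //; apply: lt_le_trans ZY'; rewrite muX.
  exact: mu_gap.
by move=> /split_cancel/(split_ind_iso _ Xi) xiso; case: xN; apply: xiso; case: X'i.
Qed.

End GabrielRoiter.

(** * Finite type *)

Section FiniteType.
Context (C : imcat).
Local Notation ob := (ob C).
Local Notation hom := (@hom C).
Local Notation "g ** f" := (comp g f) (at level 40, left associativity).
Local Notation idm := (@idm C).
Local Notation ell := (@len C).

Implicit Types (A B E I K Q W X Y Z : ob) (P D : ob -> Prop).

Definition fin_isom P : Prop :=
  exists s : seq ob, forall X, P X -> exists Y, List.In Y s /\ isom X Y.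

Lemma fin_isom_sub P P' : (forall X, P X -> P' X) -> fin_isom P' -> fin_isom P.
Proof. by move=> PP' [s Hs]; exists s => X /PP'/Hs. Qed.

Lemma fin_isom0 P : (forall X, ~ P X) -> fin_isom P.
Proof. by move=> P0; exists [::] => X /P0. Qed.

Lemma fin_isomU P P' : fin_isom P -> fin_isom P' -> fin_isom (fun X => P X \/ P' X).
Proof.
move=> [s Hs] [s' Hs']; exists (s ++ s') => X [/Hs|/Hs'] [Y [Ys XY]]; exists Y.
  by split=> //; apply/List.in_or_app; left.
by split=> //; apply/List.in_or_app; right.
Qed.

Lemma fin_isom1 Y : fin_isom (isom Y).
Proof. by exists [:: Y] => X YX; exists Y; split; [left | apply: isom_sym]. Qed.

(** A listed representative may fail [P], so it is traded for an isomorphic member of [P], if there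
    is one, before its fibre is used. *)
Lemma fin_isom_bigU P (R : ob -> ob -> Prop) : fin_isom P ->
  (forall Y Y' X, isom Y Y' -> R Y X -> R Y' X) ->
  (forall Y, P Y -> fin_isom (R Y)) -> fin_isom (fun X => exists Y, P Y /\ R Y X).
Proof.
move=> [s]; elim: s P => [|Y0 s IHs] P Hs Riso Rfin.
  by apply: fin_isom0 => X [Y [/Hs[? [[]]]]].
have f1 : fin_isom (fun X => exists Y, (P Y /\ ~ isom Y Y0) /\ R Y X).
  apply: IHs => //; last by move=> Y [/Rfin].
  move=> X [/Hs[Y [[<-|Ys] XY]] N]; first by case: N.
  by exists Y.
have [[Y [PY Y0Y]]|N] := pselect (exists Y, P Y /\ isom Y Y0).
  apply: fin_isom_sub (fin_isomU f1 (Rfin _ PY)) => X [Y' [PY' RX]].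
  have [i|i] := pselect (isom Y' Y0); last by left; exists Y'.
  by right; apply: Riso RX; apply: isom_trans i _; apply: isom_sym.
apply: fin_isom_sub f1 => X [Y' [PY' RX]]; exists Y'; split=> //; split=> //.
by move=> i; apply: N; exists Y'.
Qed.

Definition left_almost_split : Prop := forall K, ind K ->
  exists E (g : hom K E), ~ splitm g /\
    forall X (h : hom K X), ~ splitm h -> exists h' : hom E X, h = h' ** g.

Context (las : left_almost_split) (C0 : ob).
Context (C0P : forall X, ~ zob X -> exists f : hom C0 X, f <> 0).

(** * Finiteness of classes of bounded length *)

Section Bounded.
Context (D : ob -> Prop) (b : nat).
Context (Dind : forall X, D X -> ind X).
Context (Dsub : forall X Y (f : hom X Y), ind X -> inj f -> dec D Y -> D X).
Context (Dlen : forall X, D X -> (ell X <= b)%N).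

(** A left approximation of [E] by sums of objects of [D]: take a longest quotient [Q] of [E] that
    is such a sum. The image of [E] in the sum of [Q] and [X] is again one and maps onto [Q], so it
    is no longer than [Q], and [h] factors through [q]. *)
Lemma largest_quotient E : exists Q (q : hom E Q), dec D Q /\
  forall X (h : hom E X), D X -> exists h' : hom Q X, h = h' ** q.
Proof.
pose P n := `[< exists Q (q : hom E Q), [/\ dec D Q, surj q & ell Q = n] >].
have [Z Z0] := zero_ex C.
have P1 : exists n, P n.
  have [I [m [e [_ mi es]]]] := image_ex (0 : hom E Z).
  have I0 : zob I.
    by apply/len0/eqP; rewrite -leqn0 -((len0 Z).2 Z0) (inj_len mi).
  by exists (ell I); apply/asboolP; exists I, e; split=> //; apply: dec_zob.
have Pb n : P n -> (n <= ell E)%N by move=> /asboolP[Q [q [_ qs <-]]];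
  apply: surj_len qs.
case: (ex_maxnP P1 Pb) => n /asboolP[Q [q [dQ qs lQ]]] nmax.
exists Q, q; split=> // X h DX.
have [Y [i1 [p1 [i2 [p2 bip]]]]] := biproduct_ex Q X.
have [I [m [e [Em mi es]]]] := image_ex (i1 ** q + i2 ** h).
have dI : dec D I.
  apply: dec_mono (ind_dec I) => V [Vi [v vi]].
  apply: Dsub Vi (inj_comp mi vi) _; exact: dec_sum bip dQ (dec_base DX).
case: bip => e1 e2 e3 e4 _.
have Eq : q = p1 ** m ** e.
  by rewrite -compA -Em compDr !compA e1 e3 comp1m comp0m addr0.
have pms : surj (p1 ** m) by apply: (@surj_cancel _ _ _ _ _ e); rewrite -Eq.
have [|r [r1 r2]] := surj_iso pms.
  by rewrite lQ; apply: nmax; apply/asboolP; exists I, e.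
have re : r ** q = e by rewrite Eq compA r1 comp1m.
exists (p2 ** m ** r); rewrite -!compA re -Em compDr !compA e4 e2.
by rewrite comp0m comp1m add0r.
Qed.

(** A nonzero composite through a direct sum is nonzero through one of the summands. [N] is a
    condition on maps out of [Y] that survives projection to a summand: being non-split in the
    inductive steps, and no condition at the start. *)
Lemma fin_isom_factor W Y Q (N : forall Z, hom Y Z ->
  Prop) (g : hom Y Q) (f : hom W Y) :
  (forall Z Z' (p : hom Z Z') (h : hom Y Z), N Z h -> N Z' (p ** h)) ->
  (forall Z (h : hom Y Z), D Z -> N Z h ->
    fin_isom (fun X => D X /\ exists k : hom Z X, k ** (h ** f) <> 0)) ->
  N Q g -> dec D Q ->
  fin_isom (fun X => D X /\ exists k : hom Q X, k ** (g ** f) <> 0).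
Proof.
move=> Nc Nf Ng dQ; elim: dQ g Ng =>
  [{}Q Q0|{}Q DQ|A B {}Q i1 p1 i2 p2 bip _ IA _ IB] g Ng.
- by apply: fin_isom0 => X [_ [k]]; rewrite (zob_dom k Q0) comp0m.
- exact: Nf.
- apply: fin_isom_sub (fin_isomU (IA _ (Nc _ _ p1 _ Ng)) (IB _ (Nc _ _ p2 _ Ng))).
  move=> X [DX [k kgf]]; case: bip => _ _ _ _ e5.
  have E : k ** (g ** f) =
      k ** i1 ** (p1 ** g ** f) + k ** i2 ** (p2 ** g ** f).
    rewrite -!compA -compDr; congr (k ** _).
    by rewrite !compA -!compDl e5 comp1m.
  have [k1|k1] := pselect (k ** i1 ** (p1 ** g ** f) = 0).
    by right; split=> //; exists (k ** i2) => k2; apply: kgf; rewrite E k1 k2 addr0.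
  by left; split=> //; exists (k ** i1).
Qed.

(** A map out of [Y] that is not an isomorphism factors through the almost split map of [Y], then
    through a summand of a quotient in [D]. This extends the chain [f] by one non-isomorphism and
    leaves finitely many choices; [i] counts the steps left before Harada-Sai kills the
    composite. *)
Lemma fin_isom_bounded : fin_isom D.
Proof.
have [n Hn] := harada_sai C b.
have H i W Y (f : hom W Y) : (i <= n)%N -> noniso_chain b (n - i) f -> D Y ->
    fin_isom (fun X => D X /\ exists k : hom Y X, k ** f <> 0).
  elim: i W Y f => [|i IHi] W Y f lin.
    by rewrite subn0 => /Hn f0 _; apply: fin_isom0 => X [_ [k]]; rewrite f0 compm0.
  move=> cf DY; have [E [g [gN gP]]] := las (Dind DY).
  have [Q [q [dQ qP]]] := largest_quotient E.
  have fin := @fin_isom_factor W Y Q (fun Z h => ~ splitm h) (q ** g) f.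
  apply: fin_isom_sub (fin_isomU (fin_isom1 Y) (fin _ _ _ dQ)).
  - move=> X [DX [k kf]]; have [ki|kN] := pselect (iso k); first by left; exists k.
    right; split=> //; have [|k' Ek] := gP _ k.
      by move=> ks; apply: kN; apply: split_ind_iso; [case: (Dind DY) | apply: Dind |].
    have [k'' Ek'] := qP _ k' DX; exists k''.
    by move=> k0; apply: kf; rewrite -k0 Ek Ek' !compA.
  - by move=> Z Z' p h hN /split_cancel.
  - move=> Z h DZ hN; apply: IHi => //; first exact: ltnW.
    rewrite -subnSK //; apply: noniso_chainS => //; [exact: Dind | exact: Dlen |].
    by move=> /iso_split.
  - by move=> /split_cancel.
(* Every member of [D] receives a nonzero map from [C0], which passes through one of the finitely
   many summands of [Q]; chains start there, so no bound on the length of [C0] itself enters. *)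
have [Q [q [dQ qP]]] := largest_quotient C0.
have fin := @fin_isom_factor C0 C0 Q (fun Z h => True) q (idm C0).
apply: fin_isom_sub (fin _ _ Logic.I dQ) => //.
- move=> X DX; split=> //; have [k k0] := C0P (Dind DX).1.
  by have [k' Ek] := qP _ k DX; exists k'; rewrite compm1 -Ek.
- move=> Z h DZ _; apply: fin_isom_sub (H n Z Z (idm Z) (leqnn n) _ DZ).
    move=> X [DX [k k0]]; split=> //; exists k => k1; apply: k0.
    by rewrite compA compm1 -[k]compm1 k1 comp0m.
  by rewrite subnn; apply: noniso_chain0; [apply: Dind | apply: Dlen].
Qed.

End Bounded.

(** The inclusion of [K] factors through [g], and the image [I] of [E] in [X] cannot be shorter than
    [X]. Otherwise [mu_main], applied to [K] inside [I], either splits [g] or finds in [I] a proper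
    indecomposable subobject of [X] of measure above [mu K], against the maximality of [K]. *)
Lemma gr_sub_len K E (g : hom K E) X : ind X -> gr_sub K X -> ~ splitm g ->
  (forall X (h : hom K X), ~ splitm h -> exists h' : hom E X, h = h' ** g) ->
  (ell X <= ell E)%N.
Proof.
move=> Xi [Ki [[x [xi xN]] muX]] gN gP.
have [xs|h Ex] := gP _ x; first by case: xN; apply: split_ind_iso => //; case: Ki.
have [I [m [e [Eh mi es]]]] := image_ex h.
apply: leq_trans (surj_len es); rewrite leqNgt; apply/negP => lI.
have egi : inj (e ** g) by apply: (@inj_cancel _ _ _ _ m); rewrite compA -Eh -Ex.
pose R Z := ind Z /\ exists z : hom Z I, inj z.
have RI Z : R Z -> ind Z by case.
have [[Z [[Zi [z zi]] ltZ]]|] := mu_main Ki egi RI (ind_dec I).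
  have mzi := inj_comp mi zi.
  have mzN : ~ iso (m ** z).
    by move=> j; move: lI; rewrite ltnNge (leq_trans (surj_len (iso_surj j)) (inj_len zi)).
  have := mu_proper Zi mzi mzN; rewrite muX lerD2r.
  by move=> /(lt_le_trans ltZ); rewrite ltxx.
by move=> /split_cancel.
Qed.

(** * The tree of Gabriel-Roiter submodules *)

Definition gr_root X := ind X /\ ~ exists K, gr_sub K X.

(** The measure of a root is its single weight, which leaves room for no proper indecomposable
    subobject. So the image of a nonzero map from [C0] is all of [X]. *)
Lemma gr_root_len X : gr_root X -> (ell X <= ell C0)%N.
Proof.
move=> [Xi XN]; have [f f0] := C0P Xi.1.
have muX : mu X = weight (ell X) by case: (mu_cases X).
have [I [m [e [Ef mi es]]]] := image_ex f.
have [I0|I0] := pselect (zob I); first by case: f0; rewrite Ef (zob_dom m I0) comp0m.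
have [Z [Zi [z zi]]] := nonzero_ind_sub I0.
have [mz|mzN] := pselect (iso (m ** z)).
  by apply: leq_trans (surj_len (iso_surj mz)) (leq_trans (inj_len zi) (surj_len es)).
have := mu_proper Zi (inj_comp mi zi) mzN; rewrite muX gerDr => /(le_trans (mu_ge Z)).
by rewrite leNgt weight_gt0.
Qed.

Lemma gr_sub_isom K K' X : isom K K' -> gr_sub K X -> gr_sub K' X.
Proof.
move=> KK' [Ki [[x [xi xN]] muX]]; split; first exact: isom_ind KK' Ki.
rewrite -(mu_isom KK'); split=> //; have [f [g [gf fg]]] := KK'.
exists (x ** g); split; first by apply: inj_comp => //; apply: iso_inj; exists f.
by move=> j; apply: xN; apply: iso_cancel j; exists f.
Qed.

Lemma gr_sub_mu K X : gr_sub K X -> mu K < mu X.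
Proof. by move=> [_ [_ ->]]; rewrite ltrDl weight_gt0. Qed.

Lemma gr_sub_lt K X : gr_sub K X -> (ell K < ell X)%N.
Proof. by move=> [_ [[x [xi xN]] _]]; apply: proper_len xi xN. Qed.

(** Steps are added at the lower end, so that the descendants of [K] split into those of its
    immediate successors, as the induction in [small_fin] requires. *)
Inductive gr_desc : ob -> ob -> Prop :=
| gr_desc0 K X : isom K X -> gr_desc K X
| gr_descS K K' X : gr_sub K K' -> ind K' -> gr_desc K' X -> gr_desc K X.

Lemma gr_desc_inv K X : gr_desc K X ->
  isom K X \/ exists K', gr_sub K K' /\ ind K' /\ gr_desc K' X.
Proof. by case=> [{}K {}X KX|{}K K' {}X KK' K'i d]; [left | right; exists K']. Qed.

Lemma gr_desc_isom K K' X : isom K K' -> gr_desc K X -> gr_desc K' X.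
Proof.
move=> KK' d; case: d KK' => [{}K {}X KX|{}K K'' {}X KK'' K''i d] KK'.
  by apply: gr_desc0; apply: isom_trans KX; apply: isom_sym.
by apply: gr_descS d => //; apply: gr_sub_isom KK''.
Qed.

Lemma gr_desc_mu K X : gr_desc K X -> mu K <= mu X.
Proof.
elim=> [{}K {}X KX|{}K K' {}X KK' _ _ IH]; first by rewrite (mu_isom KX).
by apply: le_trans IH; apply/ltW/gr_sub_mu.
Qed.

Lemma gr_desc_rcons K K' X : gr_desc K K' -> gr_sub K' X -> ind X -> gr_desc K X.
Proof.
move=> d; elim: d X => [{}K {}K' KK'|{}K K'' {}K' KK'' K''i _ IH] X K'X Xi.
  apply: (@gr_descS _ X); [exact: gr_sub_isom (isom_sym KK') K'X | by []|].
  exact/gr_desc0/isom_refl.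
by apply: gr_descS KK'' K''i _; apply: IH.
Qed.

Lemma gr_desc_root X : ind X -> exists K, gr_root K /\ gr_desc K X.
Proof.
have [n] := ubnP (ell X); elim: n X => // n IHn X ltX Xi.
have [[K KX]|XN] := pselect (exists K, gr_sub K X).
  have [|//|R [Rr RK]] := IHn K; [exact: leq_trans (gr_sub_lt KX) ltX | by case: KX|].
  by exists R; split=> //; apply: gr_desc_rcons RK KX Xi.
by exists X; split; [split | apply/gr_desc0/isom_refl].
Qed.

Definition small X := ind X /\ fin_isom (fun Y => ind Y /\ mu Y <= mu X).

Lemma small_le X Y : small Y -> ind X -> mu X <= mu Y -> small X.
Proof.
move=> [Yi fY] Xi XY; split=> //; apply: fin_isom_sub fY => Z [Zi ZX].
by split=> //; apply: le_trans ZX XY.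
Qed.

(** Under the length bound all measures are multiples of [weight b] with bounded numerator, so the
    maximum is one of natural numbers. *)
Lemma ex_mu_max P b : (forall X, P X -> (ell X <= b)%N) -> (exists X, P X) ->
  exists X, P X /\ forall Y, P Y -> mu Y <= mu X.
Proof.
move=> lP [X0 PX0].
pose p v := `[< exists X, P X /\ mu X = v%:R * weight b >].
have mup X : P X -> exists2 v, p v & ((v <= 2 ^ b.+1)%N /\ mu X = v%:R * weight b).
  move=> PX; have [v vlt Ev] := gr_chain_nat (muP X).1 (lP _ PX).
  exists v; first by apply/asboolP; exists X.
  by split=> //; apply: leq_trans vlt; apply: leq_addr.
have p1 : exists v, p v by have [v pv _] := mup _ PX0; exists v.
have pb v : p v -> (v <= 2 ^ b.+1)%N.
  move=> /asboolP[X [/mup[w _ [wb ->]]]].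
  have w0 : weight b != 0 by rewrite gt_eqF // weight_gt0.
  by move=> /(mulIf w0)/eqP; rewrite eqr_nat => /eqP <-.
case: (ex_maxnP p1 pb) => v /asboolP[X [PX Ev]] vmax; exists X;
  split=> // Y /mup[w pw [_ ->]].
by rewrite Ev ler_pM2r ?weight_gt0 // ler_nat vmax.
Qed.

Lemma ex_mu_min P b : (forall X, P X -> (ell X <= b)%N) -> (exists X, P X) ->
  exists X, P X /\ forall Y, P Y -> mu X <= mu Y.
Proof.
move=> lP [X0 PX0].
pose p v := `[< exists X, P X /\ mu X = v%:R * weight b >].
have mup X : P X -> exists2 v, p v & mu X = v%:R * weight b.
  move=> PX; have [v vlt Ev] := gr_chain_nat (muP X).1 (lP _ PX).
  by exists v => //; apply/asboolP; exists X.
have p1 : exists v, p v by have [v pv _] := mup _ PX0; exists v.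
case: (ex_minnP p1) => v /asboolP[X [PX Ev]] vmin; exists X; split=> // Y /mup[w pw ->].
by rewrite Ev ler_pM2r ?weight_gt0 // ler_nat vmin.
Qed.

(** A member of largest measure exists, and its smallness covers all the others. *)
Lemma small_fin_bounded P b : (forall X, P X -> small X) ->
  (forall X, P X -> (ell X <= b)%N) -> fin_isom P.
Proof.
move=> Ps Pb; have [/(ex_mu_max Pb)[X [PX Xmax]]|N] := pselect (exists X, P X).
  by apply: fin_isom_sub (Ps _ PX).2 => Y PY; split; [case: (Ps _ PY) | apply: Xmax].
by apply: fin_isom0 => X PX; apply: N; exists X.
Qed.

(** The larger object comes first, so accessibility says that ascending chains of proper inclusions
    stop. *)
Definition proper_ext Y X : Prop :=
  [/\ ind X, ind Y & exists f : hom X Y, inj f /\ ~ iso f].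

(** Koenig's lemma as a well-founded induction: roots and successors of a given object are of
    bounded length, hence finite in number among small objects, and the set of descendants of [K] is
    a finite union over its successors. *)
Lemma small_fin : (forall X, ind X -> Acc proper_ext X) -> fin_isom small.
Proof.
move=> acc.
have descfin K : ind K -> fin_isom (fun X => small X /\ gr_desc K X).
  move=> Ki; have aK := acc K Ki; elim: aK Ki => {}K _ IH Ki.
  have [E [g [gN gP]]] := las Ki.
  pose P K' := gr_sub K K' /\ small K'.
  have finP : fin_isom P.
    apply: (@small_fin_bounded _ (ell E)) => X [KX sX] //.
    by apply: gr_sub_len KX gN gP; case: sX.
  have fin2 : fin_isom (fun X => exists K', P K' /\ (small X /\ gr_desc K' X)).
    apply: (fin_isom_bigU finP) => [Y Y' X YY' [sX YX]|K' [KK' [K'i _]]].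
      by split=> //; apply: gr_desc_isom YX.
    by apply: IH => //; split=> //; case: KK' => _ [].
  apply: fin_isom_sub (fin_isomU (fin_isom1 K) fin2) => X [sX KX].
  have [KX'|[K' [KK' [K'i K'X]]]] := gr_desc_inv KX; [by left | right].
  exists K'; split=> //; split=> //.
  exact: small_le sX K'i (gr_desc_mu K'X).
have rootfin : fin_isom (fun K => gr_root K /\ small K).
  by apply: (@small_fin_bounded _ (ell C0)) => X [Xr sX] //; apply: gr_root_len.
have fin2 : fin_isom (fun X => exists K,
  (gr_root K /\ small K) /\ (small X /\ gr_desc K X)).
  apply: (fin_isom_bigU rootfin) => [Y Y' X YY' [sX YX]|K [[Ki _] _]];
    last exact: descfin.
  by split=> //; apply: gr_desc_isom YX.
apply: fin_isom_sub fin2 => X sX; have [K [Kr KX]] := gr_desc_root sX.1.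
exists K; split=> //; split=> //; apply: small_le sX _ (gr_desc_mu KX).
by case: Kr.
Qed.

Lemma fin_isom_len P : fin_isom P -> exists b, forall X, P X -> (ell X <= b)%N.
Proof.
move=> [s Hs]; suff [b Hb] : exists b, forall Y, List.In Y s -> (ell Y <= b)%N.
  by exists b => X /Hs[Y [/Hb ? /isom_len->]].
elim: s {Hs} => [|Y s [b Hb]]; first by exists 0%N.
by exists (maxn (ell Y) b) => Z [<-|/Hb Zb]; rewrite leq_max ?leqnn ?Zb ?orbT.
Qed.

Lemma gr_sub_fin_len P : fin_isom P -> exists b, forall K X,
  P K -> gr_sub K X -> ind X -> (ell X <= b)%N.
Proof.
move=> [s Hs]; suff [b Hb] : exists b, forall Y X,
    List.In Y s -> gr_sub Y X -> ind X -> (ell X <= b)%N.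
  exists b => K X /Hs[Y [Ys KY]] /(gr_sub_isom KY) YX Xi; exact: Hb Ys YX Xi.
elim: s {Hs} => [|Y s [b Hb]]; first by exists 0%N.
have [Yi|Yi] := pselect (ind Y); last first.
  exists b => Z X [<- [/Yi //]|]; exact: Hb.
have [E [g [gN gP]]] := las Yi.
exists (maxn (ell E) b) => Z X [<- YX Xi|Zs ZX Xi].
  by rewrite leq_max (gr_sub_len Xi YX gN gP).
by rewrite leq_max (Hb _ _ Zs ZX Xi) orbT.
Qed.

Lemma ind_fin : (forall X, ind X -> Acc proper_ext X) -> fin_isom (@ind C).
Proof.
move=> /small_fin sfin; apply: (fin_isom_sub _ sfin) => X0 X0i.
apply: contrapT => X0N.
(* [S] is the lowest layer of non-small objects. Its lengths are bounded, by [C0] for roots and by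
   almost split targets for objects above one of the finitely many small ones. *)
pose S X := [/\ ind X, ~ small X & gr_root X \/ exists K, small K /\ gr_sub K X].
have Sbelow X : ind X -> ~ small X -> S X \/ exists Y, S Y /\ mu Y < mu X.
  have [n] := ubnP (ell X); elim: n X => // n IHn X ltX Xi XN.
  have [[K KX]|KN] := pselect (exists K, gr_sub K X); last first.
    by left; split=> //; left.
  have Ki : ind K by case: KX.
  have [Ks|KN] := pselect (small K); first by left; split=> //; right; exists K.
  right; have [|SK|[Y [SY YK]]] := IHn K _ Ki KN.
  - exact: leq_trans (gr_sub_lt KX) ltX.
  - by exists K; split=> //; apply: gr_sub_mu.
  - by exists Y; split=> //; apply: lt_trans YK (gr_sub_mu KX).
have [b1 Hb1] := gr_sub_fin_len sfin; have [b2 Hb2] := fin_isom_len sfin.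
have Slen X : S X -> (ell X <= maxn (ell C0) b1)%N.
  move=> [Xi _ [/gr_root_len lX|[K [sK KX]]]]; rewrite leq_max ?lX //.
  by rewrite (Hb1 _ _ sK KX Xi) orbT.
have [|X1 [SX1 X1min]] := ex_mu_min Slen.
  by have [S0|[Y [SY _]]] := Sbelow _ X0i X0N; [exists X0 | exists Y].
have [X1i X1N _] := SX1; apply: X1N; split=> //.
(* An indecomposable of measure at most [mu X1] is small or in [S], since an element of [S] of
   smaller measure would contradict the choice of [X1]; in both cases its length is bounded. Closure
   under subobjects of sums is Gabriel's property. *)
apply: (@fin_isom_bounded _ (maxn b2 (maxn (ell C0) b1))) => X //; first by case.
- move=> Y f Xi fi dY; split=> //.
  have [//|[Z [[Zi ZX1] XZ]]|fs] := mu_main Xi fi _ dY; first by move=> Z [].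
    exact/ltW/(lt_le_trans XZ ZX1).
  have [//|Z [[_ ZX1] XZ]] := dec_retract _ Xi dY fs; first by move=> Z [].
  by rewrite (mu_isom XZ).
- move=> [Xi XX1]; rewrite leq_max; have [sX|XN] := pselect (small X).
    by rewrite Hb2.
  have [SX|[Y [SY YX]]] := Sbelow _ Xi XN; first by rewrite Slen ?orbT.
  by have := lt_le_trans YX (le_trans XX1 (X1min _ SY)); rewrite ltxx.
Qed.

Lemma proper_ext_acc :
  ~ (exists (X : nat -> ob) (f : forall i, hom (X i) (X i.+1)),
      forall i, [/\ ind (X i), inj (f i) & ~ iso (f i)]) ->
  forall X, ind X -> Acc proper_ext X.
Proof.
move=> noch X0 X0i; apply: contrapT => X0N.
have step (X : {X | ~ Acc proper_ext X}) : exists Y : {X | ~ Acc proper_ext X},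
    proper_ext (sval Y) (sval X).
  case: X => X XN; apply: contrapT => N; apply: (XN); constructor=> Y YX.
  by apply: contrapT => YN; apply: N; exists (exist _ Y YN).
have [F [F0 FS]] := dependent_choice (fun x => cid (step x)) (exist _ X0 X0N).
apply: noch; exists (fun i => sval (F i)).
have H i : exists f : hom (sval (F i)) (sval (F i.+1)), inj f /\ ~ iso f.
  by have [_ _ []] := FS i; move=> f; exists f.
exists (fun i => sval (cid (H i))) => i; case: (cid (H i)) => f [fi fN] /=.
by split=> //; case: (FS i).
Qed.


End FiniteType.

(** * Submodules, quotients and homomorphisms *)

Definition submod (R : pzRingType) (M : lmodType R) (U : M -> Prop) : Prop :=
  U 0 /\ forall a x y, U x -> U y -> U (a *: x + y).

Section Submodule.
Context (R : pzRingType) (M : lmodType R).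

Record submodule := Submodule { sm_set :> M -> Prop; smP : submod sm_set }.

Context (U : submodule).

Definition sm_pred : {pred M} := fun x => `[< U x >].

Lemma sm_pred_closed : submod_closed sm_pred.
Proof.
have [U0 UD] := smP U; split; first exact/asboolP.
by move=> a x y /asboolP Ux /asboolP Uy; apply/asboolP/UD.
Qed.

HB.instance Definition _ := GRing.isSubmodClosed.Build R M sm_pred sm_pred_closed.

Record sm_type := SmType { sm_val : M; _ : sm_val \in sm_pred }.

HB.instance Definition _ := [isSub for sm_val].
HB.instance Definition _ := [Choice of sm_type by <:].
HB.instance Definition _ := [SubChoice_isSubLmodule of sm_type by <:].

Definition qt_type := Quotient.quot sm_pred.
HB.instance Definition _ := GRing.Zmodule.on qt_type.

Definition qt_pi (x : M) : qt_type := (\pi_(Quotient.quot sm_pred) x)%qT.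
Definition qt_scale (a : R) (x : qt_type) : qt_type :=
  qt_pi (a *: repr (x : Quotient.quot sm_pred)).

Lemma qt_piD x y : qt_pi (x + y) = qt_pi x + qt_pi y.
Proof. by rewrite /qt_pi raddfD. Qed.

Lemma qt_piE x y : qt_pi x = qt_pi y <-> U (x - y).
Proof.
split; last first.
  move=> Uxy; apply/eqP; rewrite /qt_pi -Quotient.idealrBE; exact/asboolP.
by move/eqP; rewrite /qt_pi -Quotient.idealrBE => /asboolP.
Qed.

Lemma qt_repr (x : qt_type) : qt_pi (repr (x : Quotient.quot sm_pred)) = x.
Proof. exact: reprK. Qed.

Lemma qt_piZ a x : qt_pi (a *: x) = qt_scale a (qt_pi x).
Proof.
rewrite /qt_scale; apply/qt_piE; rewrite -scalerBr.
have : U (x - repr (qt_pi x : Quotient.quot sm_pred)) by apply/qt_piE; rewrite qt_repr.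
by case: (smP U) => U0 UD /(UD a _ 0)/(_ U0); rewrite addr0.
Qed.

Lemma qt_scalerA a b v : qt_scale a (qt_scale b v) = qt_scale (a * b) v.
Proof. by rewrite -[v]qt_repr -!qt_piZ scalerA. Qed.
Lemma qt_scale1r : left_id 1 qt_scale.
Proof. by move=> v; rewrite -[v]qt_repr -!qt_piZ scale1r. Qed.
Lemma qt_scalerDr : right_distributive qt_scale +%R.
Proof. by move=> a u v; rewrite -[v]qt_repr -[u]qt_repr -qt_piD -!qt_piZ -qt_piD scalerDr. Qed.
Lemma qt_scalerDl v : {morph qt_scale^~ v : a b / a + b}.
Proof. by move=> a b; rewrite -[v]qt_repr -!qt_piZ -qt_piD scalerDl. Qed.

HB.instance Definition _ := GRing.Zmodule_isLmodule.Build R qt_type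
  qt_scalerA qt_scale1r qt_scalerDr qt_scalerDl.

Lemma qt_pi_linear : linear qt_pi.
Proof. by move=> a x y; rewrite qt_piD qt_piZ. Qed.

HB.instance Definition _ := GRing.isLinear.Build R M qt_type _ qt_pi qt_pi_linear.

End Submodule.

Lemma submodule_ex (R : pzRingType) (M : lmodType R) (U : M -> Prop) : submod U ->
  exists (S : lmodType R) (i : {linear S -> M}), injective i /\
    forall x, U x <-> exists y, i y = x.
Proof.
move=> sU; pose S := Submodule sU.
exists (sm_type S : lmodType R), (val : {linear sm_type S -> M}).
split; first exact: val_inj.
move=> x; split=> [Ux|[y <-]]; last by case: y => y /= /asboolP.
have px : x \in sm_pred S by apply/asboolP.
by exists (SmType px).
Qed.

Lemma quotient_ex (R : pzRingType) (M : lmodType R) (U : M -> Prop) : submod U ->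
  exists (Q : lmodType R) (p : {linear M -> Q}), surjective p /\
    forall x, U x <-> p x = 0.
Proof.
move=> sU; pose S := Submodule sU.
exists (qt_type S : lmodType R), (@qt_pi R M S : {linear _ -> _}); split.
  by move=> y; exists (repr (y : Quotient.quot (sm_pred S))); apply: qt_repr.
by move=> x; rewrite -[X in _ = X](linear0 (@qt_pi R M S)) /= qt_piE subr0.
Qed.

Section Hom.
Context (R : pzRingType) (M N : lmodType R).

Definition lin_pred : {pred M -> N} := fun f => `[< linear f >].

Lemma lin_pred_closed : zmod_closed lin_pred.
Proof.
split; first by apply/asboolP => a x y; rewrite /= scaler0 addr0.
move=> f g /asboolP fl /asboolP gl; apply/asboolP => a x y.
rewrite /GRing.add /GRing.opp /= fl gl scalerDr scalerN opprD.
by rewrite addrACA.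
Qed.

HB.instance Definition _ := GRing.isZmodClosed.Build (M -> N) lin_pred lin_pred_closed.

Record lhom := LHom { lfun :> M -> N; _ : lfun \in lin_pred }.

HB.instance Definition _ := [isSub for lfun].
HB.instance Definition _ := [Choice of lhom by <:].
HB.instance Definition _ := [SubChoice_isSubZmodule of lhom by <:].

Lemma lfun_linear (f : lhom) : linear f.
Proof. by case: f => f /= /asboolP. Qed.

HB.instance Definition _ (f : lhom) := GRing.isLinear.Build R M N _ f (@lfun_linear f).

Definition mkhom (f : {linear M -> N}) : lhom :=
  @LHom f (introT (asboolP _) (@linearP _ _ _ _ f)).

Lemma lhomP (f g : lhom) : (forall x, f x = g x) -> f = g.
Proof. by move=> fg; apply: val_inj; apply/funext. Qed.

End Hom.

Section HomMod.
Context (k : comPzRingType) (M N : lmodType k).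

Definition lhom_scale (a : k) (f : lhom M N) : M -> N := fun x => a *: f x.

Lemma lhom_scale_linear a f : lhom_scale a f \in @lin_pred _ M N.
Proof.
by apply/asboolP => b x y; rewrite /lhom_scale linearP scalerDr !scalerA mulrC.
Qed.

Definition lhomZ a f := LHom (lhom_scale_linear a f).

Lemma lhom_scalerA a b v : lhomZ a (lhomZ b v) = lhomZ (a * b) v.
Proof. by apply: lhomP => x; rewrite /= /lhom_scale /= scalerA. Qed.
Lemma lhom_scale1r : left_id 1 lhomZ.
Proof. by move=> v; apply: lhomP => x; rewrite /= /lhom_scale scale1r. Qed.
Lemma lhom_scalerDr : right_distributive lhomZ +%R.
Proof. by move=> a u v; apply: lhomP => x; rewrite /= /lhom_scale scalerDr. Qed.
Lemma lhom_scalerDl v : {morph lhomZ^~ v : a b / a + b}.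
Proof. by move=> a b; apply: lhomP => x; rewrite /= /lhom_scale scalerDl. Qed.

HB.instance Definition _ := GRing.Zmodule_isLmodule.Build k (lhom M N)
  lhom_scalerA lhom_scale1r lhom_scalerDr lhom_scalerDl.

End HomMod.

(** * Length *)

Section Length.
Context (R : pzRingType).
Implicit Types M N A B : lmodType R.

Inductive chain M : (M -> Prop) -> nat -> Prop :=
| chain0 U : submod U -> chain U 0
| chainS U V n : chain U n -> submod V -> (forall x, U x -> V x) ->
    (exists x, V x /\ ~ U x) -> chain V n.+1.

Definition bnd M (n : nat) : Prop := forall U m, @chain M U m -> (m <= n)%N.
Definition finlen M : Prop := exists n, bnd M n.
(** Composition length as the longest chain of submodules. A module of infinite length gets the
    default 0, so [flen] is used together with [finlen]. *)
Definition flen M : nat := xget 0%N [set n | bnd M n /\ forall m, bnd M m ->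
  (n <= m)%N].

Lemma chain_submod M (U : M -> Prop) n : chain U n -> submod U.
Proof. by case. Qed.

Lemma chain_mono M (U V : M -> Prop) n :
  chain U n -> submod V -> (forall x, U x -> V x) -> chain V n.
Proof.
move=> cU sV UV; case: cU UV => [{}U sU|W {}U m cW sU WU [x [Ux Wx]]] UV;
  first exact: chain0.
by apply: (chainS cW sV) => [y /WU/UV //|]; exists x; split=> //; apply: UV.
Qed.

Lemma submod0 M (U : M -> Prop) : submod U -> U 0. Proof. by case. Qed.
Lemma submodD M (U : M -> Prop) x y : submod U -> U x -> U y -> U (x + y).
Proof. by move=> [_ UD] Ux Uy; rewrite -[x]scale1r; apply: UD. Qed.
Lemma submodZ M (U : M -> Prop) a x : submod U -> U x -> U (a *: x).
Proof. by move=> [U0 UD] Ux; rewrite -[_ *: _]addr0; apply: UD. Qed.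
Lemma submodN M (U : M -> Prop) x : submod U -> U x -> U (- x).
Proof. by move=> sU Ux; rewrite -scaleN1r; apply: submodZ. Qed.
Lemma submodB M (U : M -> Prop) x y : submod U -> U x -> U y -> U (x - y).
Proof. by move=> sU Ux Uy; apply: submodD => //; apply: submodN. Qed.

Lemma submod_zero M : submod (fun x : M => x = 0).
Proof. by split=> // a x y -> ->; rewrite scaler0 addr0. Qed.

Lemma submod_full M : submod (fun x : M => True). Proof. by []. Qed.

Lemma submod_preim M N (f : {linear M -> N}) (U : N -> Prop) :
  submod U -> submod (fun x => U (f x)).
Proof.
by move=> [U0 UD]; split; rewrite ?linear0 // => a x y ? ?; rewrite linearP; apply: UD.
Qed.

Lemma submod_im M N (f : {linear M -> N}) (U : M -> Prop) :
  submod U -> submod (fun y => exists x, U x /\ f x = y).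
Proof.
move=> [U0 UD]; split; first by exists 0; rewrite linear0.
move=> a _ _ [x [Ux <-]] [y [Uy <-]]; exists (a *: x + y).
by rewrite linearP; split=> //; apply: UD.
Qed.

Lemma submod_cap M (U V : M -> Prop) :
  submod U -> submod V -> submod (fun x => U x /\ V x).
Proof.
by move=> [U0 UD] [V0 VD]; split=> // a x y [? ?] [? ?]; split; [apply: UD | apply: VD].
Qed.

Lemma submod_sum M (U V : M -> Prop) : submod U -> submod V ->
  submod (fun x => exists u v, [/\ U u, V v & x = u + v]).
Proof.
move=> [U0 UD] [V0 VD]; split; first by exists 0, 0; rewrite addr0.
move=> a _ _ [u [v [Uu Vv ->]]] [u' [v' [Uu' Vv' ->]]].
exists (a *: u + u'), (a *: v + v'); split; [exact: UD | exact: VD |].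
by rewrite scalerDr addrACA.
Qed.

Lemma submod_cyc M (x : M) : submod (fun y => exists a : R, y = a *: x).
Proof.
split; first by exists 0; rewrite scale0r.
by move=> a _ _ [b ->] [c ->]; exists (a * b + c); rewrite scalerDl scalerA.
Qed.

(** [F] and [G] stand for the traces of [U] in a submodule and in the quotient by it. The last
    hypothesis is the modular law: every strict step of the chain is strict in one of the two. *)
Lemma chain_split M A B (F : (M -> Prop) -> (A -> Prop)) (G : (M -> Prop) -> (B ->
  Prop)) :
  (forall U, submod U -> submod (F U)) -> (forall U, submod U -> submod (G U)) ->
  (forall U V, submod U -> submod V -> (forall x, U x -> V x) ->
     [/\ forall x, F U x -> F V x, forall x, G U x -> G V x
       & (forall x, F V x -> F U x) -> (forall x, G V x -> G U x) ->
         forall x, V x -> U x]) ->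
  forall U n, chain U n ->
    exists a b, [/\ (n <= a + b)%N, chain (F U) a & chain (G U) b].
Proof.
move=> sF sG FG U n; elim=> [{}U sU|{}U V {}n cU [a [b [le cF cG]]] sV UV [x [Vx Ux]]].
  by exists 0%N, 0%N; split=> //; apply: chain0; auto.
have sU := chain_submod cU; have [FUV GUV E] := FG _ _ sU sV UV.
have [FN|FN] := pselect (exists x, F V x /\ ~ F U x).
  exists a.+1, b; split; first by rewrite addSn.
    exact: chainS cF (sF _ sV) FUV FN.
  exact: chain_mono cG (sG _ sV) GUV.
exists a, b.+1; split; first by rewrite addnS.
  exact: chain_mono cF (sF _ sV) FUV.
apply: chainS cG (sG _ sV) GUV _; apply: contrapT => GN.
apply: Ux; apply: E => // y Vy; apply: contrapT => Uy; first by apply: FN; exists y.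
by apply: GN; exists y.
Qed.

Lemma flenP M : finlen M -> bnd M (flen M) /\ forall m, bnd M m -> (flen M <= m)%N.
Proof.
move=> [n0 Hn0].
suff H : exists n, bnd M n /\ forall m, bnd M m -> (n <= m)%N by apply: (xgetPex 0%N H).
have P1 : exists n, `[< bnd M n >] by exists n0; apply/asboolP.
case: (ex_minnP P1) => n /asboolP bn nmin; exists n; split=> // m bm.
by apply: nmin; apply/asboolP.
Qed.

Lemma bndW M m n : (m <= n)%N -> bnd M m -> bnd M n.
Proof. by move=> mn bM U l /bM lm; apply: leq_trans mn. Qed.

Lemma chain_im M N (f : {linear M -> N}) U n : injective f -> chain U n ->
  chain (fun y => exists x, U x /\ f x = y) n.
Proof.
move=> fi; elim=> [{}U sU|{}U V {}n cU IH sV UV [x [Vx Ux]]].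
  exact/chain0/submod_im.
apply: (chainS IH); first exact: submod_im.
  by move=> y [z [/UV Vz <-]]; exists z.
exists (f x); split; first by exists x.
by move=> [z [Uz /fi zx]]; apply: Ux; rewrite -zx.
Qed.

Lemma chain_preim M N (f : {linear M -> N}) U n : surjective f -> chain U n ->
  chain (fun x => U (f x)) n.
Proof.
move=> fs; elim=> [{}U sU|{}U V {}n cU IH sV UV [x [Vx Ux]]].
  exact/chain0/submod_preim.
apply: (chainS IH); first exact: submod_preim.
  by move=> y; apply: UV.
by have [y Ey] := fs x; exists y; rewrite Ey.
Qed.

Lemma inj_bnd M N (f : {linear M -> N}) n : injective f -> bnd N n -> bnd M n.
Proof. by move=> fi bN U m /(chain_im fi)/bN. Qed.

Lemma inj_bnd_lt M N (f : {linear M -> N}) n : injective f -> bnd N n ->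
  ~ surjective f -> (0 < n)%N /\ bnd M n.-1.
Proof.
move=> fi bN fN.
have H U m : @chain M U m -> (m < n)%N.
  move=> /(chain_im fi) c; have : @chain N (fun _ => True) m.+1.
    apply: (chainS c) => //; apply: contrapT => N0; apply: fN => y.
    apply: contrapT => Ny; apply: N0; exists y; split=> // -[x [_ E]].
    by apply: Ny; exists x.
  exact: bN.
have n0 := H _ _ (chain0 (@submod_zero M)); split=> // U m /H.
by case: n n0 {bN H}.
Qed.

Lemma surj_bnd M N (f : {linear M -> N}) n : surjective f -> bnd M n -> bnd N n.
Proof. by move=> fs bM U m /(chain_preim fs)/bM. Qed.

Lemma chain_preim_lt M N (f : {linear M -> N}) U n (x : M) : surjective f ->
  f x = 0 -> x <> 0 -> chain U n -> chain (fun x => U (f x)) n.+1.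
Proof.
move=> fs fx0 x0; elim=> [{}U sU|{}U V {}n cU IH sV UV [y [Vy Uy]]].
  apply: (chainS (chain0 (@submod_zero M))); first exact: submod_preim.
    by move=> _ ->; rewrite linear0; apply: submod0.
  by exists x; rewrite fx0; split=> //; apply: submod0.
apply: (chainS IH); first exact: submod_preim.
  by move=> z; apply: UV.
by have [z Ez] := fs y; exists z; rewrite Ez.
Qed.

Lemma linear_injP M N (f : {linear M -> N}) :
  (forall x, f x = 0 -> x = 0) -> injective f.
Proof.
by move=> H x y fxy; apply/eqP; rewrite -subr_eq0; apply/eqP/H;
  rewrite linearB fxy subrr.
Qed.

Lemma surj_bnd_lt M N (f : {linear M -> N}) n : surjective f -> bnd M n ->
  ~ injective f -> (0 < n)%N /\ bnd N n.-1.
Proof.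
move=> fs bM fN; have [x [fx0 x0]] : exists x, f x = 0 /\ x <> 0.
  apply: contrapT => H; apply: fN; apply: linear_injP => x fx0.
  by apply: contrapT => x0; apply: H; exists x.
have H U m : @chain N U m -> (m < n)%N by move=> /(chain_preim_lt fs fx0 x0)/bM.
have n0 := H _ _ (chain0 (@submod_zero N)); split=> // U m /H.
by case: n n0 {bM H}.
Qed.

(** Only chains inside the image of [g] are bounded in [B]. This form serves the evaluation of
    homomorphisms at an element, whose image is much smaller than its target. *)
Lemma exact_bnd A M B (f : {linear A -> M}) (g : {linear M -> B}) m n :
  (forall x, g x = 0 -> exists y, f y = x) -> bnd A m ->
  (forall V l, @chain B V l -> (forall y, V y -> exists x, g x = y) -> (l <= n)%N) ->
  bnd M (m + n).
Proof.
move=> ex bA bB U l cU.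
pose F (U : M -> Prop) := fun y => U (f y).
pose G (U : M -> Prop) := fun y => exists x, U x /\ g x = y.
have sF V : submod V -> submod (F V) by apply: submod_preim.
have sG V : submod V -> submod (G V) by apply: submod_im.
have FG U' V : submod U' -> submod V -> (forall x, U' x -> V x) ->
    [/\ forall x, F U' x -> F V x, forall x, G U' x -> G V x
      & (forall x, F V x -> F U' x) -> (forall x, G V x -> G U' x) ->
        forall x, V x -> U' x].
  move=> sU' sV UV; split; first by move=> x; apply: UV.
    by move=> y [x [/UV Vx <-]]; exists x.
  move=> FV GV x Vx; have [|x' [Ux' gx]] := GV (g x); first by exists x.
  have [|y Ey] := ex (x - x'); first by rewrite linearB gx subrr.
  rewrite -[x](subrK x') -Ey; apply: submodD => //; apply: FV; rewrite /F Ey.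
  by apply: submodB => //; apply: UV.
have [a [b [le cF cG]]] := chain_split sF sG FG cU.
apply: leq_trans le (leq_add (bA _ _ cF) (bB _ _ cG _)).
by move=> y [x [_ <-]]; exists x.
Qed.

Lemma exact_finlen A M B (f : {linear A -> M}) (g : {linear M -> B}) :
  (forall x, g x = 0 -> exists y, f y = x) -> finlen A -> finlen B -> finlen M.
Proof.
move=> ex [m bA] [n bB]; exists (m + n)%N; apply: exact_bnd ex bA _ => V l /bB //.
Qed.

Lemma bnd0P M : bnd M 0 <-> zero_module M.
Proof.
split=> [b x|z U [//|m] c].
  apply: contrapT => x0; suff /b : @chain M (fun _ => True) 1 by [].
  by apply: (chainS (chain0 (@submod_zero M))) => //; exists x.
exfalso; move En: m.+1 c => l c; case: c En => // V W n cV sW VW [x [Wx Vx]] _.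
by apply: Vx; rewrite (z x); apply: submod0; apply: chain_submod cV.
Qed.

Lemma submod_max M (P : (M -> Prop) -> Prop) : finlen M ->
  (forall U, P U -> submod U) -> (exists U, P U) ->
  exists U, P U /\ forall V, P V -> (forall x, U x -> V x) -> forall x, V x -> U x.
Proof.
move=> [n bM] Ps [U0 PU0]; apply: contrapT => N.
suff H m : exists U, P U /\ chain U m by have [U [_ /bM]] := H n.+1; rewrite ltnn.
elim: m => [|m [U [PU cU]]]; first by exists U0; split=> //; apply/chain0/Ps.
apply: contrapT => N'; apply: N; exists U; split=> // V PV UV x Vx.
apply: contrapT => Ux; apply: N'; exists V; split=> //.
by apply: (chainS cU (Ps _ PV) UV); exists x.
Qed.

Lemma submod_min M (P : (M -> Prop) -> Prop) : finlen M ->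
  (forall U, P U -> submod U) -> (exists U, P U) ->
  exists U, P U /\ forall V, P V -> (forall x, V x -> U x) -> forall x, U x -> V x.
Proof.
move=> [n0 bM] Ps [U0 PU0].
pose h (U : M -> Prop) n := forall V m, @chain M V m -> (forall x, V x -> U x) ->
  (m <= n)%N.
pose p n := `[< exists U, P U /\ h U n >].
have p1 : exists n, p n.
  by exists n0; apply/asboolP; exists U0; split=> // V m /bM.
case: (ex_minnP p1) => n /asboolP[U [PU hU]] nmin; exists U; split=> // V PV VU x Ux.
apply: contrapT => Vx.
have H W m : chain W m -> (forall x, W x -> V x) -> (m < n)%N.
  move=> cW WV; apply: (hU U) => //; apply: (chainS cW (Ps _ PU)).
    by move=> y /WV/VU.
  by exists x; split=> // /WV.
have n0' := H _ _ (chain0 (Ps _ PV)) (fun _ => id).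
have /nmin : p n.-1.
  apply/asboolP; exists V; split=> // W m cW WV.
  by have := H _ _ cW WV; case: n n0' {hU nmin H}.
by rewrite leqNgt prednK // leqnn.
Qed.

End Length.

Definition mklin (R : pzRingType) (M N : lmodType R) (f : M -> N) (fl : linear f) :
  {linear M -> N} := HB.pack f (GRing.isLinear.Build R M N _ f fl).

(** * Finite length and finite generation *)

Section Finlen.
Context (R : pzRingType).
Implicit Types M N A B : lmodType R.

Lemma inl_linear M N : linear (fun x : M => (x, 0) : M * N).
Proof. by move=> a x y; congr pair; rewrite /= scaler0 addr0. Qed.

Lemma inr_linear M N : linear (fun x : N => (0, x) : M * N).
Proof. by move=> a x y; congr pair; rewrite /= scaler0 addr0. Qed.

Lemma fst_linear M N : linear (fst : M * N -> M). Proof. by []. Qed.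
Lemma snd_linear M N : linear (snd : M * N -> N). Proof. by []. Qed.

Lemma finlen_prod M N : finlen M -> finlen N -> finlen (M * N)%type.
Proof.
apply: (@exact_finlen _ M (M * N)%type N (mklin (@inl_linear M N)) (mklin (@snd_linear M N))).
by move=> [x y] /= ->; exists x.
Qed.

Lemma inj_finlen M N (f : {linear M -> N}) : injective f -> finlen N -> finlen M.
Proof. by move=> fi [n bN]; exists n; apply: inj_bnd fi bN. Qed.

Lemma surj_finlen M N (f : {linear M -> N}) : surjective f -> finlen M -> finlen N.
Proof. by move=> fs [n bM]; exists n; apply: surj_bnd fs bM. Qed.

Lemma flen_inj M N (f : {linear M -> N}) : injective f -> finlen N ->
  (flen M <= flen N)%N.
Proof.
move=> fi fN; have [bN _] := flenP fN; have [_ mM] := flenP (inj_finlen fi fN).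
exact/mM/(inj_bnd fi).
Qed.

Lemma flen_surj M N (f : {linear M -> N}) : surjective f -> finlen M ->
  (flen N <= flen M)%N.
Proof.
move=> fs fM; have [bM _] := flenP fM; have [_ mN] := flenP (surj_finlen fs fM).
exact/mN/(surj_bnd fs).
Qed.

Lemma inj_flen_surj M N (f : {linear M -> N}) :
  injective f -> finlen N -> (flen N <= flen M)%N -> surjective f.
Proof.
move=> fi fN le; apply: contrapT => fs; have [bN _] := flenP fN.
have [n0 bM] := inj_bnd_lt fi bN fs; have [_ /(_ _ bM)] := flenP (inj_finlen fi fN).
by move=> /(leq_trans le); rewrite leqNgt prednK // leqnn.
Qed.

Lemma surj_flen_inj M N (f : {linear M -> N}) :
  surjective f -> finlen M -> (flen M <= flen N)%N -> injective f.
Proof.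
move=> fs fM le; apply: contrapT => fi; have [bM _] := flenP fM.
have [n0 bN] := surj_bnd_lt fs bM fi; have [_ /(_ _ bN)] := flenP (surj_finlen fs fM).
by move=> /(leq_trans le); rewrite leqNgt prednK // leqnn.
Qed.

Lemma finlen_fct M n : finlen M -> finlen ('I_n -> M).
Proof.
move=> fM; elim: n => [|n IHn].
  by exists 0%N; apply/bnd0P => x; apply/funext => -[].
pose f (h : 'I_n -> M) : 'I_n.+1 -> M := fun i => oapp h 0 (unlift ord0 i).
have fl : linear f.
  move=> a u v; apply/funext => i; rewrite /f.
  change (oapp (a *: u + v) 0 (unlift ord0 i) =
    a *: oapp u 0 (unlift ord0 i) + oapp v 0 (unlift ord0 i)).
  by case: (unlift ord0 i) => [j|] //=; rewrite scaler0 addr0.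
pose g (h : 'I_n.+1 -> M) : M := h ord0.
have gl : linear g by [].
apply: (exact_finlen (f := mklin fl) (g := mklin gl)) IHn fM => x /= gx.
exists (fun j => x (lift ord0 j)); apply/funext => i; rewrite /f.
by case: unliftP => [j ->|->] //=; rewrite -gx.
Qed.

Lemma chain_zero M (W : M -> Prop) l :
  chain W l -> (forall y, W y -> y = 0) -> (l <= 0)%N.
Proof.
case=> // U V n cU sV UV [x [Vx Ux]] V0; case: Ux; rewrite (V0 _ Vx).
exact: submod0 (chain_submod cU).
Qed.

Lemma chain_simple M (T W : M -> Prop) l :
  (forall y z, T y -> T z -> y <> 0 -> exists c : R, z = c *: y) ->
  chain W l -> (forall y, W y -> T y) -> (l <= 1)%N.
Proof.
move=> simple cW; suff H : (forall y, W y -> T y) ->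
    (l <= 1)%N /\ ((0 < l)%N -> exists y, W y /\ y <> 0) by move=> /H[].
elim: cW => [//|U V n cU IH sV UV [x [Vx Ux]]] VT.
have sU := chain_submod cU.
have [n1 Un] := IH (fun y Uy => VT _ (UV _ Uy)).
have x0 : x <> 0 by move=> x0; apply: Ux; rewrite x0; apply: submod0.
split; last by move=> _; exists x.
rewrite ltnS leqn0; apply: contrapT => /negP; rewrite -lt0n => /Un[y [Uy y0]].
have [c Ec] := simple y x (VT _ (UV _ Uy)) (VT _ Vx) y0.
by apply: Ux; rewrite Ec; apply: submodZ.
Qed.

Definition comb M n (e : 'I_n -> M) (c : 'I_n -> R) : M := \sum_(i < n) c i *: e i.

Lemma comb_linear M n (e : 'I_n -> M) :
  linear (comb e : ('I_n -> R^o) -> M).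
Proof.
move=> a u v; rewrite /comb scaler_sumr -big_split /=; apply: eq_bigr => i _.
by rewrite scalerA -scalerDl.
Qed.

Lemma combN M n (e : 'I_n -> M) c : comb e (- (c : 'I_n -> R^o)) = - comb e c.
Proof. by rewrite /comb -sumrN; apply: eq_bigr => i _; rewrite -scaleNr. Qed.

Lemma fin_gen_finlen M : finlen (R^o : lmodType R) -> fin_gen M -> finlen M.
Proof.
move=> fR [n [e eP]]; apply: (surj_finlen (f :=
  mklin (comb_linear e))) (finlen_fct n fR).
by move=> x; have [c ->] := eP x; exists c.
Qed.

Lemma comb_delta M n (e : 'I_n -> M) i : comb e (fun j => (j == i)%:R) = e i.
Proof.
rewrite /comb (bigD1 i) //= eqxx scale1r big1 ?addr0 // => j /negPf ->.
by rewrite scale0r.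
Qed.

Lemma finlen_fin_gen_sub M (U : M -> Prop) : finlen M -> submod U ->
  exists (n : nat) (e : 'I_n -> M), forall x, U x <-> exists c, x = comb e c.
Proof.
move=> fM sU.
pose P V := (forall x, V x -> U x) /\
  exists (n : nat) (e : 'I_n -> M), forall x, V x <-> exists c, x = comb e c.
have [V [VU [n [e eP]]]||V [[VU [n [e eP]]] Vmax]] := @submod_max _ M P fM.
- split; first by apply/eP; exists (fun=> 0); rewrite /comb big1 // => i _;
  rewrite scale0r.
  move=> a _ _ /eP[c ->] /eP[d ->]; apply/eP; exists (a *: (c : 'I_n -> R^o) + d).
  by rewrite (comb_linear e).
- exists (fun x => x = 0); split; first by move=> x ->; apply: submod0.
  exists 0%N, (fun=> 0) => x; split=> [->|[c ->]]; last by rewrite /comb big_ord0.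
  by exists (fun=> 0); rewrite /comb big_ord0.
exists n, e => x; rewrite -eP; split=> [Ux|/VU //].
pose e' (i : 'I_n.+1) := oapp e x (unlift ord0 i).
have Ee' c : comb e' c = c ord0 *: x + comb e (fun i => c (lift ord0 i)).
  rewrite /comb big_ord_recl /e' unlift_none /=; congr (_ + _).
  by apply: eq_bigr => i _; rewrite liftK.
apply: (Vmax (fun y => exists c, y = comb e' c)).
- split; last by exists n.+1, e'.
  move=> _ [c ->]; rewrite Ee'; apply: submodD => //; first exact: submodZ.
  by apply: VU; apply/eP; exists (fun i => c (lift ord0 i)).
- move=> y /eP[c ->]; exists (fun i => oapp c 0 (unlift ord0 i)).
  rewrite Ee' unlift_none /= scale0r add0r; congr comb.
  by apply/funext => i; rewrite liftK.
- exists (fun i => oapp (fun=> 0) 1 (unlift ord0 i)).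
  by rewrite Ee' unlift_none /= scale1r /comb big1 ?addr0 // => i _;
    rewrite liftK scale0r.
Qed.

Lemma finlen_fin_gen M : finlen M -> fin_gen M.
Proof.
move=> /finlen_fin_gen_sub/(_ (@submod_full _ M))[n [e eP]]; exists n, e => x.
by have [/(_ Logic.I)] := eP x.
Qed.

End Finlen.

(** * Commutative artinian rings have finite length *)

Section Artin.
Context (k : comPzRingType) (kart : artinian k).
Local Notation km := (k^o : lmodType k).

Lemma artinian_min (P : (k -> Prop) -> Prop) :
  (forall U, P U -> submod (U : km -> Prop)) -> (exists U, P U) ->
  exists U, P U /\ forall V, P V -> (forall x, V x -> U x) -> forall x, U x -> V x.
Proof.
move=> Ps [U0 PU0]; apply: contrapT => N.
have step (U : {U | P U}) : exists V : {U | P U},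
    (forall x, sval V x -> sval U x) /\ ~ (forall x, sval U x -> sval V x).
  case: U => U PU /=; apply: contrapT => N'; apply: N; exists U; split=> // V PV VU.
  by apply: contrapT => UV; apply: N'; exists (exist _ V PV).
have [F [_ FS]] := dependent_choice (fun x => cid (step x)) (exist _ U0 PU0).
have [n|n x|n Hn] := kart (I := fun n => sval (F n)).
- have sU := Ps _ (svalP (F n)); split; first exact: (submod0 sU).
    by move=> x y; apply: (submodD sU).
  by move=> a x; apply: (submodZ a sU).
- exact: (FS n).1.
by apply: (FS n).2 => x Fx; apply/(Hn n.+1).
Qed.

Definition flsub (U : k -> Prop) : Prop := exists n, forall V m,
  @chain k km V m -> (forall x, V x -> U x) -> (m <= n)%N.

(* In a minimal ideal [I] of infinite length every scalar acts as zero or as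
   a surjection, hence [I] is a vector space over the field [k / ann I], and
   a hyperplane of [I] contradicts minimality. *)
Lemma artinian_finlen : finlen km.
Proof.
apply: contrapT => N.
pose P (U : k -> Prop) := submod (U : km -> Prop) /\ ~ flsub U.
have [U [sU _]||I [[sI IN] Imin]] := @artinian_min P; first exact: sU.
  exists (fun=> True); split=> // -[n Hn]; apply: N; exists n => U m cU.
  exact: Hn cU _.
have small (V : k -> Prop) : submod (V : km -> Prop) -> (forall x, V x -> I x) ->
    (exists x, I x /\ ~ V x) -> flsub V.
  move=> sV VI [x [Ix Vx]]; apply: contrapT => VN; apply: Vx.
  by apply: (Imin V).
(* If [a] is neither zero nor onto on [I], then its kernel and its image in [I] are proper ideals
   inside [I], of finite length by minimality, and so [I] would have finite length. *)
have act0 (a : k) : (forall x, I x -> a * x = 0) \/ (forall x, I x -> exists2 y,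
  I y & x = a * y).
  apply: contrapT => /not_orP[a0 aN].
  have [x [Ix ax]] : exists x, I x /\ a * x <> 0.
    by apply: contrapT => H; apply: a0 => x Ix; apply: contrapT => ax; apply: H;
      exists x.
  have [z [Iz az]] : exists z, I z /\ ~ exists2 y, I y & z = a * y.
    by apply: contrapT => H; apply: aN => y Iy; apply: contrapT => ay; apply: H;
      exists y.
  have al : linear (fun x : km => a * x : km).
    by move=> b u v; rewrite mulrDr; congr (_ + _); rewrite /GRing.scale /= mulrCA.
  pose f := mklin al.
  have [n1 H1] : flsub (fun y => exists x, I x /\ a * x = y).
    apply: small; first exact: (@submod_im _ km km f I sI).
      by move=> _ [y [Iy <-]]; apply: (submodZ a sI).
    by exists z; split=> // -[y [Iy E]]; apply: az; exists y.
  have [n2 H2] : flsub (fun y => I y /\ a * y = 0).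
    apply: small; first exact: (submod_cap sI (@submod_preim _ km km f _ (@submod_zero _ km))).
      by move=> y [].
    by exists x; split=> // -[].
  apply: IN; exists (n2 + n1)%N => V m cV VI.
  pose F (U : km -> Prop) := fun y : km => U y /\ a * y = 0.
  pose G (U : km -> Prop) := fun y : km => exists x, U x /\ f x = y.
  have sF U : submod U -> submod (F U).
    by move=> sU; apply: (submod_cap sU (@submod_preim _ km km f _ (@submod_zero _ km))).
  have sG U : submod U -> submod (G U) by apply: submod_im.
  have FG U' U : submod U' -> submod U -> (forall x, U' x -> U x) ->
      [/\ forall x, F U' x -> F U x, forall x, G U' x -> G U x
        & (forall x, F U x -> F U' x) -> (forall x, G U x -> G U' x) ->
          forall x, U x -> U' x].
    move=> sU' sU UU; split; first by move=> y [/UU].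
      by move=> y [y' [/UU ? <-]]; exists y'.
    move=> FF GG y Uy; have [|y' [Uy' Ey']] := GG (a * y); first by exists y.
    rewrite -[y](subrK y'); apply: submodD => //; apply: (FF _ _).1; split.
      by apply: submodB => //; apply: UU.
    by rewrite mulrBr -Ey' /= subrr.
  have [l1 [l2 [le c1 c2]]] := chain_split sF sG FG cV.
  apply: leq_trans le (leq_add _ _); first by apply: H2 c1 _ => y [/VI].
  by apply: H1 c2 _ => y [y' [/VI Iy' <-]]; exists y'.
(* A scalar that acts onto [I] is invertible there: the ideals generated by its powers become
   stationary, so [a ^+ n = a ^+ n.+1 * c], and every element of [I] is a multiple of [a ^+ n]. *)
have act (a : k) : (forall x, I x -> a * x = 0) \/ exists c, forall x, I x ->
  c * (a * x) = x.
  have [|as_] := act0 a; [by left | right].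
  have [n|n x [y ->]|n Hn] := kart (I := fun n x => exists y, x = a ^+ n * y).
  - split; first by exists 0; rewrite mulr0.
      by move=> _ _ [x ->] [y ->]; exists (x + y); rewrite mulrDr.
    by move=> b _ [x ->]; exists (b * x); rewrite mulrCA.
  - by exists (a * y); rewrite mulrA -exprSr.
  have [_ /(_ (ex_intro _ 1 (esym (mulr1 _))))[c Ec]] := Hn n.+1 (leqnSn n) (a ^+ n).
  exists c => x Ix.
  have [y Iy ->] : exists2 y, I y & x = a ^+ n * y.
    elim: (n) => [|m [y Iy ->]]; first by exists x; rewrite ?mul1r.
    by have [z Iz ->] := as_ y Iy; exists z; rewrite // mulrA -exprSr.
  by rewrite [in RHS]Ec exprS !mulrA; congr (_ * _); rewrite -mulrA mulrC.
have [x [Ix x0]] : exists x, I x /\ x <> 0.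
  apply: contrapT => H; apply: IN; exists 0%N => V m cV VI.
  by apply: chain_zero cV _ => y /VI Iy; apply: contrapT => y0; apply: H; exists y.
(* Zorn gives a hyperplane [H] that misses [x]. The empty chain has empty union, which is why [Q]
   does not ask for 0; [H 0] is recovered from maximality. *)
pose Q (A : set km) := [/\ forall a y z, A y -> A z -> A (a *: y + z), ~ A x
  & forall y, A y -> I y].
have [F FQ Ftot|H [[HD Hx HI] Hmax]] := @Zorn_bigcup km Q.
  split; last by move=> y [A FA Ay]; case: (FQ _ FA) => _ _; apply.
    move=> a y z [A FA Ay] [B FB Bz]; have [AB|BA] := Ftot _ _ FA FB.
      by exists B => //; case: (FQ _ FB) => BD _ _; apply: BD => //; apply: AB.
    by exists A => //; case: (FQ _ FA) => AD _ _; apply: AD => //; apply: BA.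
  by case=> A /FQ[_ AN _].
have H0 : H 0.
  apply: contrapT => H0; apply: (Hmax (fun y => y = 0)).
    split=> [y Hy|]; last by move=> /(_ 0 erefl).
    by case: H0; have := HD (-1) _ _ Hy Hy; rewrite scaleN1r addNr.
  split=> [a y z -> ->|/x0 //|y ->]; first by rewrite scaler0 addr0.
  exact: submod0 sI.
have sH : submod H by split.
have mem (y : km) : I y -> exists h (c : k), H h /\ y = h + c *: (x : km).
  move=> Iy; have [Hy|Hy] := pselect (H y).
    by exists y, 0; rewrite scale0r addr0.
  pose B (z : km) := exists u v, [/\ H u, (exists a : k, v = a *: y) & z = u + v].
  have sB : submod B by apply: submod_sum sH (submod_cyc y).
  have BI z : B z -> I z.
    move=> [u [_ [/HI Iu [a ->] ->]]]; apply: (submodD sI) => //; exact: (submodZ a sI).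
  have Bx : B x.
    apply: contrapT => Bx; apply: (Hmax B).
      split=> [z Hz|/(_ y)]; first by exists z, 0; split; rewrite ?addr0 //;
        exists 0; rewrite scale0r.
      move=> BH; apply: Hy; apply: BH; exists 0, y; split; rewrite ?add0r //.
      by exists 1; rewrite scale1r.
    by split=> // a u v Bu Bv; case: sB => _; apply.
  case: Bx => h [_ [Hh [c ->] Ex]]; have [c0|[c' c'P]] := act c.
    by case: Hx; rewrite Ex /GRing.scale /= c0 ?addr0.
  exists (- (c' *: h)), c'; split; first by apply/(submodN sH)/(submodZ _ sH).
  rewrite Ex scalerDr addrA addNr add0r /GRing.scale /=.
  by rewrite c'P.
have [q [p [ps pH]]] := quotient_ex sH.
have [n Hn] : flsub H by apply: small => //; exists x.
apply: IN; exists (n + 1)%N => V m cV VI.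
pose F (U : km -> Prop) := fun y : km => U y /\ H y.
pose G (U : km -> Prop) := fun y => exists x, U x /\ p x = y.
have sF U : submod U -> submod (F U) by move=> sU; apply: submod_cap.
have sG U : submod U -> submod (G U) by apply: submod_im.
have FG U' U : submod U' -> submod U -> (forall x, U' x -> U x) ->
    [/\ forall x, F U' x -> F U x, forall x, G U' x -> G U x
      & (forall x, F U x -> F U' x) -> (forall x, G U x -> G U' x) ->
        forall x, U x -> U' x].
  move=> sU' sU UU; split; first by move=> y [/UU].
    by move=> y [y' [/UU ? <-]]; exists y'.
  move=> FF GG y Uy; have [|y' [Uy' Ey']] := GG (p y); first by exists y.
  rewrite -[y](subrK y'); apply: submodD => //; apply: (FF _ _).1; split.
    by apply: submodB => //; apply: UU.
  by apply/pH; rewrite linearB Ey' subrr.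
have [l1 [l2 [le c1 c2]]] := chain_split sF sG FG cV.
apply: leq_trans le (leq_add _ _); first by apply: Hn c1 _ => y [].
apply: (@chain_simple _ _ (fun y => exists x, I x /\ p x = y)) c2 _; last first.
  by move=> _ [y [/VI Iy <-]]; exists y.
move=> _ _ [y [Iy <-]] [z [Iz <-]].
have [h [c [Hh ->]]] := mem _ Iy; have [h' [c' [Hh' ->]]] := mem _ Iz.
rewrite !linearD !linearZ /= (iffLR (pH h) Hh) (iffLR (pH h') Hh') !add0r => cN.
have [c0|[d dP]] := act c.
  by case: cN; rewrite -linearZ /GRing.scale /= c0 // linear0.
exists (c' * d); rewrite scalerA -mulrA -scalerA; congr (_ *: _).
by rewrite -linearZ; congr (p _); rewrite /GRing.scale /= -mulrA dP.
Qed.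

End Artin.

(** * Matlis duality over an artinian ring *)

Lemma factor_surj (R : pzRingType) (A B C : lmodType R) (p : {linear A -> B})
    (h : {linear A -> C}) : surjective p -> (forall x, p x = 0 -> h x = 0) ->
  exists g : {linear B -> C}, forall x, g (p x) = h x.
Proof.
move=> ps ker; pose s y := sval (cid (ps y)).
have sK y : p (s y) = y by rewrite /s; case: cid.
have hE x y : p x = p y -> h x = h y.
  move=> E; apply/eqP; rewrite -subr_eq0 -linearB; apply/eqP/ker.
  by rewrite linearB E subrr.
have gl : linear (h \o s).
  by move=> a x y /=; rewrite -linearP; apply: hE; rewrite linearP !sK.
by exists (mklin gl) => x /=; apply: hE; rewrite sK.
Qed.

Section Matlis.
Context (k : comPzRingType).
Implicit Types M N A B : lmodType k.
Local Notation km := (k^o : lmodType k).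
Context (fk : finlen km).

Definition maxid (m : k -> Prop) : Prop :=
  [/\ submod (m : km -> Prop), ~ m 1 & forall a, ~ m a -> exists b, m (b * a - 1)].

Definition ann M (x : M) (a : k) : Prop := a *: x = 0.

Lemma submod_ann M (x : M) : submod (ann x : km -> Prop).
Proof.
split; first by rewrite /ann scale0r.
move=> a b c bx cx; rewrite /ann scalerDl [(a *: b) *: x](_ : _ = a *: (b *: x)) ?scalerA //.
by rewrite -scalerA bx cx scaler0 addr0.
Qed.

(* The socle of [N] contains each simple module at most once. *)
Definition socle_free N : Prop := forall m, maxid m -> forall x y : N, x <> 0 ->
  (forall a, m a -> a *: x = 0) -> (forall a, m a -> a *: y = 0) ->
  exists c, y = c *: x.

Lemma simple_elt M : finlen M -> ~ zero_module M -> exists x : M,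
  x <> 0 /\ maxid (ann x).
Proof.
move=> fM M0; have [x0 x00] : exists x : M, x <> 0.
  by apply: contrapT => H; apply: M0 => x; apply: contrapT => x0; apply: H; exists x.
pose P (U : M -> Prop) := exists x, x <> 0 /\ U = (fun y => exists a : k, y = a *: x).
have [U [x [_ ->]]||U [[x [x1 ->]] Umin]] := @submod_min _ M P fM.
- exact: submod_cyc.
- by exists (fun y => exists a : k, y = a *: x0), x0.
exists x; split=> //; split; first exact: submod_ann.
  by rewrite /ann scale1r.
move=> a ax; have [b Ex] : exists b : k, x = b *: (a *: x).
  apply: (Umin (fun y => exists b : k, y = b *: (a *: x))).
  - by exists (a *: x).
  - by move=> _ [b ->]; exists (b * a); rewrite scalerA.
  - by exists 1; rewrite scale1r.
by exists b; rewrite /ann scalerBl scale1r -scalerA -Ex subrr.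
Qed.

Lemma comp_linear M N B (p : {linear M -> B}) :
  linear (fun f : lhom B N => mkhom (f \o p) : lhom M N).
Proof. by move=> a f g; apply: lhomP => x. Qed.

Lemma ev_linear M N (x : M) : linear (fun f : lhom M N => f x).
Proof. by []. Qed.

(** Evaluation at a simple element [s] of [M] has values killed by [ann s], so its image has length
    at most one because [N] is [socle_free]; its kernel is the space of maps from [M / ks], where
    [M] has become shorter. *)
Lemma hom_bnd N n M : socle_free N -> bnd M n -> bnd (lhom M N : lmodType k) n.
Proof.
move=> HN; elim: n M => [|n IHn] M bM.
  move/bnd0P: bM => M0; apply/bnd0P => f; apply: lhomP => x.
  by rewrite (M0 x) linear0.
have [M0|M0] := pselect (zero_module M).
  apply: (@bndW _ _ 0) => //; apply/bnd0P => f; apply: lhomP => x.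
  by rewrite (M0 x) linear0.
have [s [s0 smax]] := @simple_elt M (ex_intro _ _ bM) M0.
have [Q [p [ps pker]]] := quotient_ex (submod_cyc s).
have ps0 : p s = 0 by apply/pker; exists 1; rewrite scale1r.
have pN : ~ injective p by move=> pi; apply: s0; apply: pi; rewrite ps0 linear0.
have [_ /IHn bQ] := surj_bnd_lt ps bM pN.
rewrite -addn1; apply: (exact_bnd (f := mklin (@comp_linear M N Q p))
  (g := mklin (@ev_linear M N s)) (m := n)) => //.
  move=> f /= fs0; have [x /pker[a ->]|g gE] := @factor_surj _ _ _ _ p f ps.
    by rewrite linearZ /= fs0 scaler0.
  by exists (mkhom g); apply: lhomP => x; rewrite /= gE.
move=> V l cV VT; apply: (@chain_simple _ _ (fun y => forall a, ann s a ->
  a *: y = 0)) cV _.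
  by move=> y z Ty Tz y0; apply: (HN _ smax).
by move=> y /VT[f /= <-] a sa; rewrite -linearZ /= sa linear0.
Qed.

Lemma hom_flen N M : socle_free N -> finlen M ->
  finlen (lhom M N : lmodType k) /\ (flen (lhom M N : lmodType k) <= flen M)%N.
Proof.
move=> HN fM; have [bM _] := flenP fM; have bH := hom_bnd HN bM.
have fH : finlen (lhom M N : lmodType k) by exists (flen M).
by split=> //; apply: (flenP fH).2.
Qed.

Lemma scale_linear M (x : M) : linear (fun a : km => a *: x).
Proof. by move=> a b c; rewrite scalerDl -scalerA. Qed.

Lemma hom1_linear N : linear (fun x : N => mkhom (mklin (scale_linear x)) : lhom km N).
Proof.
move=> a x y; apply: lhomP => b.
change (b *: (a *: x + y) = a *: (b *: x) + b *: y).
by rewrite scalerDr !scalerA mulrC.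
Qed.

(** [N] embeds in the homomorphisms from [k] to [N], whose length is at most that of [k]. *)
Lemma socle_free_flen N : socle_free N -> finlen N -> (flen N <= flen km)%N.
Proof.
move=> HN fN; have [fH le] := hom_flen HN fk; apply: leq_trans le.
apply: (flen_inj (f := mklin (@hom1_linear N))) fH => x y E.
by have := congr1 (fun f : lhom km N => f 1) E; rewrite /= !scale1r.
Qed.

(** Maximal length encodes the minimal injective cogenerator without constructing injective hulls:
    splitting, extension and cogeneration are all drawn from it. *)
Definition matlis N : Prop := [/\ finlen N, socle_free N
  & forall N', finlen N' -> socle_free N' -> (flen N' <= flen N)%N].

Lemma matlis_ex : exists J, matlis J.
Proof.
pose P n := `[< exists N, [/\ finlen N, socle_free N & flen N = n] >].
have P1 : exists n, P n.
  have [Z [p [ps pz]]] := quotient_ex (@submod_full _ km).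
  have Z0 (x : Z) : x = 0 by have [y <-] := ps x; apply/pz.
  exists (flen Z); apply/asboolP; exists Z; split=> //.
    by exists 0%N; apply/bnd0P => x; apply: Z0.
have Pb n : P n -> (n <= flen km)%N.
  by move=> /asboolP[N [fN HN <-]]; apply: socle_free_flen.
case: (ex_maxnP P1 Pb) => n /asboolP[J [fJ HJ lJ]] nmax; exists J; split=> // N fN HN.
by rewrite lJ; apply: nmax; apply/asboolP; exists N.
Qed.

Context (J : lmodType k) (HJ : matlis J).

Lemma matlis_finlen : finlen J. Proof. by case: HJ. Qed.

(** If the simple module [S = k / m] were missing from the socle of [J], the sum of [J] and [S]
    would still be [socle_free], and longer. *)
Lemma matlis_simple m : maxid m -> exists j : J, j <> 0 /\ forall a, m a -> a *: j = 0.
Proof.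
move=> mm; have [fJ sJ Jmax] := HJ; apply: contrapT => N.
have [sm m1 minv] := mm.
have [S [p [ps pm]]] := quotient_ex sm.
have Sgen (y : S) : exists a, y = a *: p 1.
  by have [a <-] := ps y; exists a; rewrite -linearZ /GRing.scale /= mulr1.
have Skill a (y : S) : m a -> a *: y = 0.
  have [b <-] := ps y => ma; rewrite -linearZ; apply/pm.
  by rewrite /GRing.scale /= mulrC; apply: (submodZ b sm).
have Sinv a (y : S) : ~ m a -> exists b, b *: (a *: y) = y.
  move=> /minv[b mb]; exists b; apply/eqP; rewrite scalerA -subr_eq0 -{2}[y]scale1r.
  by rewrite -scalerBl Skill.
have fS : finlen S := surj_finlen ps fk.
have sJS : socle_free (J * S)%type.
  move=> m' [sm' m'1 m'inv] [j s] [j' s'] xy0 kx ky.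
  have kj a : m' a -> a *: j = 0 by move=> /kx[].
  have ks a : m' a -> a *: s = 0 by move=> /kx[].
  have kj' a : m' a -> a *: j' = 0 by move=> /ky[].
  have ks' a : m' a -> a *: s' = 0 by move=> /ky[].
  have [[a [m'a ma]]|sub] := pselect (exists a, m' a /\ ~ m a).
    have s0 : s = 0 by have [b <-] := Sinv a s ma; rewrite ks // scaler0.
    have s'0 : s' = 0 by have [b <-] := Sinv a s' ma; rewrite ks' // scaler0.
    rewrite s0 s'0 in xy0 *; have j0 : j <> 0 by move=> j0; apply: xy0; rewrite j0.
    have mm' : maxid m' by split.
    have [c ->] := sJ _ mm' j j' j0 kj kj'.
    by exists c; congr pair; rewrite /= scaler0.
  have m'm a : m' a -> m a by move=> m'a; apply: contrapT => ma; apply: sub; exists a.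
  have mm'' a : m a -> m' a.
    move=> ma; apply: contrapT => /m'inv[b /m'm mb]; apply: m1.
    rewrite -(subKr (b * a) 1); apply: (submodB sm) => //; exact: (submodZ b sm).
  have j0 : j = 0.
    by apply: contrapT => j0; apply: N; exists j; split=> // a /mm''; apply: kj.
  have j'0 : j' = 0.
    by apply: contrapT => j0'; apply: N; exists j'; split=> // a /mm''; apply: kj'.
  rewrite j0 j'0 in xy0 *; have s0 : s <> 0 by move=> s0; apply: xy0; rewrite s0.
  have [a Ea] := Sgen s; have [b Eb] := Sgen s'.
  have ma : ~ m a.
    move=> ma; apply: s0; rewrite Ea; exact: Skill.
  have [c Ec] := Sinv a (p 1) ma.
  exists (b * c); congr pair; first by rewrite /= scaler0.
  by rewrite /= Ea Eb -scalerA Ec.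
have fJS : finlen (J * S)%type by apply: finlen_prod.
have ii : injective (mklin (@inl_linear _ J S)) by move=> x y [].
by have [x [_ /esym/pm]] := inj_flen_surj ii fJS (Jmax _ fJS sJS) (0, p 1).
Qed.

(** Divide by a submodule [U] maximal among those meeting [J] trivially. Then [J] is essential in
    the quotient [Q], so [Q] has no new socle and by maximality of [J] is no longer than [J]: the
    embedding is onto. *)
Lemma matlis_split M (i : {linear J -> M}) : injective i -> finlen M ->
  exists r : {linear M -> J}, forall x, r (i x) = x.
Proof.
move=> ii fM; have [fJ sJ Jmax] := HJ.
pose P (U : M -> Prop) := submod U /\ forall x, U (i x) -> x = 0.
have [U []//||U [[sU Ui] Umax]] := @submod_max _ M P fM.
  exists (fun x => x = 0); split; first exact: submod_zero.
  by move=> x E; apply: ii; rewrite E linear0.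
have [Q [p [ps pU]]] := quotient_ex sU.
have pii : injective (p \o i) by apply: linear_injP => x /= /pU/Ui.
have ess m (x : Q) : maxid m -> x <> 0 -> (forall a, m a -> a *: x = 0) ->
    exists j, x = p (i j).
  move=> [sm m1 minv] x0 mx; have [y Ey] := ps x.
  pose V z := exists u v, [/\ U u, (exists a : k, v = a *: y) & z = u + v].
  have sV : submod V by apply: submod_sum sU (submod_cyc y).
  have [j [Vj j0]] : exists j, V (i j) /\ j <> 0.
    apply: contrapT => H; apply: x0; rewrite -Ey; apply/pU.
    apply: (Umax V); first split=> //.
    - by move=> j Vj; apply: contrapT => j0; apply: H; exists j.
    - by move=> z Uz; exists z, 0; split; rewrite ?addr0 //; exists 0; rewrite scale0r.
    - by exists 0, y; split; rewrite ?add0r //; [exact: submod0 | exists 1;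
      rewrite scale1r].
  have [u [_ [Uu [a ->] Ej]]] := Vj.
  have Ea : p (i j) = a *: x.
    by rewrite Ej linearD linearZ /= Ey (iffLR (pU u) Uu) add0r.
  have ma : ~ m a.
    move=> /mx E; apply: j0; apply: pii; rewrite /= Ea E.
    by rewrite !linear0.
  have [b mb] := minv a ma; exists (b *: j).
  rewrite !linearZ /= Ea scalerA; apply/eqP; rewrite eq_sym -subr_eq0 -{2}[x]scale1r.
  by rewrite -scalerBl mx.
have sQ : socle_free Q.
  move=> m mm x y x0 mx my.
  have [j Ej] := ess m x mm x0 mx.
  have [y0|y0] := pselect (y = 0); first by exists 0; rewrite scale0r.
  have [j' Ej'] := ess m y mm y0 my.
  have j0 : j <> 0 by move=> j0; apply: x0; rewrite Ej j0 !linear0.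
  have kj (z : J) (w : Q) : w = p (i z) -> (forall a, m a -> a *: w = 0) -> forall a,
    m a -> a *: z = 0.
    by move=> Ew mw a /mw E; apply: pii; rewrite /= !linearZ /= -Ew E !linear0.
  have [c Ec] := sJ m mm j j' j0 (kj _ _ Ej mx) (kj _ _ Ej' my).
  by exists c; rewrite Ej' Ec !linearZ /= -Ej.
have fQ := surj_finlen ps fM.
have pis := inj_flen_surj (f := p \o i) pii fQ (Jmax _ fQ sQ).
have [r rP] := @factor_surj _ _ _ _ (p \o i) idfun pis
  (fun x E => pii x 0 (etrans E (esym (linear0 (p \o i))))).
by exists (r \o p) => x; apply: rP.
Qed.

(** [J] embeds in the pushout of [h] and [p] because [h] kills the kernel of [p]; a retraction of
    this embedding yields [g]. *)
Lemma matlis_ext A B (p : {linear A -> B}) (h : {linear A -> J}) : finlen B ->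
  (forall x, p x = 0 -> h x = 0) ->
  exists g : {linear B -> J}, forall x, g (p x) = h x.
Proof.
move=> fB ker.
have dl : linear (fun x => (h x, - p x) : J * B).
  by move=> a x y; congr pair; rewrite /= linearP // opprD -scalerN.
have sU := @submod_im _ _ _ (mklin dl) _ (@submod_full _ A).
have [Q [q [qs qU]]] := quotient_ex sU.
have qi : injective (q \o mklin (@inl_linear _ J B)).
  apply: linear_injP => j /= /qU[x [_ [<- /eqP]]].
  by rewrite oppr_eq0 => /eqP/ker.
have fQ : finlen Q := surj_finlen qs (finlen_prod matlis_finlen fB).
have [r rP] := @matlis_split Q (q \o mklin (@inl_linear _ J B)) qi fQ.
exists (r \o q \o mklin (@inr_linear _ J B)) => x /=.
rewrite -[RHS]rP /=; congr (r _); apply/esym/eqP; rewrite -subr_eq0 -linearB.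
by apply/eqP/qU; exists x; split=> //; congr pair; rewrite /= ?subr0 ?sub0r.
Qed.

(** For a maximal ideal [m] above the annihilator of [x], the map from [kx] to [k / m] and on to [J]
    extends to [M]. *)
Lemma matlis_cogen M (x : M) : finlen M -> x <> 0 -> exists f : {linear M -> J},
  f x <> 0.
Proof.
move=> fM x0.
pose P (m : km -> Prop) := [/\ submod m, ~ m 1 & forall a, ann x a -> m a].
have [m []//||m [[sm m1 xm] mmax]] := @submod_max _ km P fk.
  exists (ann x); split=> //; first exact: submod_ann.
  by rewrite /ann scale1r.
have mm : maxid m.
  split=> // a ma.
  pose V (z : km) := exists u v, [/\ m u, (exists b : k,
    v = b *: (a : km)) & z = u + v].
  have sV : submod V by apply: submod_sum sm (submod_cyc _).
  have mV z : m z -> V z.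
    by move=> mz; exists z, 0; split; rewrite ?addr0 //; exists 0; rewrite scale0r.
  have [u [_ [mu [b ->] E]]] : V 1.
    apply: contrapT => V1; apply: ma; apply: (mmax V); first by split=> // z /xm/mV.
      by [].
    by exists 0, a; split; rewrite ?add0r //; [exact: submod0 | exists 1;
      rewrite scale1r].
  exists b; rewrite [1]E /GRing.scale /= opprD addrCA subrr addr0.
  exact: (submodN sm).
have [j [j0 mj]] := matlis_simple mm.
have [g gP] := @matlis_ext km M (mklin (scale_linear x)) (mklin (scale_linear j)) fM
  (fun a ax => mj a (xm a ax)).
by exists g => gx; apply: j0; have := gP 1; rewrite /= !scale1r gx.
Qed.

Lemma matlis_separate M (T : M -> Prop) (x : M) : finlen M -> submod T -> ~ T x ->
  exists f : {linear M -> J}, (forall y, T y -> f y = 0) /\ f x <> 0.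
Proof.
move=> fM sT Tx; have [Q [p [ps pT]]] := quotient_ex sT.
have [|f fx] := @matlis_cogen Q (p x) (surj_finlen ps fM); first by move/pT.
by exists (f \o p); split=> // y /pT /= ->; rewrite linear0.
Qed.

Lemma biev_linear M : linear (fun x : M =>
  mkhom (mklin (@ev_linear M J x)) : lhom (lhom M J : lmodType k) J).
Proof. by move=> a x y; apply: lhomP => f /=; rewrite linearP. Qed.

(** Evaluation into the bidual is injective by cogeneration. Each dual is no longer than the module
    it comes from, so it is also onto. *)
Lemma matlis_bidual M (t : {linear (lhom M J : lmodType k) -> J}) : finlen M ->
  exists x : M, forall f, t f = f x.
Proof.
move=> fM; have [fJ sJ _] := HJ.
have [fH lH] := hom_flen sJ fM; have [fHH lHH] := hom_flen sJ fH.
have bi : injective (mklin (@biev_linear M)).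
  apply: linear_injP => x /= E; apply: contrapT => /(matlis_cogen fM)[f]; apply.
  by have := congr1 (fun g : lhom (lhom M J : lmodType k) J => g (mkhom f)) E.
have [x Ex] := inj_flen_surj bi fHH (leq_trans lHH lH) (mkhom t).
by exists x => f; have := congr1 (fun g : lhom (lhom M J : lmodType k) J => g f) Ex.
Qed.

End Matlis.

(** * Almost split morphisms *)

Lemma linear_inv (R : pzRingType) (M N : lmodType R) (f : {linear M -> N}) :
  bijective f -> exists g : {linear N -> M}, cancel f g /\ cancel g f.
Proof.
move=> [g fg gf]; have gl : linear g.
  by move=> a x y; apply: (can_inj fg); rewrite linearP !gf.
by exists (mklin gl).
Qed.

Lemma bijP (R : pzRingType) (M N : lmodType R) (f : {linear M -> N}) :
  injective f -> surjective f -> bijective f.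
Proof.
move=> fi fs; pose s y := sval (cid (fs y)).
have sK y : f (s y) = y by rewrite /s; case: cid.
by exists s => [x|//]; apply: fi.
Qed.

Lemma lift_inj (R : pzRingType) (E M X : lmodType R) (i : {linear E -> M})
    (f : {linear X -> M}) : injective i -> (forall x, exists y, i y = f x) ->
  exists g : {linear X -> E}, forall x, i (g x) = f x.
Proof.
move=> ii H; pose g x := sval (cid (H x)).
have gE x : i (g x) = f x by rewrite /g; case: cid.
have gl : linear g by move=> a x y; apply: ii; rewrite linearP !gE linearP.
by exists (mklin gl).
Qed.

Section Restriction.
Context (k : comPzRingType) (L : pzRingType) (phi : {rmorphism k -> L}).

(** The dummy [let] makes [phi] a parameter of the type, so that the scaling by [k] can be attached
    to it. *)
Definition res (M : lmodType L) : Type := let _ := phi in M.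

Section ResInst.
Context (M : lmodType L).
HB.instance Definition _ := GRing.Zmodule.copy (res M) M.

Definition res_scale (a : k) (x : res M) : res M := phi a *: (x : M).

Lemma res_scalerA a b v : res_scale a (res_scale b v) = res_scale (a * b) v.
Proof. by rewrite /res_scale scalerA rmorphM. Qed.
Lemma res_scale1r : left_id 1 res_scale.
Proof. by move=> v; rewrite /res_scale rmorph1 scale1r. Qed.
Lemma res_scalerDr : right_distributive res_scale +%R.
Proof. by move=> a u v; rewrite /res_scale scalerDr. Qed.
Lemma res_scalerDl v : {morph res_scale^~ v : a b / a + b}.
Proof. by move=> a b; rewrite /res_scale rmorphD scalerDl. Qed.

HB.instance Definition _ := GRing.Zmodule_isLmodule.Build k (res M)
  res_scalerA res_scale1r res_scalerDr res_scalerDl.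
End ResInst.

Lemma resE (M : lmodType L) a (x : res M) : a *: x = phi a *: (x : M).
Proof. by []. Qed.

Lemma reslin_linear (M N : lmodType L) (f : {linear M -> N}) :
  linear (f : res M -> res N).
Proof. by move=> a x y; rewrite !resE linearP. Qed.

Definition reslin (M N : lmodType L) (f : {linear M -> N}) :
  {linear (res M : lmodType k) -> (res N : lmodType k)} := mklin (reslin_linear f).

Definition dlt (M : zmodType) n (i : 'I_n) (x : M) : 'I_n -> M :=
  fun j => if j == i then x else 0.

Lemma dlt_sum (M : zmodType) n (u : 'I_n -> M) : u = \sum_i dlt i (u i).
Proof.
apply/funext => j; rewrite fct_sumE (bigD1 j) //= /dlt eqxx big1 ?addr0 // => i.
by rewrite eq_sym => /negPf ->.
Qed.

Lemma dlt_linear (R : pzRingType) (M : lmodType R) n (i : 'I_n) :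
  linear (dlt i : M -> ('I_n -> M)).
Proof.
move=> a x y; apply/funext => j.
change (dlt i (a *: x + y) j = a *: dlt i x j + dlt i y j).
by rewrite /dlt; case: ifP; rewrite // scaler0 addr0.
Qed.

Context (phiC : forall a x, GRing.comm (phi a) x).
Context (fk : finlen (k^o : lmodType k)).
Context (fL : finlen (res L^o : lmodType k)).

Lemma fin_gen_res (M : lmodType L) : fin_gen M -> finlen (res M : lmodType k).
Proof.
move=> [n [e eP]].
have cl : linear (comb e : ('I_n -> res L^o) -> res M).
  by move=> a u v; exact: (comb_linear e (phi a) u v).
apply: (surj_finlen (f := mklin cl)); last exact: finlen_fct.
by move=> x; have [c ->] := eP x; exists c.
Qed.

Lemma res_fin_gen (M : lmodType L) : finlen (res M : lmodType k) -> fin_gen M.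
Proof.
move=> /finlen_fin_gen[n [e eP]]; exists n, e => x.
by have [c ->] := eP x; exists (fun i => phi (c i)).
Qed.

Context (J : lmodType k) (HJ : matlis J).

(* The module [Hom_k(L ^ m, J)], on which [L] acts through its right action
   on [L ^ m]. *)
Definition dualm (m : nat) : Type := lhom ('I_m -> res L^o : lmodType k) J.

Section Dual.
Context (m : nat).
HB.instance Definition _ := GRing.Zmodule.copy (dualm m)
  (lhom ('I_m -> res L^o : lmodType k) J).

Lemma rmul_linear (l : L) :
  linear (fun (u : 'I_m -> res L^o) (j : 'I_m) => (u j : L) * l : res L^o).
Proof.
move=> a u v; apply/funext => j.
change ((phi a * u j + v j) * l = phi a * (u j * l) + v j * l).
by rewrite mulrDl mulrA.
Qed.

Definition dual_scale (l : L) (t : dualm m) : dualm m :=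
  mkhom (t \o mklin (rmul_linear l)).

Lemma dual_scalerA a b v : dual_scale a (dual_scale b v) = dual_scale (a * b) v.
Proof.
apply: lhomP => u; congr (lfun v _); apply/funext => j.
by rewrite /= mulrA.
Qed.
Lemma dual_scale1r : left_id 1 dual_scale.
Proof. by move=> v; apply: lhomP => u; congr (lfun v _); apply/funext => j;
  rewrite /= mulr1. Qed.
Lemma dual_scalerDr : right_distributive dual_scale +%R.
Proof. by move=> a u v; apply: lhomP. Qed.
Lemma dual_scalerDl v : {morph dual_scale^~ v : a b / a + b}.
Proof.
move=> a b; apply: lhomP => u; rewrite [RHS](_ : _ = lfun v (fun j =>
  u j * a) + lfun v (fun j => u j * b)) //.
rewrite -linearD; congr (lfun v _); apply/funext => j.
by rewrite /= mulrDr.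
Qed.

HB.instance Definition _ := GRing.Zmodule_isLmodule.Build L (dualm m)
  dual_scalerA dual_scale1r dual_scalerDr dual_scalerDl.

Lemma dualE (l : L) (t : dualm m) u : lfun (l *: t) u = lfun t (fun j => u j * l).
Proof. by []. Qed.

Lemma res_dual_linear : linear (fun t : res (dualm m) =>
  t : lhom ('I_m -> res L^o : lmodType k) J).
Proof.
move=> a x y; apply: lhomP => u.
change (lfun x (fun j => u j * phi a) + lfun y u = a *: lfun x u + lfun y u).
congr (_ + _); rewrite -linearZ; congr (lfun x _); apply/funext => j.
by rewrite -[RHS]/(phi a * u j) phiC.
Qed.

Lemma finlen_dual : finlen (res (dualm m) : lmodType k).
Proof.
have [_ sJ _] := HJ.
have [fH _] := hom_flen sJ (finlen_fct m fL).
by apply: (inj_finlen (f := mklin res_dual_linear)) fH => x y.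
Qed.

End Dual.

(** By adjunction, a functional [p] on [M] with [p x <> 0] gives the [L]-linear map sending [y] to
    the functional [p (u *: y)] of [u]. *)
Lemma dual_cogen (M : lmodType L) : fin_gen M -> ~ zero_module M ->
  exists f : {linear M -> dualm 1}, exists x, f x <> 0.
Proof.
move=> fM M0; have [x x0] : exists x : M, x <> 0.
  by apply: contrapT => H; apply: M0 => x; apply: contrapT => x0; apply: H; exists x.
have [p px] := matlis_cogen fk HJ (fin_gen_res fM) x0.
have ul (y : M) : linear (fun u : 'I_1 -> res L^o => p ((u ord0 : L) *: y)).
  move=> a u v; rewrite -linearP; congr (p _).
  change ((phi a * (u ord0 : L) + (v ord0 : L)) *: y =
    phi a *: ((u ord0 : L) *: y) + (v ord0 : L) *: y).
  by rewrite scalerDl scalerA.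
pose f (y : M) : dualm 1 := mkhom (mklin (ul y)).
have fl : linear f.
  move=> a y z; apply: lhomP => u.
  rewrite -[RHS]/(p ((u ord0 * a) *: y) + p ((u ord0 : L) *: z)) -linearD.
  by congr (p _); rewrite /= scalerDr scalerA.
exists (mklin fl), x => /(congr1 (fun t : dualm 1 => lfun t (fun=> 1))).
by rewrite /= scale1r.
Qed.

Definition local_end (M : lmodType L) : Prop := forall g1 g2 g : {linear M -> M},
  (forall x, g x = g1 x + g2 x) -> bijective g -> bijective g1 \/ bijective g2.

Definition sect (M N : lmodType L) (f : {linear M -> N}) : Prop :=
  exists r : {linear N -> M}, forall x, r (f x) = x.
Definition retr (M N : lmodType L) (f : {linear M -> N}) : Prop :=
  exists s : {linear N -> M}, forall x, f (s x) = x.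

(** This makes the radical of [End M] a [k]-submodule. Centrality of [phi a] makes [phi a *: g1]
    linear, and were it bijective, so would be [g1]. *)
Lemma nonbij_comb (M : lmodType L) (g1 g2 : {linear M -> M}) a : local_end M ->
  ~ bijective g1 -> ~ bijective g2 ->
  exists g : {linear M -> M}, ~ bijective g /\ forall x, g x = phi a *: g1 x + g2 x.
Proof.
move=> Ml b1 b2.
have l1 : linear (fun x => phi a *: g1 x).
  by move=> b x y; rewrite linearP scalerDr !scalerA phiC.
have l2 : linear (fun x => phi a *: g1 x + g2 x).
  move=> b x y; rewrite !linearP !scalerDr !scalerA phiC.
  by rewrite addrACA.
exists (mklin l2); split=> // /(Ml (mklin l1) g2 (mklin l2) (fun=> erefl))[b|//].
apply: b1; apply: bijP => [x y E|y].
  by apply: (bij_inj b); rewrite /= E.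
case: b => h _ hK; exists (phi a *: h y).
by rewrite linearZ -[RHS]hK.
Qed.

Lemma nonbij0 (M : lmodType L) : ~ zero_module M ->
  exists g : {linear M -> M}, ~ bijective g /\ forall x, g x = 0.
Proof.
move=> M0; have l0 : linear (fun _ : M => 0 : M) by move=> a x y; rewrite scaler0 addr0.
exists (mklin l0); split=> // /bij_inj i; apply: M0 => x.
exact: i.
Qed.

Lemma gens_inj (M N : lmodType L) n (e : 'I_n -> M) (f g : {linear M -> N}) :
  (forall x, exists c, x = comb e c) -> (forall i, f (e i) = g (e i)) -> f =1 g.
Proof.
move=> eP fg x; have [c ->] := eP x; rewrite /comb !linear_sum.
by apply: eq_bigr => i _; rewrite !linearZ /= fg.
Qed.

(* Let [p] be a functional on [End N] with kernel containing the radical and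
   [p 1 <> 0].  Then [f : X -> N] is a non-retraction iff the functional
   [g |-> p (f \o g)] on [Hom(N, X)] vanishes; this condition is expressed by
   a presentation [L ^ m -> L ^ n -> N] of [N] and extended functionals, i.e.
   as a factorization through a pullback of [Hom_k(L ^ m, J)]. *)
Lemma right_almost_split_ex (N : lmodType L) :
  fin_gen N -> ~ zero_module N -> local_end N ->
  exists (E : lmodType L) (g : {linear E -> N}), [/\ fin_gen E, ~ retr g
    & forall (X : lmodType L) (h : {linear X -> N}), fin_gen X -> ~ retr h ->
      exists h' : {linear X -> E}, forall x, h x = g (h' x)].
Proof.
move=> fN N0 Nl; have [n [e eP]] := fN.
have fresN := fin_gen_res fN.
(* The radical of [End N], with endomorphisms coded by their values on the generators [e]; the
   identity is [e] itself. *)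
pose T (u : 'I_n -> res N) := exists g : {linear N -> N},
  ~ bijective g /\ forall i, u i = g (e i).
have sT : submod (T : ('I_n -> res N : lmodType k) -> Prop).
  split; first by have [g [gN g0]] := nonbij0 N0; exists g; split=> // i; rewrite g0.
  move=> a u v [g1 [b1 E1]] [g2 [b2 E2]].
  have [g [gN gE]] := nonbij_comb a Nl b1 b2; exists g; split=> // i.
  by rewrite gE -E1 -E2.
have Te : ~ T e.
  move=> [g [gN gE]]; apply: gN; apply: (eq_bij (f := id)); first by exists id.
  by apply: (@gens_inj _ _ _ e idfun g) => // i; rewrite -gE.
have [P [PT Pe]] := matlis_separate fk HJ (finlen_fct n fresN) sT Te.
pose Rel (c : 'I_n -> res L^o) := comb e c = 0.
have sRel : submod (Rel : ('I_n -> res L^o : lmodType k) -> Prop).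
  split; first by rewrite /Rel -[RHS](linear0 (mklin (comb_linear e))).
  move=> a u v Eu Ev; rewrite /Rel.
  rewrite -[RHS](_ : phi a *: comb e u + comb e v = 0).
    exact: (comb_linear e (phi a) u v).
  by rewrite Eu Ev scaler0 addr0.
have [m [r rP]] := finlen_fin_gen_sub (finlen_fct n fL) sRel.
pose rmat (v : 'I_n -> res L^o) : 'I_m -> res L^o := fun j => \sum_i (r j i : L) * v i.
pose Ep (z : N * dualm m) := forall v : 'I_n -> L,
  P (fun i => v i *: z.1) = lfun z.2 (rmat v).
have sE : submod Ep.
  split.
    move=> v; rewrite -[RHS]/0 -[RHS](linear0 P); congr (P _); apply/funext => i.
    by change (v i *: (0 : N) = 0); rewrite scaler0.
  move=> l [y t] [y' t'] Ey Ey' v; rewrite /= in Ey Ey'.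
  rewrite -[RHS]/(lfun t (fun j => rmat v j * l) + lfun t' (rmat v)).
  rewrite -Ey'.
  rewrite (_ : (fun j => rmat v j * l) = rmat (fun i => v i * l)); last first.
    apply/funext => j; rewrite /rmat mulr_suml; apply: eq_bigr => i _.
    by rewrite mulrA.
  rewrite -Ey -linearD; congr (P _); apply/funext => i.
  by rewrite /= scalerDr scalerA.
have [E [i [ii iE]]] := submodule_ex sE.
have fE : fin_gen E.
  apply: res_fin_gen.
  have il : linear (fun x : res E => i x : (res N * res (dualm m))%type).
    by move=> a x y; rewrite resE linearP.
  apply: (inj_finlen (f := mklin il)); first exact: ii.
  by apply: finlen_prod => //; apply: finlen_dual.
exists E, (mklin (@fst_linear _ _ _) \o i); split=> //.
- move=> [s sK]; pose t y := (i (s y)).2.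
  have tE y : Ep (y, t y).
    apply/iE; exists (s y); rewrite [LHS]surjective_pairing; congr pair. exact: sK.
  have t0 : t 0 = 0 by rewrite /t !linear0.
  have tD y z : t (y + z) = t y + t z by rewrite /t !linearD.
  have tZ l y : t (l *: y) = l *: t y by rewrite /t !linearZ.
  have rmat_dlt i1 : rmat (dlt i1 1) = fun j => r j i1.
    apply/funext => j; rewrite /rmat (bigD1 i1) //= /dlt eqxx mulr1 big1 ?addr0 //.
    by move=> i2 /negPf ->; rewrite mulr0.
  have dlt_mul j (l : L) : (fun j' : 'I_m => dlt j (1 : L) j' * l) = dlt j l.
    by apply/funext => j'; rewrite /dlt; case: ifP => _; rewrite ?mul1r ?mul0r.
  (* A section makes [t] an [L]-linear map on [N]. This turns [P e] into a sum over [j] of terms [t]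
     of the relation [r j] evaluated at [e], and these relations vanish. *)
  apply: Pe; rewrite [e in P e]dlt_sum linear_sum /=.
  transitivity (\sum_(i1 < n) \sum_(j < m) lfun (t ((r j i1 : L) *: e i1)) (dlt j (1 : L))).
    apply: eq_bigr => i1 _; have := tE (e i1) (dlt i1 1); rewrite /= rmat_dlt.
    rewrite [X in P X](_ : _ = dlt i1 (e i1)); last first.
      by apply/funext => i2; rewrite /dlt; case: ifP => _; rewrite ?scale1r ?scale0r.
    move=> ->; rewrite [X in lfun _ X]dlt_sum linear_sum; apply: eq_bigr => j _.
    by rewrite tZ dualE dlt_mul.
  rewrite exchange_big big1 // => j _.
  have tu_D : {morph (fun y => lfun (t y) (dlt j 1)) : y z / y + z}.
    by move=> y z; rewrite tD.
  have tu_0 : lfun (t 0) (dlt j 1) = 0 by rewrite t0.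
  rewrite -(big_morph (fun y => lfun (t y) (dlt j 1)) tu_D tu_0).
  rewrite [X in t X](_ : _ = 0) ?t0 //.
  have /rP : exists c, r j = comb r c by exists (fun j' => (j' == j)%:R);
    rewrite comb_delta.
  by [].
move=> X h fX hN; have fresX := fin_gen_res fX.
pose p (x : 'I_n -> res X) : 'I_m -> res X := fun j => \sum_i (r j i : L) *: (x i : X).
have pl : linear p.
  move=> a u v; apply/funext => j.
  change (p (a *: u + v) j = phi a *: (p u j : X) + p v j).
  rewrite /p scaler_sumr -big_split /=; apply: eq_bigr => i1 _.
  change ((r j i1 : L) *: (phi a *: (u i1 : X) + (v i1 : X)) =
    phi a *: ((r j i1 : L) *: (u i1 : X)) + (r j i1 : L) *: (v i1 : X)).
  by rewrite scalerDr !scalerA phiC.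
pose q (x : 'I_n -> res X) : J := P (fun i1 => h (x i1)).
have ql : linear q.
  move=> a u v; rewrite /q -linearP; congr (P _); apply/funext => i1.
  change (h (phi a *: (u i1 : X) + (v i1 : X)) = phi a *: h (u i1) + h (v i1)).
  by rewrite linearP.
(* The kernel of [p] consists of the maps from [N] to [X], and [q] vanishes on it because [h \o g]
   is never bijective. The extension [Q] of [q] along [p] supplies the second component of the lift
   of [h]. *)
have [|Q QE] := matlis_ext HJ (p := mklin pl) (h := mklin ql) (finlen_fct m fresX).
  move=> x /= px0.
  have [||g gE] := @factor_surj _ _ _ _ (mklin (comb_linear e)) (mklin (comb_linear (x : 'I_n -> X))).
  - by move=> y; have [c ->] := eP y; exists c.
  - move=> c /(rP c)[d ->] /=.
    transitivity (\sum_j phi (d j) *: (p x j : X)); last first.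
      by rewrite px0 big1 // => j _; exact: scaler0.
    rewrite /comb /p; under [RHS]eq_bigr do rewrite scaler_sumr.
    rewrite exchange_big; apply: eq_bigr => i1 _ /=.
    rewrite fct_sumE scaler_suml; apply: eq_bigr => j _.
    by rewrite scalerA.
  have ge i1 : g (e i1) = x i1.
    by have := gE (fun j => (j == i1)%:R); rewrite /= !comb_delta.
  apply: PT; exists (h \o g); split; last by move=> i1 /=; rewrite ge.
  by move=> /linear_inv[g' [_ g'K]]; apply: hN; exists (g \o g') => y; apply: g'K.
have tl (x : X) : linear (fun u : 'I_m -> res L^o => Q (fun j => (u j : L) *: x)).
  move=> a u v; rewrite -linearP; congr (Q _); apply/funext => j.
  change ((phi a * (u j : L) + (v j : L)) *: x = phi a *: ((u j : L) *: x) + (v j : L) *: x).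
  by rewrite scalerDl scalerA.
pose f (x : X) : N * dualm m := (h x, mkhom (mklin (tl x))).
have fl : linear f.
  move=> a x y; congr pair; first exact: linearP.
  apply: lhomP => u.
  rewrite -[RHS]/(Q (fun j => ((u j : L) * a) *: x) + Q (fun j =>
    (u j : L) *: y)) -linearD.
  by congr (Q _); apply/funext => j; rewrite /= scalerDr scalerA.
have [x|h' h'E] := lift_inj (f := mklin fl) ii.
  apply/iE => v; rewrite /f /=.
  rewrite -[LHS](_ : q (fun i1 => v i1 *: x) = _); last first.
    by rewrite /q; congr (P _); apply/funext => i1; rewrite linearZ.
  rewrite -[LHS]QE; congr (Q _); apply/funext => j.
  rewrite /= /p /rmat scaler_suml; apply: eq_bigr => i1 _.
  by rewrite scalerA.
by exists h' => x; rewrite /= h'E.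
Qed.

(* The dual construction, with a presentation of [Hom_k(K, J)] and a pushout
   of [L ^ m]; biduality of [K] turns functionals on [Hom_k(K, J)] back into
   elements of [K]. *)
Lemma left_almost_split_ex (K : lmodType L) :
  fin_gen K -> ~ zero_module K -> local_end K ->
  exists (E : lmodType L) (g : {linear K -> E}), [/\ fin_gen E, ~ sect g
    & forall (X : lmodType L) (h : {linear K -> X}), fin_gen X -> ~ sect h ->
      exists h' : {linear E -> X}, forall x, h x = h' (g x)].
Proof.
move=> fK K0 Kl; have fresK := fin_gen_res fK; have [_ sJ _] := HJ.
pose DK : lmodType k := lhom (res K : lmodType k) J.
have [fDK _] := hom_flen sJ fresK.
have [n [e eP]] := finlen_fin_gen fDK.
have e_inj (x y : K) : (forall i, lfun (e i) x = lfun (e i) y) -> x = y.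
  move=> exy; apply/eqP; rewrite -subr_eq0; apply/eqP; apply: contrapT.
  move=> /(@matlis_cogen _ fk _ HJ (res K : lmodType k) (x - y) fresK) [f]; apply.
  have [c Ec] := eP (mkhom f).
  transitivity (\sum_i c i *: lfun (e i) (x - y)).
    have := congr1 (fun t : DK => lfun t (x - y)) Ec; rewrite /= => ->.
    exact: (linear_sum (mklin (@ev_linear _ (res K) J (x - y)))).
  apply: big1 => i _; transitivity (c i *: (lfun (e i) x - lfun (e i) y)).
    by congr (_ *: _); exact: (linearB (e i)).
  by rewrite exy subrr scaler0.
pose T (u : 'I_n -> DK) := exists g : {linear K -> K},
  ~ bijective g /\ forall i x, lfun (u i) x = lfun (e i) (g x).
have sT : submod (T : ('I_n -> DK : lmodType k) -> Prop).
  split.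
    have [g [gN g0]] := nonbij0 K0; exists g; split=> // i x.
    by rewrite g0 [RHS]linear0.
  move=> a u v [g1 [b1 E1]] [g2 [b2 E2]].
  have [g [gN gE]] := nonbij_comb a Kl b1 b2; exists g; split=> // i x.
  rewrite gE; change (a *: lfun (u i) x + lfun (v i) x = lfun (e i) (a *: (g1 x : res K) + g2 x)).
  by rewrite linearP E1 E2.
have Te : ~ T e.
  move=> [g [gN gE]]; apply: gN; apply: (eq_bij (f := id)); first by exists id.
  by move=> x; apply: e_inj => i; rewrite -gE.
have [P [PT Pe]] := matlis_separate fk HJ (finlen_fct n fDK) sT Te.
(* By biduality the functional [P] on tuples of functionals is evaluation at a tuple of elements of
   [K]. *)
have [c cP] : exists c : 'I_n -> K, forall u, P u = \sum_i lfun (u i) (c i).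
  have H i : exists x : K, forall f : DK, P (dlt i f) = lfun f x.
    have [x xP] := matlis_bidual fk HJ (P \o mklin (@dlt_linear _ DK n i)) fresK.
    by exists x => f; rewrite -xP.
  exists (fun i => sval (cid (H i))) => u; rewrite [u in LHS]dlt_sum linear_sum.
  by apply: eq_bigr => i _; case: (cid (H i)) => x /= ->.
pose Rel (v : 'I_n -> res L^o) := forall y : K, \sum_i lfun (e i) ((v i : L) *: y) = 0.
have sRel : submod (Rel : ('I_n -> res L^o : lmodType k) -> Prop).
  split; first by move=> y; apply: big1 => i _; rewrite [_ *: _]scale0r [LHS]linear0.
  move=> a u v Ru Rv y.
  transitivity (a *: \sum_i lfun (e i) ((u i : L) *: y) + \sum_i lfun (e i) ((v i : L) *: y)).
    rewrite scaler_sumr -big_split; apply: eq_bigr => i _ /=.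
    rewrite -linearP; congr (lfun _ _).
    change ((phi a * (u i : L) + (v i : L)) *: y = phi a *: ((u i : L) *: y) + (v i : L) *: y).
    by rewrite scalerDl scalerA.
  by rewrite Ru Rv scaler0 addr0.
have [m [r rP]] := finlen_fin_gen_sub (finlen_fct n fL) sRel.
have rRel j : Rel (r j) by apply/rP; exists (fun j' => (j' == j)%:R);
  rewrite comb_delta.
(* [E] is the quotient by the image of [d], so in it each [c i] is identified with the tuple of the
   coefficients [r j i]. *)
pose d (l : 'I_n -> L^o) : K * ('I_m -> L^o) :=
  (comb c l, - (fun j => \sum_i (l i : L) * (r j i : L))).
have dl : linear d.
  move=> a u v; congr pair; first exact: (comb_linear c).
  rewrite /= scalerN -opprD; congr (- _); apply/funext => j.
  change (\sum_i (a * u i + v i) * (r j i : L) =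
    a * (\sum_i (u i : L) * (r j i : L)) + \sum_i (v i : L) * (r j i : L)).
  rewrite mulr_sumr -big_split; apply: eq_bigr => i _ /=.
  by rewrite mulrDl mulrA.
have sU := submod_im (mklin dl) (@submod_full _ _).
have [E [q [qs qU]]] := quotient_ex sU.
have fE : fin_gen E.
  apply: res_fin_gen; apply: (surj_finlen (f := reslin q)); first exact: qs.
  have il : linear (fun x : res (K * ('I_m -> L^o))%type => x : (res K * ('I_m ->
    res L^o))%type).
    by [].
  apply: (inj_finlen (f := mklin il)); first by [].
  exact: finlen_prod (finlen_fct m fL).
exists E, (q \o mklin (@inl_linear _ _ _)); split=> //.
- move=> [s sK]; apply: Pe; rewrite cP.
  pose w : {linear ('I_m -> L^o) -> K} := s \o q \o mklin (@inr_linear _ _ _).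
  (* A retraction would write [c i] as the combination of the elements [w (dlt j 1)] with
     coefficients [r j i]. Since each [r j] is a relation between the functionals [e i], this forces
     [P e = 0]. *)
  have Ec i : c i = \sum_j (r j i : L) *: w (dlt j (1 : L)).
    transitivity (w (fun j => r j i)).
      rewrite -[LHS]sK; congr (s _); apply/eqP; rewrite /= -subr_eq0 -linearB.
      apply/eqP/qU; exists (fun i' => (i' == i)%:R); split=> //; congr pair.
        by rewrite /= comb_delta subr0.
      rewrite /= sub0r; congr (- _); apply/funext => j.
      rewrite (bigD1 i) //= eqxx mul1r big1 ?addr0 // => i' /negPf ->.
      by rewrite mul0r.
    rewrite [X in w X](@dlt_sum L^o) linear_sum; apply: eq_bigr => j _.
    rewrite -linearZ; congr (w _); apply/funext => j'.
    change (dlt j (r j i : L) j' = (r j i : L) * dlt j (1 : L) j').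
    by rewrite /dlt; case: ifP => _; rewrite ?mulr1 ?mulr0.
  transitivity (\sum_(i < n) \sum_(j < m) lfun (e i) ((r j i : L) *: w (dlt j (1 : L)))).
    by apply: eq_bigr => i _; rewrite Ec [LHS]linear_sum.
  by rewrite exchange_big big1 // => j _; apply: rRel.
move=> X h fX hN; have fresX := fin_gen_res fX.
pose p (x : 'I_m -> res X) : 'I_n -> res X := fun i => \sum_j (r j i : L) *: (x j : X).
(* An extension of [h] to [E] amounts to images [x j] of the basis of [L ^ m] with [h (c i)] equal
   to the sum of the [r j i *: x j]. If there is none, a functional [S] separates the tuple of the
   [h (c i)] from the image of [p]. *)
have [[x xP]|xN] := pselect (exists x, forall i, h (c i) = p x i).
  have ul : linear (fun z : K * ('I_m -> L^o) => h z.1 + comb (x : 'I_m -> X) z.2).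
    move=> a [y u] [z v].
    change (h (a *: y + z) + comb (x : 'I_m -> X) (a *: u + v) =
      a *: (h y + comb (x : 'I_m -> X) u) + (h z + comb (x : 'I_m -> X) v)).
    by rewrite linearP (comb_linear (x : 'I_m -> X)) scalerDr addrACA.
  have [z /qU[l [_ <-]]|g gE] := factor_surj (h := mklin ul) qs.
    apply/eqP; rewrite /= (combN (x : 'I_m -> X)) subr_eq0; apply/eqP.
    transitivity (\sum_i (l i : L) *: (h (c i) : X)).
      by rewrite /comb linear_sum; apply: eq_bigr => i _; rewrite linearZ.
    under eq_bigr do rewrite xP scaler_sumr.
    rewrite exchange_big /comb; apply: eq_bigr => j _.
    by rewrite scaler_suml; apply: eq_bigr => i _; rewrite scalerA.
  exists g => y; rewrite /= gE /= /comb big1 ?addr0 // => j _.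
  exact: scale0r.
exfalso; have pl : linear p.
  move=> a u v; apply/funext => i.
  change (p (a *: u + v) i = phi a *: (p u i : X) + p v i).
  rewrite /p scaler_sumr -big_split /=; apply: eq_bigr => j _.
  change ((r j i : L) *: (phi a *: (u j : X) + (v j : X)) =
    phi a *: ((r j i : L) *: (u j : X)) + (r j i : L) *: (v j : X)).
  by rewrite scalerDr !scalerA phiC.
pose T' (w : 'I_n -> res X) := exists x, True /\ p x = w.
have sT' : submod (T' : ('I_n -> res X : lmodType k) -> Prop).
  exact: (submod_im (mklin pl) (@submod_full _ _)).
have [|S [ST Sc]] := @matlis_separate _ fk _ HJ ('I_n -> res X : lmodType k)
    T' (fun i => h (c i)) (finlen_fct n fresX) sT'.
  by move=> [x [_ Ex]]; apply: xN; exists x => i; rewrite Ex.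
(* As a function of [v], the right side kills the relations, so it factors through the functional
   [B v] on [K]. It extends to all functionals, and by biduality the extension is evaluation at some
   [y]. *)
have G (x : X) : exists y : K, forall v : 'I_n -> L,
    \sum_i lfun (e i) (v i *: y) = S (fun i => v i *: x).
  pose b (v : 'I_n -> res L^o) (y : res K) : J :=
    \sum_i lfun (e i) ((v i : L) *: (y : K)).
  have bl v : linear (b v).
    move=> a y z; rewrite /b scaler_sumr -big_split; apply: eq_bigr => i _ /=.
    rewrite -linearP; congr (lfun _ _).
    change ((v i : L) *: (phi a *: (y : K) + (z : K)) =
      phi a *: ((v i : L) *: (y : K)) + (v i : L) *: (z : K)).
    by rewrite scalerDr !scalerA phiC.
  pose B v : DK := mkhom (mklin (bl v)).
  have Bl : linear B.
    move=> a u v; apply: lhomP => y.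
    change (b (a *: u + v) y = a *: b u y + b v y).
    rewrite /b scaler_sumr -big_split; apply: eq_bigr => i _ /=.
    rewrite -linearP; congr (lfun _ _).
    change ((phi a * (u i : L) + (v i : L)) *: (y : K) =
      phi a *: ((u i : L) *: (y : K)) + (v i : L) *: (y : K)).
    by rewrite scalerDl scalerA.
  have Sl : linear (fun v : 'I_n -> res L^o => S (fun i => (v i : L) *: x)).
    move=> a u v; rewrite -linearP; congr (S _); apply/funext => i.
    change ((phi a * (u i : L) + (v i : L)) *: x =
      phi a *: ((u i : L) *: x) + (v i : L) *: x).
    by rewrite scalerDl scalerA.
  have [v Bv0|t tE] := matlis_ext HJ (p := mklin Bl) (h := mklin Sl) fDK.
    have /rP[a Ea] : Rel v.
      by move=> y; have := congr1 (fun f : DK => lfun f y) Bv0.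
    apply: ST; exists (fun j => phi (a j) *: x); split=> //; apply/funext => i.
    rewrite /p Ea /comb fct_sumE scaler_suml; apply: eq_bigr => j _.
    change ((r j i : L) *: (phi (a j) *: x) = (phi (a j) * (r j i : L)) *: x).
    by rewrite scalerA phiC.
  have [y yP] := matlis_bidual fk HJ t fresK; exists y => v.
  by rewrite -[RHS]tE /= yP.
pose g x := sval (cid (G x)).
have gE x v : \sum_i lfun (e i) (v i *: g x) = S (fun i => v i *: x).
  by rewrite /g; case: cid.
have e_sum (i : 'I_n) (y : K) :
    \sum_i' lfun (e i') (dlt i (1 : L) i' *: y) = lfun (e i) y.
  rewrite (bigD1 i) //= /dlt eqxx scale1r big1 ?addr0 // => i' /negPf ->.
  by rewrite scale0r linear0.
have gl : linear g.
  move=> a x y; apply: e_inj => i; rewrite -[LHS]e_sum gE.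
  rewrite -[RHS]e_sum.
  transitivity (\sum_i' (lfun (e i') ((dlt i (1 : L) i' * a) *: g x) +
      lfun (e i') (dlt i (1 : L) i' *: g y))).
    rewrite big_split /= !gE -linearD; congr (S _); apply/funext => i'.
    by rewrite /= scalerDr scalerA.
  by apply: eq_bigr => i' _; rewrite scalerDr scalerA -linearD.
(* [g \o h] is not bijective because [h] has no retraction, so [P] vanishes on its tuple. By the
   choice of [g] this value is [S] at the [h (c i)], which is nonzero. *)
have TN : T (fun i => mkhom (e i \o reslin (mklin gl \o h))).
  exists (mklin gl \o h); split=> // /linear_inv[g' [g'K _]]; apply: hN.
  by exists (g' \o mklin gl) => y; apply: g'K.
apply: Sc; rewrite -[RHS](PT _ TN) cP [X in S X]dlt_sum linear_sum.
apply: eq_bigr => i _; rewrite /= -[RHS]e_sum gE; congr (S _); apply/funext => i'.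
by rewrite /dlt; case: ifP => _; rewrite ?scale1r ?scale0r.
Qed.

End Restriction.

(** * Subcategories of modules *)

Lemma abstract_finite_type (C : imcat) : left_almost_split C ->
  (exists C0 : ob C, forall X, ~ zob X -> exists f : hom C0 X, f <> 0) ->
  ~ (exists (X : nat -> ob C) (f : forall i, hom (X i) (X i.+1)),
      forall i, [/\ ind (X i), inj (f i) & ~ iso (f i)]) ->
  fin_isom (@ind C).
Proof. by move=> las [C0 C0P] /proper_ext_acc; apply: ind_fin C0P. Qed.

(** * The opposite category *)

Section Opposite.
Context (C : imcat).

Lemma op_biproduct (A B X : ob C) (i1 : hom A X) (p1 : hom X A) (i2 : hom B X)
    (p2 : hom X B) : biproduct_eqs (@idm C) (@comp C) i1 p1 i2 p2 ->
  @biproduct_eqs (ob C) (fun X Y => hom Y X) (@idm C)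
    (fun X Y Z g f => comp f g) A B X p1 i1 p2 i2.
Proof. by case. Qed.

Definition opcat : imcat.
Proof.
refine (@ImCat (ob C) (fun X Y => hom Y X) (@idm C) (fun X Y Z g f => comp f g)
  (fun X Y => @surj C Y X) (fun X Y => @inj C Y X) (@len C)
  _ _ _ _ _ _ _ _ _ _ _ _ _ _ _ _ _ _ _ _).
- by move=> *; rewrite compA.
- by move=> *; apply: compm1.
- by move=> *; apply: comp1m.
- by move=> *; apply: compDr.
- by move=> *; apply: compDl.
- exact: surj_id.
- by move=> X Y Z g f gs fs; apply: surj_comp.
- by move=> X Y Z g f; apply: surj_cancel.
- exact: inj_id.
- by move=> X Y Z g f gs fs; apply: inj_comp.
- by move=> X Y Z g f; apply: inj_cancel.
- by move=> X Y f; have [I [m [e [-> mi es]]]] := image_ex f; exists I, e, m.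
- by move=> X Y f; apply: surj_len.
- by move=> X Y f fs le; have [g [gf fg]] := surj_iso fs le; exists g.
- by move=> X Y f; apply: inj_len.
- by move=> X Y f fs le; have [g [gf fg]] := inj_iso fs le; exists g.
- exact: len0.
- exact: zero_ex.
- move=> A B; have [X [i1 [p1 [i2 [p2 bip]]]]] := biproduct_ex A B.
  by exists X, p1, i1, p2, i2; apply: op_biproduct.
- move=> A X s r sr; have [B [s' [r' bip]]] := complement_ex sr.
  by exists B, r', s'; apply: op_biproduct.
Defined.

Lemma op_ind (X : ob C) : @ind opcat X <-> @ind C X.
Proof.
split=> -[X0 Xi]; split=> // A B i1 p1 i2 p2 [e1 e2 e3 e4 e5].
  by apply: (Xi A B p1 i1 p2 i2); split.
by apply: (Xi A B p1 i1 p2 i2); split.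
Qed.

Lemma op_iso (X Y : ob C) (f : hom Y X) : @iso opcat X Y f <-> @iso C Y X f.
Proof. by split=> -[g [gf fg]]; exists g. Qed.

End Opposite.

(** * Module subcategories as categories with images *)

Section ModuleCategory.
Context (k : comPzRingType) (L : pzRingType) (phi : {rmorphism k -> L}).
Context (fL : finlen (res phi L^o : lmodType k)).
Context (C : lmodType L -> Prop).
Context (Cfg : forall M, C M -> fin_gen M).
Context (Cadd : additive_subcategory C).
Context (Csum : closed_under_summands C).
Context (Cim : closed_under_images C).

Local Notation cob := {M : lmodType L | C M}.
Local Notation chom := (fun M N : cob => lhom (sval M) (sval N) : zmodType).

Definition lhom_id (M : lmodType L) : lhom M M := mkhom idfun.
Definition lhom_comp (M N P : lmodType L) (g : lhom N P) (f : lhom M N) : lhom M P :=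
  mkhom (g \o f).

Lemma C_finlen (M : cob) : finlen (res phi (sval M) : lmodType k).
Proof. by apply: fin_gen_res => //; apply: Cfg; case: M. Qed.

Lemma zero_obj : exists M : cob, zero_module (sval M).
Proof.
have [Z [p [ps pz]]] := quotient_ex (@submod_full _ (L^o : lmodType L)).
have Z0 : zero_module Z by move=> x; have [y <-] := ps x; apply/pz.
by exists (exist _ Z (Cadd.1 Z Z0)).
Qed.

Lemma lhom_iso (M N : lmodType L) (f : lhom M N) : injective f -> surjective f ->
  exists g : lhom N M, lhom_comp g f = lhom_id M /\ lhom_comp f g = lhom_id N.
Proof.
move=> fi fs; have [g [gf fg]] := linear_inv (bijP fi fs).
by exists (mkhom g); split; apply: lhomP => x; [apply: gf | apply: fg].
Qed.

Lemma prod_biproduct (M N P : lmodType L) (f : {linear P ->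
  (M * N)%type}) (g : {linear (M * N)%type -> P}) :
  cancel f g -> cancel g f ->
  exists (i1 : lhom M P) (p1 : lhom P M) (i2 : lhom N P) (p2 : lhom P N),
  [/\ lhom_comp p1 i1 = lhom_id M, lhom_comp p2 i2 = lhom_id N,
      lhom_comp p1 i2 = 0, lhom_comp p2 i1 = 0
    & lhom_comp i1 p1 + lhom_comp i2 p2 = lhom_id P].
Proof.
move=> fg gf.
exists (mkhom (g \o mklin (@inl_linear _ M N))),
  (mkhom (mklin (@fst_linear _ M N) \o f)).
exists (mkhom (g \o mklin (@inr_linear _ M N))),
  (mkhom (mklin (@snd_linear _ M N) \o f)).
split; apply: lhomP => x /=; rewrite ?gf //.
change (g ((f x).1, 0) + g (0, (f x).2) = x).
rewrite -linearD -[RHS]fg; congr (g _).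
by rewrite [RHS]surjective_pairing; congr pair; rewrite /= ?addr0 ?add0r.
Qed.

Definition modcat : imcat.
Proof.
refine (@ImCat cob chom (fun M => lhom_id (sval M))
  (fun M N P => @lhom_comp (sval M) (sval N) (sval P))
  (fun M N f => injective f) (fun M N f => surjective f)
  (fun M => flen (res phi (sval M) : lmodType k))
  _ _ _ _ _ _ _ _ _ _ _ _ _ _ _ _ _ _ _ _).
- by move=> W X Y Z h g f; apply: lhomP.
- by move=> X Y f; apply: lhomP.
- by move=> X Y f; apply: lhomP.
- by move=> X Y Z g h f; apply: lhomP.
- move=> X Y Z g h f; apply: lhomP => x.
  exact: linearD.
- by move=> X x y.
- by move=> X Y Z g f gi fi x y /gi/fi.
- by move=> X Y Z g f gfi x y E; apply: gfi; rewrite /= E.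
- by move=> X y; exists y.
- move=> X Y Z g f gs fs z; have [y <-] := gs z; have [x <-] := fs y.
  by exists x.
- by move=> X Y Z g f gfs z; have [x Ex] := gfs z; exists (f x).
- move=> X Y f; have CI := Cim (f : {linear _ -> _}) (svalP X) (svalP Y).
  pose m : {linear lin_image (f : {linear _ -> _}) -> sval Y} := val.
  have [x|e eE] := @lift_inj _ _ _ _ m (f : {linear _ -> _}) val_inj.
    have fx : f x \in in_image (f : {linear _ -> _}) by apply/asboolP; exists x.
    by exists (LinImage fx).
  exists (exist _ _ CI), (mkhom m), (mkhom e); split=> //.
  + by apply: lhomP => x; apply/esym/eE.
  + case=> y yP; have /asboolP[x Ex] := yP; exists x; apply: val_inj.
    exact: etrans (eE x) Ex.
- by move=> X Y f fi; apply: (flen_inj (f := reslin phi f)) => //; apply: C_finlen.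
- move=> X Y f fi le; apply: lhom_iso => //.
  by apply: (inj_flen_surj (f := reslin phi f)) => //; apply: C_finlen.
- by move=> X Y f fs; apply: (flen_surj (f := reslin phi f)) => //; apply: C_finlen.
- move=> X Y f fs le; apply: lhom_iso => //.
  by apply: (surj_flen_inj (f := reslin phi f)) => //; apply: C_finlen.
- move=> X; have [bX mX] := flenP (C_finlen X); split=> [X0|X0].
    by rewrite X0 in bX; move/bnd0P: bX => z; apply: lhomP => x; apply: z.
  apply/eqP; rewrite -leqn0; apply: mX; apply/bnd0P => x.
  exact: (congr1 (fun f : lhom (sval X) (sval X) => f x) X0).
- have [Z Z0] := zero_obj; exists Z; apply: lhomP => x; exact: Z0.
- move=> A B; have [i1 [p1 [i2 [p2 bip]]]] :=
    @prod_biproduct (sval A) (sval B) (sval A * sval B)%type idfun idfun (fun=> erefl) (fun=> erefl).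
  by exists (exist _ _ (Cadd.2 _ _ (svalP A) (svalP B))), i1, p1, i2, p2.
(* The complement is the image of the idempotent [1 - s r], which lies in [C] by closure under
   images. *)
- move=> A X s r rs.
  pose t : {linear sval X -> sval X} := lhom_id (sval X) - lhom_comp s r.
  have CI := Cim t (svalP X) (svalP X).
  pose m : {linear lin_image t -> sval X} := val.
  have [x|e eE] := @lift_inj _ _ _ _ m t val_inj.
    have fx : t x \in in_image t by apply/asboolP; exists x.
    by exists (LinImage fx).
  have rsK x : r (s x) = x.
    exact: (congr1 (fun f : lhom (sval A) (sval A) => f x) rs).
  have tE x : t x = x - s (r x) by [].
  have rt x : r (t x) = 0.
    have E : r (x - s (r x)) = r x - r (s (r x)) by apply: (linearB r).
    by rewrite tE E rsK subrr.
  have rm y : r (m y) = 0.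
    by case: y => y yP; have /asboolP[x Ex] := yP; rewrite /m /= -(rt x) Ex.
  have tm y : t (m y) = m y by rewrite tE rm linear0 subr0.
  exists (exist _ _ CI), (mkhom m), (mkhom e); split=> //; apply: lhomP => x.
  + by apply: val_inj; apply: etrans (eE _) (tm _).
  + exact: rm.
  + by apply: val_inj; apply: etrans (eE _) _; rewrite tE rsK subrr.
  + change (s (r x) + m (e x) = x).
    by rewrite eE tE addrC subrK.
Defined.

Lemma modcat_zob (X : ob modcat) : zob X <-> zero_module (sval X).
Proof.
split=> [X0 x|X0]; last by apply: lhomP => x; apply: X0.
exact: (congr1 (fun f : lhom (sval X) (sval X) => f x) X0).
Qed.

Lemma modcat_iso (X Y : ob modcat) (f : hom X Y) :
  iso f <-> bijective (f : lhom (sval X) (sval Y)).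
Proof.
split=> [[g [gf fg]]|].
  exists (g : lhom (sval Y) (sval X)) => x.
    exact: (congr1 (fun f : lhom (sval X) (sval X) => f x) gf).
  exact: (congr1 (fun f : lhom (sval Y) (sval Y) => f x) fg).
move=> fb; apply: lhom_iso; first exact: bij_inj.
by case: fb => g _ gK y; exists (g y).
Qed.

(** Closure under summands makes indecomposability inside [C] agree with that among all modules:
    both factors of a decomposition lie in [C], the second after swapping them. *)
Lemma modcat_ind (X : ob modcat) : ind X <-> indecomposable (sval X).
Proof.
split=> -[X0 Xi].
  split; first by move/modcat_zob.
  move=> A B XAB; have [f fb] := XAB; have [g [fK gK]] := linear_inv fb.
  have CA : C A := Csum (svalP X) XAB.
  have CB : C B.
    apply: Csum (svalP X) _.
    have sl (M N : lmodType L) : linear (fun z : M * N => (z.2, z.1)) by [].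
    exists (mklin (@sl A B) \o f); exists (g \o mklin (@sl B A)) => x /=.
      by rewrite -[RHS]fK; congr (g _); case: (f x).
    by rewrite gK; case: x.
  have [i1 [p1 [i2 [p2 bip]]]] := prod_biproduct fK gK.
  have [/modcat_zob A0|/modcat_zob B0] :=
    Xi (exist _ A CA) (exist _ B CB) i1 p1 i2 p2 bip.
    by left.
  by right.
split; first by move/modcat_zob.
move=> A B i1 p1 i2 p2 [e1 e2 e3 e4 e5].
have ev (M N : lmodType L) (f g : lhom M N) x : f = g -> f x = g x by move=> ->.
have XAB : isomorphic (sval X) (sval A * sval B)%type.
  have fl : linear (fun x => (lfun p1 x, lfun p2 x)).
    by move=> a x y; congr pair; apply: linearP.
  exists (mklin fl).
  exists (fun z => lfun i1 z.1 + lfun i2 z.2) => x /=; first exact: (ev _ _ _ _ x e5).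
  have E (M N P : lmodType L) (g : lhom N P) (f : lhom M N) y : g (f y) = lhom_comp g f y by [].
  case: x => x y /=; congr pair.
    apply: etrans (linearD (p1 : lhom _ _) _ _) _; rewrite /= !E.
    by rewrite (ev _ _ _ _ x e1) (ev _ _ _ _ y e3) addr0.
  apply: etrans (linearD (p2 : lhom _ _) _ _) _; rewrite /= !E.
  by rewrite (ev _ _ _ _ x e4) (ev _ _ _ _ y e2) add0r.
by have [A0|B0] := Xi _ _ XAB; [left | right]; apply/modcat_zob.
Qed.

(** Composition with the inverse of [g] reduces to a sum equal to the identity, to which [ind_local]
    applies. *)
Lemma indecomposable_local (M : lmodType L) : C M -> indecomposable M -> local_end M.
Proof.
move=> CM Mi g1 g2 g E /linear_inv[g' [g'K gK]].
pose X : ob modcat := exist _ M CM.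
have Xi : ind X by apply/modcat_ind.
have bij_of (h : {linear M -> M}) : iso (mkhom (g' \o h) : @hom modcat X X) ->
  bijective h.
  move=> /modcat_iso b; apply: (eq_bij (f := g \o (g' \o h))); last by move=> x;
    apply: gK.
  by apply: bij_comp => //; exists g'.
have [|b|b] := @ind_local modcat X (mkhom (g' \o g1)) (mkhom (g' \o g2)) Xi.
- apply: lhomP => x; rewrite -[RHS]g'K E.
  exact/esym/linearD.
- by left; apply: bij_of.
- by right; apply: bij_of.
Qed.

Lemma fin_isom_frt : fin_isom (@ind modcat) -> finite_representation_type C.
Proof.
move=> [s Hs]; have [Z _] := zero_obj.
exists (List.length s), (fun i : 'I_(List.length s) => sval (List.nth i s Z)) =>
  M CM Mi.
have [|Y [Ys [f /modcat_iso fb]]] := Hs (exist _ M CM); first exact/modcat_ind.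
have [n [nlt En]] := List.In_nth _ _ Z Ys.
have ns : (n < List.length s)%N by apply/ssrnat.ltP.
by exists (Ordinal ns); rewrite /= En; exists f.
Qed.

Lemma monos_noch : monos_noetherian C ->
  ~ (exists (X : nat -> ob modcat) (f : forall i, hom (X i) (X i.+1)),
      forall i, [/\ ind (X i), inj (f i) & ~ iso (f i)]).
Proof.
move=> noe [X [f fP]].
have Xi i : indecomposable (sval (X i)) by apply/modcat_ind; case: (fP i).
pose g i : {linear sval (X i) -> sval (X i.+1)} := (f i : lhom _ _).
have gi i : injective (g i) by case: (fP i).
pose F i := ModMorphism (g i).
have [|i|i|d Hd] := noe nat F _ (fun i => sval (X i)) g.
- move=> i; split; last exact: gi.
  by split; [apply: svalP | apply: Xi | apply: svalP | apply: Xi].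
- by exists i.
- have [x x0] : exists x : sval (X 0%N), x <> 0.
    apply: contrapT => H; case: (Xi 0%N) => X0 _; apply: X0 => x.
    by apply: contrapT => x0; apply: H; exists x.
  exists x; elim: i.+1 => [|j IH] //= E; apply: IH; apply: gi.
  by rewrite linear0.
by case: (fP d) => _ _; apply; apply/modcat_iso; apply: Hd.
Qed.

Lemma epis_noch : epis_conoetherian C ->
  ~ (exists (X : nat -> ob (opcat modcat)) (f : forall i, hom (X i) (X i.+1)),
      forall i, [/\ ind (X i), inj (f i) & ~ iso (f i)]).
Proof.
move=> noe [X [f fP]].
have Xi i : indecomposable (sval (X i)).
  by apply/modcat_ind/op_ind; case: (fP i).
pose g i : {linear sval (X i.+1) -> sval (X i)} := (f i : lhom _ _).
have gs i : surjective (g i) by case: (fP i).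
pose F i := ModMorphism (g i).
have [|i|i|d Hd] := noe nat F _ (fun i => sval (X i)) g.
- move=> i; split; last exact: gs.
  by split; [apply: svalP | apply: Xi | apply: svalP | apply: Xi].
- by exists i.
- have [x x0] : exists x : sval (X 0%N), x <> 0.
    apply: contrapT => H; case: (Xi 0%N) => X0 _; apply: X0 => x.
    by apply: contrapT => x0; apply: H; exists x.
  suff [y yx] : exists y, cochain_comp g i.+1 y = x by exists y; rewrite yx.
  elim: i.+1 => [|j [y yx]]; first by exists x.
  by have [z zy] := gs j y; exists z; rewrite /= zy.
by case: (fP d) => _ _; apply; apply/op_iso/modcat_iso; apply: Hd.
Qed.

Lemma frt_len : finite_representation_type C -> exists b, forall M : lmodType L,
  C M -> indecomposable M -> (flen (res phi M : lmodType k) <= b)%N.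
Proof.
move=> [n [N HN]]; exists (\max_(i < n) flen (res phi (N i) : lmodType k)).
move=> M CM Mi; have [i [f fb]] := HN M CM Mi.
have [g [fK gK]] := linear_inv fb.
apply: leq_trans (leq_bigmax i); apply: (flen_inj (f := reslin phi f)).
  exact: can_inj fK.
apply: (surj_finlen (f := reslin phi f)); first by move=> y; exists (g y); apply: gK.
exact: (C_finlen (exist _ M CM)).
Qed.

Lemma bounded_seq_stable (u : nat -> nat) b : (forall i, (u i <= u i.+1)%N) ->
  (forall i, (u i <= b)%N) -> exists d, forall i, (d <= i)%N -> (u i.+1 <= u i)%N.
Proof.
move=> umono ub; pose p n := `[< exists i, u i = n >].
have p1 : exists n, p n by exists (u 0%N); apply/asboolP; exists 0%N.
have pb n : p n -> (n <= b)%N by move=> /asboolP[i <-].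
case: (ex_maxnP p1 pb) => n /asboolP[d ud] nmax; exists d => i di.
apply: (@leq_trans n); first by apply: nmax; apply/asboolP; exists i.+1.
by rewrite -ud -(subnKC di); elim: (i - d)%N => [|j IH];
  rewrite ?addn0 // addnS (leq_trans IH).
Qed.

(** Lengths grow along the chain and are bounded, so they become constant; an injective map between
    modules of equal length is bijective. *)
Lemma frt_monos : finite_representation_type C -> monos_noetherian C.
Proof.
move=> /frt_len[b Hb] J f Hf X g gf _.
have gP i : [/\ C (X i), indecomposable (X i), C (X i.+1) & injective (g i)].
  by have [j Ej] := gf i; have := Hf j; rewrite Ej => -[[/= ? ? ? ?] ?].
have fl i : finlen (res phi (X i) : lmodType k).
  by case: (gP i) => CX *; apply: (C_finlen (exist _ _ CX)).
have gi i : injective (reslin phi (g i)) by case: (gP i).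
have [i|i|d Hd] := @bounded_seq_stable (fun i => flen (res phi (X i) : lmodType k)) b.
- exact: flen_inj (gi i) (fl _).
- by case: (gP i) => CX Xi _ _; apply: Hb.
exists d => i di; apply: bijP; first exact: gi.
exact: (inj_flen_surj (gi i) (fl _) (Hd i di)).
Qed.

Lemma frt_epis : finite_representation_type C -> epis_conoetherian C.
Proof.
move=> /frt_len[b Hb] J f Hf X g gf _.
have gP i : [/\ C (X i), indecomposable (X i), C (X i.+1) & surjective (g i)].
  by have [j Ej] := gf i; have := Hf j; rewrite Ej => -[[/= ? ? ? ?] ?].
have fl i : finlen (res phi (X i) : lmodType k).
  by case: (gP i) => CX *; apply: (C_finlen (exist _ _ CX)).
have gs i : surjective (reslin phi (g i)) by case: (gP i).
have [i|i|d Hd] := @bounded_seq_stable (fun i => flen (res phi (X i) : lmodType k)) b.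
- exact: flen_surj (gs i) (fl _).
- by case: (gP i) => CX Xi _ _; apply: Hb.
exists d => i di; apply: bijP; last exact: gs.
exact: (surj_flen_inj (gs i) (fl _) (Hd i di)).
Qed.

End ModuleCategory.

Section FinitelyGenerated.
Context (k : comPzRingType) (L : pzRingType) (phi : {rmorphism k -> L}).
Context (fL : finlen (res phi L^o : lmodType k)).

Lemma fin_gen_surj (M N : lmodType L) (f : {linear M -> N}) :
  surjective f -> fin_gen M -> fin_gen N.
Proof.
move=> fs /(fin_gen_res fL) fM; apply: (@res_fin_gen _ _ phi).
exact: (surj_finlen (f := reslin phi f)).
Qed.

Lemma fin_gen_inj (M N : lmodType L) (f : {linear M -> N}) :
  injective f -> fin_gen N -> fin_gen M.
Proof.
move=> fi /(fin_gen_res fL) fN; apply: (@res_fin_gen _ _ phi).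
exact: (inj_finlen (f := reslin phi f)).
Qed.

Lemma fin_gen_additive : additive_subcategory (@fin_gen L).
Proof.
split=> [M M0|M N fM fN].
  by exists 0%N, (fun=> 0) => x; exists (fun=> 0); rewrite big_ord0.
apply: (@res_fin_gen _ _ phi).
have il : linear (fun x : res phi (M * N)%type =>
  x : (res phi M * res phi N)%type) by [].
apply: (inj_finlen (f := mklin il)); first by [].
by apply: finlen_prod; apply: fin_gen_res.
Qed.

Lemma fin_gen_summands : closed_under_summands (@fin_gen L).
Proof.
move=> M A B fM [f [g _ gK]]; apply: (fin_gen_surj (f :=
  mklin (@fst_linear _ A B) \o f)) fM.
by move=> a; exists (g (a, 0)); rewrite /= gK.
Qed.

Lemma fin_gen_images : closed_under_images (@fin_gen L).
Proof.
move=> M N f _; apply: (fin_gen_inj (f := (val : {linear lin_image f -> N}))).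
exact: val_inj.
Qed.

Lemma fin_gen_functorially_finite : functorially_finite (@fin_gen L).
Proof.
by move=> X fX; split; exists X, idfun; split=> // A f _; exists f.
Qed.

Lemma fin_gen_regular : fin_gen (L^o : lmodType L).
Proof. exact: res_fin_gen fL. Qed.

End FinitelyGenerated.

(** * Almost split morphisms and sources in the subcategory *)

Section Subcategory.
Context (k : comPzRingType) (L : pzRingType) (phi : {rmorphism k -> L}).
Context (phiC : forall a x, GRing.comm (phi a) x).
Context (fk : finlen (k^o : lmodType k)).
Context (fL : finlen (res phi L^o : lmodType k)).
Context (C : lmodType L -> Prop).
Context (Cfg : forall M, C M -> fin_gen M).
Context (Cadd : additive_subcategory C).
Context (Csum : closed_under_summands C).
Context (Cff : functorially_finite C).
Context (Cim : closed_under_images C).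

Let cat := modcat fL Cfg Cadd Cim.

Lemma fin_gen_local (M : lmodType L) : fin_gen M -> indecomposable M -> local_end M.
Proof.
apply: (@indecomposable_local k L phi fL (@fin_gen L)) => //.
- exact: fin_gen_additive fL.
- exact: fin_gen_summands fL.
- exact: fin_gen_images fL.
Qed.

(** The almost split map of [K] among finitely generated modules is followed by a left approximation
    of its target: non-split maps into [C] still factor, and a retraction of the composite would
    restrict to one of the first map. *)
Lemma modcat_left : left_almost_split cat.
Proof.
move=> K /(modcat_ind Csum) Ki; have [J HJ] := matlis_ex fk.
have fK := Cfg (svalP K).
have [E [g [fE gN gP]]] :=
  left_almost_split_ex phiC fk fL HJ fK Ki.1 (fin_gen_local fK Ki).
have [[A [a [CA aP]]] _] := Cff fE.
exists (exist _ A CA), (mkhom (a \o g)); split.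
  move=> [r rE]; apply: gN; exists ((r : lhom A (sval K)) \o a) => x.
  exact: (congr1 (fun f : lhom (sval K) (sval K) => f x) rE).
move=> X h hN.
have [||h' h'E] := gP (sval X) (h : lhom _ _); first exact/Cfg/svalP.
  move=> [r rE]; apply: hN; exists (mkhom r); apply: lhomP => x; exact: rE.
have [b bE] := aP (sval X) h' (svalP X).
by exists (mkhom b); apply: lhomP => x; rewrite h'E bE.
Qed.

Lemma modcat_right : left_almost_split (opcat cat).
Proof.
move=> K /op_ind/(modcat_ind Csum) Ki; have [J HJ] := matlis_ex fk.
have fK := Cfg (svalP K).
have [E [g [fE gN gP]]] :=
  right_almost_split_ex phiC fk fL HJ fK Ki.1 (fin_gen_local fK Ki).
have [_ [A [a [CA aP]]]] := Cff fE.
exists (exist _ A CA), (mkhom (g \o a)); split.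
  move=> [r rE]; apply: gN; exists (a \o (r : lhom (sval K) A)) => x.
  exact: (congr1 (fun f : lhom (sval K) (sval K) => f x) rE).
move=> X h hN.
have [||h' h'E] := gP (sval X) (h : lhom (sval X) (sval K)); first exact/Cfg/svalP.
  move=> [r rE]; apply: hN; exists (mkhom r); apply: lhomP => x; exact: rE.
have [b bE] := aP (sval X) h' (svalP X).
by exists (mkhom b); apply: lhomP => x; rewrite h'E bE.
Qed.

(** Take a left approximation of the regular module: for [x <> 0] in [X], the map from [L] to [X]
    sending 1 to [x] factors through it. *)
Lemma modcat_source : exists C0 : ob cat, forall X, ~ zob X -> exists f : hom C0 X,
  f <> 0.
Proof.
have [[A [a [CA aP]]] _] := Cff (fin_gen_regular fL).
exists (exist _ A CA) => X XN.
have [x x0] : exists x : sval X, x <> 0.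
  apply: contrapT => H; apply: XN; apply/modcat_zob => x.
  by apply: contrapT => x0; apply: H; exists x.
have xl : linear (fun l : L^o => (l : L) *: (x : sval X)) by move=> l u v;
  rewrite scalerDl scalerA.
have [b bE] := aP (sval X) (mklin xl) (svalP X).
exists (mkhom b) => b0; apply: x0.
have := bE 1; rewrite /= scale1r => ->.
exact: (congr1 (fun f : lhom A (sval X) => f (a 1)) b0).
Qed.

(** Dually, take a right approximation of the cogenerator [dualm phi J 1], the module of functionals
    on [L]. *)
Lemma modcat_target : exists C0 : ob (opcat cat),
  forall X, ~ zob X -> exists f : hom C0 X, f <> 0.
Proof.
have [J HJ] := matlis_ex fk.
have fD : fin_gen (dualm phi J 1 : lmodType L).
  by apply: res_fin_gen; apply: finlen_dual.
have [_ [A [a [CA aP]]]] := Cff fD.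
exists (exist _ A CA) => X XN.
have X0 : ~ zero_module (sval X) by move=> X0; apply: XN;
  apply/(@modcat_zob _ _ _ fL _ Cfg Cadd Cim).
have [f [x fx]] := dual_cogen fk fL HJ (Cfg (svalP X)) X0.
have [b bE] := aP (sval X) f (svalP X).
exists (mkhom b) => b0; apply: fx; rewrite bE /=.
have -> : b x = 0 by exact: (congr1 (fun f : lhom (sval X) A => f x) b0).
exact: linear0.
Qed.

Lemma noetherian_finite_type : monos_noetherian C <-> finite_representation_type C.
Proof.
split=> [noe|]; last exact: (frt_monos fL).
apply: (@fin_isom_frt _ _ _ fL _ Cfg Cadd Csum Cim).
exact: abstract_finite_type modcat_left modcat_source
  (@monos_noch _ _ _ fL _ Cfg Cadd Csum Cim noe).
Qed.

Lemma conoetherian_finite_type : epis_conoetherian C <-> finite_representation_type C.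
Proof.
split=> [noe|]; last exact: (frt_epis fL).
apply: (@fin_isom_frt _ _ _ fL _ Cfg Cadd Csum Cim).
have [s Hs] := abstract_finite_type modcat_right modcat_target (@epis_noch _ _ _ fL _ Cfg Cadd Csum Cim noe).
exists s => X /op_ind/Hs[Y [Ys [f /op_iso fi]]]; exists Y; split=> //.
by apply: isom_sym; exists f.
Qed.

End Subcategory.

Lemma artin_algebra_finlen (L : pzRingType) : artin_algebra L ->
  exists (k : comPzRingType) (phi : {rmorphism k -> L}),
    [/\ forall a x, GRing.comm (phi a) x, finlen (k^o : lmodType k)
      & finlen (res phi L^o : lmodType k)].
Proof.
move=> [k [phi [kart phiC [n [e eP]]]]]; exists k, phi.
have fk := artinian_finlen kart; split=> //.
by apply: fin_gen_finlen => //; exists n, e => x; apply: eP.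
Qed.

Theorem corollary3p12 (L : pzRingType) (hL : artin_algebra L) :
  (forall C : lmodType L -> Prop,
     (forall M : lmodType L, C M -> fin_gen M) ->
     additive_subcategory C ->
     closed_under_summands C ->
     closed_under_isomorphisms C ->
     functorially_finite C ->
     closed_under_images C ->
     (monos_noetherian C <-> finite_representation_type C) /\
     (epis_conoetherian C <-> finite_representation_type C)) /\
  (monos_noetherian (@fin_gen L) <-> finite_representation_type (@fin_gen L)) /\
  (epis_conoetherian (@fin_gen L) <-> finite_representation_type (@fin_gen L)).
Proof.
have [k [phi [phiC fk fL]]] := artin_algebra_finlen hL.
have main C : (forall M : lmodType L, C M -> fin_gen M) -> additive_subcategory C ->
    closed_under_summands C -> functorially_finite C -> closed_under_images C ->
    (monos_noetherian C <-> finite_representation_type C) /\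
    (epis_conoetherian C <-> finite_representation_type C).
  move=> Cfg Cadd Csum Cff Cim; split.
    exact: (noetherian_finite_type phiC fk fL).
  exact: (conoetherian_finite_type phiC fk fL).
split; first by move=> C Cfg Cadd Csum _; apply: main.
apply: main => //; first exact: fin_gen_additive fL.
- exact: fin_gen_summands fL.
- exact: fin_gen_functorially_finite.
- exact: fin_gen_images fL.
Qed.
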